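(* Let $T>0$, let $\sigma:[0,T)\to\mathbb{R}$ be a smooth bounded function, and let $H:[0,\infty)\times\mathbb{T}^d\times\mathcal{P}(\mathbb{T}^d)\times\mathbb{R}^d\to\mathbb{R}$ be continuous (and differentiable in its last variable $p$). Assume there exists $C>0$ such that for all $p\in\mathbb{R}^d$, $s,t\ge 0$, $\mu,\nu\in\mathcal{P}(\mathbb{T}^d)$, $x,y\in\mathbb{T}^d$, $$|H(t,x,\mu,p)-H(s,y,\nu,p)|\le C(1+|p|)\big(|t-s|+W_2(\mu,\nu)+|x-y|\big),$$ and for all $t\in[0,T]$, $x\in\mathbb{T}^d$, $\mu\in\mathcal{P}(\mathbb{T}^d)$, $p\in\mathbb{R}^d$, $$|H(t,x,\mu,p)|\le C(1+|p|^2),\qquad |D_pH(t,x,\mu,p)|\le C(1+|p|).$$ Let $U,V:[0,T]\times\mathcal{P}(\mathbb{T}^d)\times\mathbb{T}^d\to\mathbb{R}$ be respectively a bounded viscosity sub-solution and a bounded viscosity super-solution of $$-\partial_tU(t,\mu,w)+\int_{\mathbb{T}^d}H(t,x,\mu,D_\mu U(t,\mu,w,x))\mu(dx)-\frac{\sigma^2(t)}{2}\Delta_wU=0\quad\text{in }(0,T)\times\mathcal{P}(\mathbb{T}^d)\times\mathbb{T}^d.$$ If $U(T,\mu,w)\le V(T,\mu,w)$ for all $\mu\in\mathcal{P}(\mathbb{T}^d)$, $w\in\mathbb{T}^d$, then $U\le V$.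
   Context: $\mathbb{T}^d=\mathbb{R}^d/\mathbb{Z}^d$; $\mathcal{P}(\mathbb{T}^d)$ is the set of Borel probability measures on $\mathbb{T}^d$ with the weak topology. For $x,y\in\mathbb{T}^d$, $|x-y|$ is the torus distance and $y-x\in\mathbb{R}^d$ denotes a (fixed, measurably chosen) representative of minimal norm. $\Pi(\mu,\mu')$ is the set of couplings and $W_2(\mu,\mu')^2=\inf_{\gamma\in\Pi(\mu,\mu')}\int|x-y|^2\gamma(dx,dy)$. $S_d(\mathbb{R})$ is the set of symmetric real $d\times d$ matrices. Super-jet. For $(t,\mu,w)\in[0,T)\times\mathcal{P}(\mathbb{T}^d)\times\mathbb{T}^d$, $J^+(U)(t,\mu,w)$ is the set of $(\theta,\psi,p,X)$ with $\theta\in\mathbb{R}$, $\psi:\mathbb{T}^d\to\mathcal{P}(\mathbb{R}^d)$ measurable such that the supports of $\psi(x,\cdot)$, $x\in\mathbb{T}^d$, lie in a common ball $B(0,R)$, $p\in\mathbb{R}^d$, $X\in S_d(\mathbb{R})$, such that for all $t'\ge t$, $\mu'\in\mathcal{P}(\mathbb{T}^d)$, $w'\in\mathbb{T}^d$, $\gamma\in\Pi(\mu,\mu')$, $$U(t',\mu',w')\le U(t,\mu,w)+\theta(t'-t)+\int\!\!\int z\cdot(y-x)\psi(x,dz)\gamma(dx,dy)+p\cdot(w'-w)+\tfrac12(w'-w)\cdot X(w'-w)+o\Big(|t'-t|+\Big(\int|x-y|^2d\gamma\Big)^{1/2}+|w'-w|^2\Big),$$ with $o(\cdot)$ uniform in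 $(t',\mu',w',\gamma)$. Also $J^-(U)(t,\mu,w)=\{(\theta,\psi,p,X):(-\theta,x\mapsto(-\mathrm{Id})_\#\psi(x,\cdot),-p,-X)\in J^+(-U)(t,\mu,w)\}$. With $\bar{\mathcal H}(t,\mu,\psi)=\int_{\mathbb{T}^d\times\mathbb{R}^d}H(t,x,\mu,z)\psi(x,dz)\mu(dx)$, a usc (resp. lsc) function $U$ is a viscosity sub-solution (resp. super-solution) if for all $(t,\mu,w)\in[0,T)\times\mathcal{P}(\mathbb{T}^d)\times\mathbb{T}^d$ and $(\theta,\psi,p,X)\in J^+(U)(t,\mu,w)$ (resp. $J^-(U)(t,\mu,w)$), $$-\theta+\bar{\mathcal H}(t,\mu,\psi)-\frac{\sigma^2(t)}{2}\mathrm{Tr}(X)\le0\quad(\text{resp. }\ge0).$$ *)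

(* Defs.v *)
From HB Require Import structures.
From mathcomp Require Import all_boot all_order all_algebra.
From mathcomp Require Import archimedean.
From mathcomp Require Import all_classical all_reals all_analysis.

Set Implicit Arguments.
Unset Strict Implicit.
Unset Printing Implicit Defensive.

Import Order.TTheory GRing.Theory Num.Theory.
Import numFieldNormedType.Exports.
Local Open Scope classical_set_scope.
Local Open Scope quotient_scope.
Local Open Scope ring_scope.

(* R^d is 'rV[R]_d.  The library norm `|v| on 'rV[R]_d is the sup norm; it
   induces the usual topology, but lengths are measured here with the
   Euclidean norm [enorm]. *)
Section euclidean.
Context {R : realType} {d : nat}.
Implicit Types u v : 'rV[R]_d.

Definition dot u v : R := \sum_(i < d) u 0 i * v 0 i.
Definition enorm v : R := Num.sqrt (dot v v).

Definition gradient (f : 'rV[R]_d -> R) (p : 'rV[R]_d) : 'rV[R]_d :=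
  \row_(i < d) 'D_('e_i) f p.

End euclidean.

Section borel_matrix.
Context {R : realType} {m n : nat}.
Local Notation opens := (@open 'M[R]_(m, n)).

HB.instance Definition _ := @isMeasurable.Build (sigma_display opens)
  'M[R]_(m, n) <<s opens >> (@sigma_algebra0 _ setT opens)
  (@sigma_algebraC _ opens) (@sigma_algebra_bigcup _ setT opens).

End borel_matrix.

Lemma measurable_opprV (R : realType) (d : nat) :
  measurable_fun setT (-%R : 'rV[R]_d -> 'rV[R]_d).
Proof.
apply: (measurability (@open 'rV[R]_d)) => //.
move=> _ [A oA <-]; rewrite setTI; apply: sub_gen_smallest.
by apply: open_comp => // x _; exact: opp_continuous.
Qed.

HB.instance Definition _ (R : realType) (d : nat) :=
  isMeasurableFun.Build _ _ 'rV[R]_d 'rV[R]_d -%R (@measurable_opprV R d).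

(* T^d is the quotient group R^d / Z^d with the quotient topology and the
   associated Borel sigma-algebra; its group law provides x - y. *)
Section torus_def.
Variables (R : realType) (d : nat).

Definition lattice : {pred 'rV[R]_d} := fun v => v \is a mxOver Num.int.

Lemma lattice_zmod_closed : zmod_closed lattice.
Proof.
split=> [|u v /mxOverP uZ /mxOverP vZ]; first exact: mxOver0.
by apply/mxOverP => i j; rewrite !mxE rpredB.
Qed.

HB.instance Definition _ :=
  GRing.isZmodClosed.Build 'rV[R]_d lattice lattice_zmod_closed.

Definition torus : Type := quotient_topology (Quotient.quot [the zmodClosed _ of lattice]).

HB.instance Definition _ := PointedTopological.on torus.
HB.instance Definition _ :=
  Quotient.copy torus (quotient_topology (Quotient.quot [the zmodClosed _ of lattice])).
HB.instance Definition _ := GRing.Zmodule.copy torus (Quotient.quot [the zmodClosed _ of lattice]).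

Local Notation opens := (@open torus).

HB.instance Definition _ := @isMeasurable.Build (sigma_display opens)
  torus <<s opens >> (@sigma_algebra0 _ setT opens)
  (@sigma_algebraC _ opens) (@sigma_algebra_bigcup _ setT opens).

End torus_def.

Section torus_metric.
Context {R : realType} {d : nat}.
Local Notation Td := (torus R d).
Local Notation Rd := 'rV[R]_d.
Implicit Types x y : Td.

Definition tdist x y : R :=
  inf [set enorm v | v in [set v : Rd | \pi_Td v = x - y]].

(* [delta x y] stands for the vector "x - y" of R^d : a jointly measurable
   choice of a representative of minimal Euclidean norm. *)
Definition minimal_difference (delta : Td -> Td -> Rd) : Prop :=
  measurable_fun [set: Td * Td] (fun q : Td * Td => delta q.1 q.2) /\
  forall x y, \pi_Td (delta x y) = x - y /\ enorm (delta x y) = tdist x y.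

End torus_metric.

Section wasserstein.
Variables (R : realType) (d : nat).
Local Notation Td := (torus R d).

Definition Ptorus : Type := probability Td R.

(* Weak topology of probability measures: the initial topology of the maps
   mu |-> \int f dmu, f continuous on the (compact) torus. *)
Definition continuous_integrals (mu : Ptorus) :
    {ptws {f : Td -> R | continuous f} -> R} :=
  fun f => \int[mu]_x (sval f x).

HB.instance Definition _ := Choice.copy Ptorus (probability Td R).
HB.instance Definition _ :=
  Topological.copy Ptorus (initial_topology continuous_integrals).

Definition coupling (mu nu : Ptorus) : set (probability (Td * Td)%type R) :=
  [set gamma : probability (Td * Td)%type R | forall A : set Td, measurable A ->
    gamma (fst @^-1` A) = mu A /\ gamma (snd @^-1` A) = nu A].

Definition transport_cost (gamma : probability (Td * Td)%type R) : R :=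
  \int[gamma]_q tdist q.1 q.2 ^+ 2.

Definition W2 (mu nu : Ptorus) : R :=
  Num.sqrt (inf [set transport_cost gamma | gamma in coupling mu nu]).

End wasserstein.

Section jets.
Variables (R : realType) (d : nat).
Local Notation Td := (torus R d).
Local Notation Pd := (Ptorus R d).
Local Notation Rd := 'rV[R]_d.

Definition msupport (nu : probability Rd R) : set Rd :=
  [set z | forall A, open A -> A z -> (0 < nu A)%E].

(* (theta, psi, p, X) *)
Definition jet : Type := (R * (Td -> pprobability Rd R) * Rd * 'M[R]_d)%type.

Definition opp_measure (nu : pprobability Rd R) : pprobability Rd R :=
  distribution nu (-%R : {mfun Rd >-> Rd}).

Definition neg_jet (j : jet) : jet :=
  let: (theta, psi, p, X) := j in
  (- theta, fun x => opp_measure (psi x), - p, - X).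

Section super.
Variables (delta : Td -> Td -> Rd) (T : R).
Implicit Type U : R -> Pd -> Td -> R.

(* U only matters on [0, T], so t' ranges over [t, T].  The uniform remainder
   o(.) is a single function omega, independent of (t', mu', w', gamma). *)
Definition superjet U (t : R) (mu : Pd) (w : Td) : set jet :=
  [set j : jet | let: (theta, psi, p, X) := j in
    [/\ measurable_fun setT psi,
        exists r, forall x, msupport (psi x) `<=` [set z | enorm z < r],
        X^T = X &
        exists2 omega : R -> R, omega =o_ (0 : R) id &
        forall t' mu' w' gamma, t <= t' <= T -> coupling mu mu' gamma ->
          U t' mu' w' <= U t mu w + theta * (t' - t)
            + \int[gamma]_q \int[psi q.1]_z dot z (delta q.2 q.1)
            + dot p (delta w' w)
            + 2^-1 * dot (delta w' w) (delta w' w *m X)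
            + omega (`|t' - t| + Num.sqrt (transport_cost gamma)
                     + tdist w' w ^+ 2)]].

Definition subjet U t mu w : set jet :=
  [set j : jet | superjet (fun t mu w => - U t mu w) t mu w (neg_jet j)].

End super.
End jets.

Section viscosity.
Variables (R : realType) (d : nat).
Local Notation Td := (torus R d).
Local Notation Pd := (Ptorus R d).
Local Notation Rd := 'rV[R]_d.
Variables (delta : Td -> Td -> Rd) (T : R) (sigma : R -> R)
  (H : R -> Td -> Pd -> Rd -> R).
Implicit Type U : R -> Pd -> Td -> R.

Definition space_time : set (R * Pd * Td) := [set q | 0 <= q.1.1 <= T].

(* Semicontinuity on [0, T] x P(T^d) x T^d for the subspace topology. *)
Definition lsc U : Prop :=
  lower_semicontinuous
    (fun q : subspace space_time => (U q.1.1 q.1.2 q.2)%:E).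

Definition usc U : Prop := lsc (fun t mu w => - U t mu w).

Definition Hbar (t : R) (mu : Pd) (psi : Td -> pprobability Rd R) : R :=
  \int[mu]_x \int[psi x]_z H t x mu z.

Definition jet_operator (t : R) (mu : Pd) (j : jet R d) : R :=
  let: (theta, psi, p, X) := j in
  - theta + Hbar t mu psi - sigma t ^+ 2 / 2 * \tr X.

Definition viscosity_subsolution U : Prop :=
  usc U /\ forall t mu w j, 0 <= t < T ->
    superjet delta T U t mu w j -> jet_operator t mu j <= 0.

Definition viscosity_supersolution U : Prop :=
  lsc U /\ forall t mu w j, 0 <= t < T ->
    subjet delta T U t mu w j -> 0 <= jet_operator t mu j.

End viscosity.

(* C^oo on a set that need not be open: restriction of a C^oo function defined
   on an open neighbourhood. *)
Definition smooth_on {R : realType} (A : set R) (f : R -> R) : Prop :=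
  exists (O : set R) (g : R -> R),
    [/\ open O, A `<=` O, forall t, A t -> g t = f t &
        forall n t, O t -> derivable (derive1n n g) t 1].

(* Main.v *)
(* The variables (t, mu, x) of U and (s, nu, y) of V are doubled, and one
   maximizes over couplings gam of mu and nu the functional
     U(t, mu, x) - V(s, nu, y) - c (T - t) - c (T - s)
       - k (int cost (p - q) dgam + cost (x - w) + cost (w - y)) - k^3 (t - s)^2,
   where cost x = sum_i (1 - cos (2 pi x_i)) is a smooth substitute for the
   squared distance.  At a maximum the coupling is frozen: mu is moved along
   plans over gam, and nu likewise, so that conditioning on the moved point
   turns the gradient of the cost into a random momentum psi, that is, into an
   element of the super-jet; this is what jets with measure-valued momenta are
   for.  In w the second-order information is only needed through the
   Laplacian, with the same coefficient sigma^2 up to small errors, so Ishii's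
   lemma is avoided: between the two sides one inserts the inf-convolution
   phi(w) = inf_y (v(y) + k cost (w - y)), and replaces it by a trigonometric sum
   close to (1 - Laplacian / a)^-1 phi, whose Laplacian compares at the touching
   points by the maximum principle.  Subtracting the two inequalities gives
   2 c <= o(1) as k goes to infinity.

   Compactness of the couplings is obtained along ultrafilters: coding points by
   binary digits, a limit of plans with a fixed marginal nu is constructed as the
   law of (x, X (x, u)) with u uniform on [0, 1[, which also provides the
   conditional laws. *)
From HB Require Import structures.
Require Import Defs.
From mathcomp Require Import all_boot all_order all_algebra.
From mathcomp Require Import all_classical all_reals all_analysis.
From mathcomp Require Import measurable_realfun.
From mathcomp Require Import ring lra zify.
Set Implicit Arguments.
Unset Strict Implicit.
Unset Printing Implicit Defensive.
Import Order.TTheory GRing.Theory Num.Theory.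
Import numFieldNormedType.Exports.
Local Open Scope classical_set_scope.
Local Open Scope ring_scope.
Local Open Scope quotient_scope.

(** * Bounded measurable functions *)

Section bounded_measurable.
Context {R : realType}.

(** The maximum moves again when phi is replaced by a smooth function, so mu and nu must be movable
    independently although the penalty links them. [cost_glue] separates them: after both points of
    a coupled pair have moved, the cost is at most the old cost plus one function of each
    displacement. The square (t - s)^2 is separated likewise, so the maximum property becomes A - B
    - k cost (x - w) - k cost (w - y) <= S, with equality at one point, A depending on (t, mu, x)
    only and B on (s, nu, y) only; each side is then touched on its own. Touching shifts the points
    by an amount h set by the precision of the trigonometric sum, while the Lipschitz bounds of the
    Hamiltonian terms grow with k. Hence h goes to 0 first, at fixed k, and k goes to infinity
    afterwards; the bounds surviving the first limit involve only quantities controlled by the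
    penalty. Since sigma is smooth on [0, T[ only, the maximizing times must stay at a fixed
    distance from T, uniformly in large k; semicontinuity and the terminal condition give this. *)

Definition bdd {S : Type} (f : S -> R) := exists M, forall x, `|f x| <= M.

(** Against a probability measure such functions are integrable, so [Rintegral] is linear and
    monotone on them without further side conditions. *)
Definition bmeas d (S : measurableType d) (f : S -> R) :=
  measurable_fun setT f /\ bdd f.

Section closure.
Context d (S : measurableType d).
Implicit Types f g : S -> R.

Lemma bmeas_cst c : bmeas (fun _ : S => c).
Proof. by split; [exact: measurable_cst|exists `|c|]. Qed.

Lemma bmeasD f g : bmeas f -> bmeas g -> bmeas (fun x => f x + g x).
Proof.
move=> [mf [M fM]] [mg [N gN]]; split; first exact: measurable_funD.
by exists (M + N) => x; rewrite (le_trans (ler_normD _ _))// lerD.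
Qed.

Lemma bmeasN f : bmeas f -> bmeas (fun x => - f x).
Proof.
move=> [mf [M fM]]; split; first exact: measurableT_comp.
by exists M => x; rewrite normrN.
Qed.

Lemma bmeasB f g : bmeas f -> bmeas g -> bmeas (fun x => f x - g x).
Proof. by move=> bf bg; apply: bmeasD => //; exact: bmeasN. Qed.

Lemma bmeasM f g : bmeas f -> bmeas g -> bmeas (fun x => f x * g x).
Proof.
move=> [mf [M fM]] [mg [N gN]]; split; first exact: measurable_funM.
by exists (M * N) => x; rewrite normrM ler_pM.
Qed.

Lemma bmeasZ c f : bmeas f -> bmeas (fun x => c * f x).
Proof. by move=> bf; apply: bmeasM => //; exact: bmeas_cst. Qed.

Lemma bmeas_norm f : bmeas f -> bmeas (fun x => `|f x|).
Proof.
move=> [mf [M fM]]; split; first exact: measurableT_comp.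
by exists M => x; rewrite normr_id.
Qed.

Lemma bmeasX f n : bmeas f -> bmeas (fun x => f x ^+ n).
Proof.
move=> bf; elim: n => [|n IH].
  by under eq_fun do rewrite expr0; exact: bmeas_cst.
by under eq_fun do rewrite exprS; exact: bmeasM.
Qed.

Lemma bmeas_sum (I : Type) (r : seq I) (F : I -> S -> R) :
  (forall i, bmeas (F i)) -> bmeas (fun x => \sum_(i <- r) F i x).
Proof.
move=> bF; elim: r => [|i r IH].
  by under eq_fun do rewrite big_nil; exact: bmeas_cst.
by under eq_fun do rewrite big_cons; exact: bmeasD.
Qed.

Lemma bmeas_comp d' (S' : measurableType d') (h : S' -> S) f :
  measurable_fun setT h -> bmeas f -> bmeas (fun x => f (h x)).
Proof.
move=> mh [mf [M fM]]; split; first exact: (measurableT_comp mf).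
by exists M.
Qed.

Lemma bmeas_integrable (P : probability S R) f :
  bmeas f -> P.-integrable setT (EFin \o f).
Proof.
move=> [mf [M fM]].
apply: (@le_integrable _ _ _ P _ measurableT _ (fun=> M%:E)) => //.
- exact/measurable_EFinP.
- by move=> x _ /=; rewrite lee_fin (le_trans (fM _))// ler_norm.
- exact: finite_measure_integrable_cst.
Qed.

End closure.

Section expectation.
Context d (S : measurableType d) (P : probability S R).
Implicit Types f g : S -> R.

Lemma expect_cst c : \int[P]_x c = c.
Proof. by rewrite Rintegral_cst//= probability_setT/= mulr1. Qed.

Lemma expectD f g : bmeas f -> bmeas g ->
  \int[P]_x (f x + g x) = \int[P]_x f x + \int[P]_x g x.
Proof. by move=> bf bg; rewrite RintegralD//; exact: bmeas_integrable. Qed.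

Lemma expectZ c f : bmeas f -> \int[P]_x (c * f x) = c * \int[P]_x f x.
Proof. by move=> bf; rewrite RintegralZl//; exact: bmeas_integrable. Qed.

Lemma expectN f : bmeas f -> \int[P]_x (- f x) = - \int[P]_x f x.
Proof.
move=> bf; rewrite -mulN1r -expectZ//.
by apply: eq_Rintegral => x _; rewrite mulN1r.
Qed.

Lemma expectB f g : bmeas f -> bmeas g ->
  \int[P]_x (f x - g x) = \int[P]_x f x - \int[P]_x g x.
Proof. by move=> bf bg; rewrite expectD ?expectN//; exact: bmeasN. Qed.

Lemma expect_le f g : bmeas f -> bmeas g -> (forall x, f x <= g x) ->
  \int[P]_x f x <= \int[P]_x g x.
Proof. by move=> bf bg fg; apply: le_Rintegral => //; exact: bmeas_integrable. Qed.

Lemma expect_ge0 f : (forall x, 0 <= f x) -> 0 <= \int[P]_x f x.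
Proof. by move=> f0; exact: Rintegral_ge0. Qed.

Lemma expect_norm f : bmeas f -> `|\int[P]_x f x| <= \int[P]_x `|f x|.
Proof. by move=> bf; apply: le_normr_Rintegral => //; exact: bmeas_integrable. Qed.

Lemma expect_bound f c : bmeas f -> (forall x, `|f x| <= c) ->
  `|\int[P]_x f x| <= c.
Proof.
move=> bf fc; apply: le_trans (expect_norm bf) _.
rewrite -[leRHS]expect_cst; apply: expect_le => //; first exact: bmeas_norm.
exact: bmeas_cst.
Qed.

Lemma expect_sqr f : bmeas f -> (\int[P]_x f x) ^+ 2 <= \int[P]_x (f x ^+ 2).
Proof.
move=> bf; set m := \int[P]_x f x.
have : 0 <= \int[P]_x ((f x - m) ^+ 2) by apply: expect_ge0 => x; exact: sqr_ge0.
rewrite (_ : (fun x => (f x - m) ^+ 2) =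
             (fun x => f x ^+ 2 + (- (2 * m) * f x + m ^+ 2))); last first.
  by apply/funext => x; ring.
have bf2 := bmeasX 2 bf; have bcf := bmeasZ (- (2 * m)) bf.
rewrite expectD//; last by apply: bmeasD => //; exact: bmeas_cst.
rewrite expectD//; last exact: bmeas_cst.
by rewrite expectZ// expect_cst -/m; move=> h; nra.
Qed.

Lemma expect_indic A : measurable A -> \int[P]_x \1_A x = fine (P A).
Proof. by move=> mA; rewrite /Rintegral integral_indic// setIT. Qed.

End expectation.

Lemma bmeas_indic d (S : measurableType d) (A : set S) : measurable A ->
  bmeas (fun x => \1_A x : R).
Proof.
move=> mA; split; first exact: measurable_indic.
by exists 1 => x; rewrite indicE; case: (x \in A); rewrite ?normr1 ?normr0.
Qed.

Section law.
Context d (S : measurableType d) d' (S' : measurableType d').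

Definition law (P : probability S R) (h : S -> S') (mh : measurable_fun setT h)
  : probability S' R :=
  distribution P (MeasurableFun.Pack (MeasurableFun.Class (isMeasurableFun.Build _ _ _ _ _ mh))).

Lemma lawE P h (mh : measurable_fun setT h) A : law P mh A = P (h @^-1` A).
Proof. by []. Qed.

Lemma expect_law P h (mh : measurable_fun setT h) (f : S' -> R) : bmeas f ->
  \int[law P mh]_x f x = \int[P]_x f (h x).
Proof.
move=> bf; rewrite /Rintegral integral_distribution//=.
  by apply/measurable_EFinP; case: bf.
by apply: bmeas_integrable; exact: bmeas_comp bf.
Qed.

End law.

Section fubini.
Context d1 (S1 : measurableType d1) d2 (S2 : measurableType d2).

Lemma bmeas_section1 (f : S1 * S2 -> R) x : bmeas f -> bmeas (fun y => f (x, y)).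
Proof. by move=> bf; apply: bmeas_comp bf; exact: pair1_measurable. Qed.

Lemma expect_prod (P : probability S1 R) (Q : probability S2 R) (f : S1 * S2 -> R) :
  bmeas f ->
  bmeas (fun x => \int[Q]_y f (x, y)) /\
  \int[(P \x Q)%E]_z f z = \int[P]_x \int[Q]_y f (x, y).
Proof.
move=> bf; have If := bmeas_integrable (P \x Q)%E bf.
have E x : (\int[Q]_y (f (x, y))%:E)%E = (\int[Q]_y f (x, y))%:E.
  rewrite fineK//; apply: integrable_fin_num => //.
  by apply: bmeas_integrable; exact: bmeas_section1.
split; last first.
  rewrite /Rintegral -integral12_prod_meas1//; congr fine.
  by apply: eq_integral => x _; rewrite -E.
have [mf [M fM]] := bf; split; last first.
  by exists M => x; apply: expect_bound => //; exact: bmeas_section1.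
apply/measurable_EFinP.
have := measurable_fubini_F If.
by congr measurable_fun; apply/funext => x; rewrite /= -E.
Qed.

End fubini.

Lemma probability_ext d (S : measurableType d) (P Q : probability S R) :
  (forall A, measurable A -> P A = Q A) ->
  forall f, bmeas f -> \int[P]_x f x = \int[Q]_x f x.
Proof.
move=> PQ f bf; rewrite /Rintegral; congr fine.
by apply: eq_measure_integral => A mA _; exact: PQ.
Qed.

End bounded_measurable.

(** * Young measures on coded spaces *)

Section ultralimits.
Context {R : realType} {I : Type} (F : set_system I) (UF : UltraFilter F).

(** A cluster point of the image of an ultrafilter is a limit: if some neighbourhood were not in the
    image filter, its complement would be, and the cluster property forbids this. *)
Lemma ultra_cvg_compact (X : topologicalType) (K : set X) (f : I -> X) :
  compact K -> (forall i, K (f i)) -> exists2 p, K p & f @ F --> p.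
Proof.
move=> cK Kf.
have FK : (f @ F) K.
  exact: (@filterE _ F _ (f @^-1` K) Kf).
have [p [Kp clp]] := cK (f @ F) _ FK.
exists p => // B nB; have [//|FB] := in_ultra_setVsetC (f @^-1` B) UF.
by have [x [nx Bx]] := clp (~` B) B FB nB.
Qed.

Lemma ultra_cvg_bdd (f : I -> R) : bdd f -> cvg (f @ F).
Proof.
move=> [M fM]; have [] := @ultra_cvg_compact R `[- M, M]%classic f.
- exact: segment_compact.
- by move=> i /=; rewrite in_itv/= -ler_norml; exact: fM.
- by move=> p _ fp; apply/cvg_ex; exists p.
Qed.

End ultralimits.

Section dominated_density.
Context {R : realType} d (S : measurableType d) (nu : probability S R).
Variable m : set S -> R.
Hypothesis m_ge0 : forall A, 0 <= m A.
Hypothesis m_le : forall A, measurable A -> m A <= fine (nu A).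
Hypothesis mU : forall A B, measurable A -> measurable B -> A `&` B = set0 ->
  m (A `|` B) = m A + m B.

Let mE (A : set S) : \bar R := (m A)%:E.

Let m0 : m set0 = 0.
Proof. by apply/eqP; rewrite eq_le m_ge0 (le_trans (m_le _))// measure0. Qed.

Let mE0 : mE set0 = 0%E.
Proof. by rewrite /mE m0. Qed.

Let mE_ge0 A : (0 <= mE A)%E.
Proof. by rewrite lee_fin. Qed.

Let m_sum (A : nat -> set S) n : (forall i, measurable (A i)) -> trivIset setT A ->
  m (\big[setU/set0]_(i < n) A i) = \sum_(0 <= i < n) m (A i).
Proof.
move=> mA tA; elim: n => [|n IH]; first by rewrite big_ord0 big_nil.
rewrite big_ord_recr big_nat_recr//= mU ?IH//; first exact: bigsetU_measurable.
rewrite big_distrl/= big1// => i _.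
by move/trivIsetP : tA; apply => //; rewrite ltn_eqF.
Qed.

Let mE_sigma : semi_sigma_additive mE.
Proof.
move=> A mA tA mUA; pose B n := \big[setU/set0]_(i < n) A i.
have mB n : measurable (B n) by exact: bigsetU_measurable.
have nuB : (fun n => fine (nu (B n))) @ \oo --> fine (nu (\bigcup_i A i)).
  have := @measure_semi_sigma_additive _ _ _ nu A mA tA mUA.
  rewrite -[X in _ --> X -> _]fineK ?fin_num_measure// => /fine_cvg.
  rewrite (_ : fine \o _ = (fun n => fine (nu (B n))))//.
  apply/funext => n /=; rewrite /B measure_bigsetU ?big_mkord//.
(* The mass lost on the tail lies between 0 and the nu-measure of the tail, which tends to 0. *)
have le n : m (\bigcup_i A i) - (fine (nu (\bigcup_i A i)) - fine (nu (B n)))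
     <= \sum_(0 <= i < n) m (A i) <= m (\bigcup_i A i).
  rewrite -m_sum// -/(B n); set C := \bigcup_i A i.
  have BC : B n `<=` C by apply: bigsetU_bigcup.
  have mD : measurable (C `\` B n) by exact: measurableD.
  have CE : B n `|` (C `\` B n) = C by rewrite setUDr setDv setD0 setUC; exact/setUidl.
  have d0 : B n `&` (C `\` B n) = set0 by rewrite setIDA setDE setIAC setICr set0I.
  have mC : m C = m (B n) + m (C `\` B n) by rewrite -mU// CE.
  have nuC : fine (nu C) = fine (nu (B n)) + fine (nu (C `\` B n)).
    by rewrite -fineD ?fin_num_measure// -measureU// CE.
  by have := m_le mD; have := m_ge0 (C `\` B n); rewrite mC nuC => *; apply/andP; split; lra.
rewrite (_ : (fun n => _) = (fun n => (\sum_(0 <= i < n) m (A i))%:E)); last first.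
  by apply/funext => n; rewrite /mE sumEFin.
apply: cvg_EFin; first by near=> n.
apply: (squeeze_cvgr (f := fun n => m (\bigcup_i A i) - (fine (nu (\bigcup_i A i)) - fine (nu (B n))))
  (h := fun=> m (\bigcup_i A i))); last exact: cvg_cst.
  by near=> n; exact: le.
rewrite -[X in _ --> X]subr0; apply: cvgB; first exact: cvg_cst.
rewrite -[X in _ --> X](subrr (fine (nu (\bigcup_i A i)))).
by apply: cvgB => //; exact: cvg_cst.
Unshelve. all: by end_near. Qed.

HB.instance Definition _ := isMeasure.Build _ _ _ mE mE0 mE_ge0 mE_sigma.

Let mE_fin : fin_num_fun mE.
Proof. by []. Qed.

HB.instance Definition _ := @Measure_isFinite.Build _ _ _ mE mE_fin.

(* Domination by nu upgrades finite additivity to sigma-additivity. *)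
Lemma dominated_density : exists2 g : S -> R,
  (forall x, 0 <= g x) /\ nu.-integrable setT (EFin \o g) &
  forall A, measurable A -> (m A)%:E = (\int[nu]_(x in A) (g x)%:E)%E.
Proof.
have dom : mE `<< nu.
  apply/null_content_dominatesP => A mA A0; congr EFin.
  by apply/eqP; rewrite eq_le m_ge0 (le_trans (m_le _))//= A0.
have [f [f0 ffin intf fE]] := radon_nikodym_sigma_finite dom.
have E : EFin \o (fine \o f) = f by apply/funext => x /=; rewrite fineK.
exists (fine \o f); last by move=> A mA; rewrite [LHS](fE A mA) -[in LHS]E.
by split; [move=> x; rewrite /= fine_ge0|rewrite E].
Qed.

End dominated_density.

(** * Binary codes and the sigma-algebra of their cylinders *)

Section code.

(* The first n bits of c, read as a binary number with c 0 most significant. *)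
Fixpoint prefix (c : nat -> bool) n : nat :=
  if n is n'.+1 then (c n' + (prefix c n').*2)%N else 0%N.

Lemma prefix_half c n : (prefix c n.+1)./2 = prefix c n.
Proof. by rewrite /= half_bit_double. Qed.

Lemma prefix_odd c n : odd (prefix c n.+1) = c n.
Proof. by rewrite /= oddD odd_double addbF oddb. Qed.

Lemma prefix_lt c n : (prefix c n < 2 ^ n)%N.
Proof.
elim: n => //= n IH; rewrite expnS mul2n -!addnn.
by case: (c n) => /=; lia.
Qed.

Lemma eq_prefix c c' n m : (m <= n)%N -> prefix c n = prefix c' n ->
  prefix c m = prefix c' m.
Proof.
elim: n => [|n IH]; first by rewrite leqn0 => /eqP ->.
rewrite leq_eqVlt ltnS => /predU1P[-> //|mn] E; apply: IH => //.
by rewrite -(prefix_half c) -(prefix_half c') E.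
Qed.

Lemma prefix_bit c c' n m : (m < n)%N -> prefix c n = prefix c' n -> c m = c' m.
Proof. by move=> mn /(eq_prefix mn) E; rewrite -(prefix_odd c) -(prefix_odd c') E. Qed.

Definition cyl n j : set (nat -> bool) := [set c | prefix c n = j].

Definition cyls : set (set (nat -> bool)) :=
  [set A | A = set0 \/ exists n j, A = cyl n j].

Definition code := g_sigma_algebraType cyls.

Lemma cyl0 : cyl 0 0 = setT.
Proof. by apply/seteqP; split => // c _. Qed.

(** Two cylinders are either disjoint or nested, since the longer prefix determines the shorter
    one. *)
Lemma cylsI : setI_closed cyls.
Proof.
have main n m j i : (n <= m)%N -> cyls (cyl n j `&` cyl m i).
  move=> nm; have [[c [cj ci]]|h] := pselect (exists c, cyl n j c /\ cyl m i c).
    right; exists m, i; apply/seteqP; split => [b []//|b bi]; split => //.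
    by rewrite /cyl/= -cj; apply: eq_prefix nm _; rewrite bi ci.
  by left; apply/seteqP; split => // b [b1 b2]; case: h; exists b.
move=> A B [->|[n [j ->]]]; first by left; rewrite set0I.
move=> [->|[m [i ->]]]; first by left; rewrite setI0.
by have [/main|/ltnW/main] := leqP n m; rewrite // setIC.
Qed.

Lemma measurable_cyl n j : measurable (cyl n j : set code).
Proof. by apply: sub_sigma_algebra; right; exists n, j. Qed.

Lemma measurable_prefix n : measurable_fun setT (prefix ^~ n : code -> nat).
Proof.
move=> _ A _; rewrite setTI.
rewrite (_ : _ @^-1` A = \bigcup_(j in A) cyl n j).
  by apply: bigcup_measurable => j _; exact: measurable_cyl.
by apply/seteqP; split => [c Ac|c [j Aj cj]]; [exists (prefix c n)|rewrite /= cj].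
Qed.

Lemma measurable_bit n : measurable_fun setT (fun c : code => c n).
Proof.
rewrite [X in measurable_fun _ X](_ : _ = odd \o prefix ^~ n.+1); last first.
  by apply/funext => c; rewrite [RHS]prefix_odd.
by apply: (@measurableT_comp _ _ _ _ _ _ odd) => //; exact: measurable_prefix.
Qed.

Lemma measurable_code d (S : measurableType d) (h : S -> code) :
  (forall n, measurable_fun setT (fun x => h x n)) -> measurable_fun setT h.
Proof.
move=> mh; have mp n : measurable_fun setT (fun x => prefix (h x) n).
  elim: n => [|n IH] /=; first exact: measurable_cst.
  apply: (measurable_fun_addn (f := fun x => nat_of_bool (h x n))).
    exact: (@measurableT_comp _ _ _ _ _ _ nat_of_bool).
  exact: (@measurableT_comp _ _ _ _ _ _ double).
apply: (@measurability _ _ S code setT h cyls) => //.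
move=> _ [_ [->|[n [j ->]]] <-].
  by rewrite preimage_set0 setI0.
rewrite setTI; have := mp n measurableT [set j] I.
by rewrite setTI.
Qed.

End code.

Section rectangles.
Context {R : realType} d (S : measurableType d).

Lemma rectangle_unique d' (S' : measurableType d') (P Q : probability (S * S')%type R) :
  (forall A B, measurable A -> measurable B -> P (A `*` B) = Q (A `*` B)) ->
  forall C, measurable C -> P C = Q C.
Proof.
move=> PQ C mC.
apply: (@measure_unique _ R _ [set A `*` B | A in measurable & B in measurable]
  (fun=> setT)) => //.
- exact: measurable_prod_measurableType.
- move=> _ _ [A mA [B mB <-]] [A' mA' [B' mB' <-]]; rewrite -setXI.
  by exists (A `&` A'); [exact: measurableI|exists (B `&` B') => //; exact: measurableI].
- by move=> _; exists setT => //; exists setT => //; rewrite setXTT.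
- by rewrite bigcup_const.
- by move=> _ [A mA [B mB <-]]; exact: PQ.
- by move=> _; apply: le_lt_trans (probability_le1 P measurableT) _; rewrite ltry.
Qed.

(** For fixed A, D |-> X (A [*] D) is a finite measure on codes, determined by its values on the
    pi-system of cylinders; this reduces the claim to [rectangle_unique]. *)
Lemma cylinder_unique (P Q : probability (S * code)%type R) :
  (forall A n j, measurable A -> P (A `*` cyl n j) = Q (A `*` cyl n j)) ->
  forall C, measurable C -> P C = Q C.
Proof.
move=> PQ; apply: rectangle_unique => A B mA mB.
have mAT : measurable (A `*` [set: code]) by exact: measurableX.
pose res (X : probability (S * code)%type R) := pushforward (mrestr X mAT) (snd : S * code -> code).
have resE X D : res X D = X (A `*` D).
  rewrite /res /pushforward /mrestr; congr (X _).
  by apply/seteqP; split => -[x c] /= [h1 h2]; split => //; case: h2.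
rewrite -!resE.
apply: (@measure_unique _ R code cyls (fun=> setT)) => //.
- exact: cylsI.
- by move=> _; right; exists 0%N, 0%N; rewrite cyl0.
- by rewrite bigcup_const.
- move=> _ [->|[n [j ->]]]; first by rewrite !measure0.
  by rewrite -[LHS]/(res P _) -[RHS]/(res Q _) !resE PQ.
- move=> _; rewrite -[X in (X < _)%E]/(res P setT) resE.
  by apply: le_lt_trans (probability_le1 P mAT) _; rewrite ltry.
Qed.

End rectangles.

Section unit_interval.
Context {R : realType}.
Local Notation mu := (@lebesgue_measure R).

Definition unif01 := mrestr mu (measurable_itv `[0 : R, 1[).

HB.instance Definition _ := Measure.on unif01.

Let unif01T : unif01 setT = 1%E.
Proof.
by rewrite /unif01 /mrestr setTI lebesgue_measure_itv/= lte_fin ltr01 oppr0 adde0.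
Qed.

HB.instance Definition _ := Measure_isProbability.Build _ _ R unif01 unif01T.

End unit_interval.

Section mass_tree.
Context {R : realType} d (S : measurableType d).
Variable p : nat -> nat -> S -> R.
Hypothesis mp : forall n j, measurable_fun setT (p n j).
Hypothesis p_ge0 : forall n j x, 0 <= p n j x.
Hypothesis p0 : forall x, p 0 0 x = 1.
Hypothesis pS : forall n j x, p n j x = p n.+1 j.*2 x + p n.+1 j.*2.+1 x.

(* Inverse transform sampling: at each level the cells cut [0, 1[ into
   consecutive intervals of lengths p n j x, and pS nests the levels. *)
Let c n j x := \sum_(i < j) p n i x.

Let c_le n i j x : (i <= j)%N -> c n i x <= c n j x.
Proof.
elim: j => [|j IH]; first by rewrite leqn0 => /eqP ->.
rewrite leq_eqVlt ltnS => /predU1P[->//|/IH h].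
by rewrite /c big_ord_recr/= (le_trans h)// lerDl.
Qed.

Let c_double n j x : c n.+1 j.*2 x = c n j x.
Proof.
by elim: j => [|j IH]; rewrite /c ?big_ord0// doubleS !big_ord_recr/= -addrA -pS -/(c _ _ _) IH.
Qed.

Let c_total n x : c n (2 ^ n) x = 1.
Proof.
elim: n => [|n IH]; first by rewrite /c expn0 big_ord1 p0.
by rewrite expnS mul2n c_double.
Qed.

(** Counting the right endpoints not exceeding a yields the index of the cell containing a, skipping
    cells of length 0; as a finite sum of tests it is measurable in both variables. *)
Definition cell_index n (z : S * R) : nat :=
  (\sum_(j < 2 ^ n) nat_of_bool (c n j.+1 z.1 <= z.2)%R)%N.

Let cell_indexE n j x a : (j < 2 ^ n)%N -> c n j x <= a < c n j.+1 x ->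
  cell_index n (x, a) = j.
Proof.
move=> jn /andP[ja aj]; rewrite /cell_index/=.
rewrite -(big_mkord xpredT (fun k => nat_of_bool (c n k.+1 x <= a))) (big_cat_nat (n := j))//=; last exact: ltnW.
rewrite [X in (_ + X)%N]big_nat_cond [X in (_ + X)%N]big1 ?addn0; last first.
  move=> k /andP[/andP[jk _] _]; apply/eqP; rewrite eqb0 -ltNge.
  by rewrite (lt_le_trans aj)// c_le.
rewrite big_nat_cond (eq_bigr (fun=> 1%N)); last first.
  move=> k /andP[/andP[_ kj] _]; apply/eqP; rewrite eqb1.
  by rewrite (le_trans _ ja)// c_le.
by rewrite -big_nat_cond sum_nat_const_nat subn0 muln1.
Qed.

Let cell_ex n x a : 0 <= a < 1 -> exists2 j, (j < 2 ^ n)%N & c n j x <= a < c n j.+1 x.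
Proof.
move=> /andP[a0 a1].
have : exists j, a < c n j.+1 x.
  by exists (2 ^ n).-1; rewrite prednK ?expn_gt0// c_total.
move=> /ex_minnP[j aj jmin]; exists j.
  rewrite ltnNge; apply/negP => nj; have := jmin (2 ^ n).-1.
  rewrite prednK ?expn_gt0// c_total => /(_ a1).
  by rewrite leqNgt (leq_trans _ nj)// prednK// expn_gt0.
rewrite aj andbT; case: j jmin {aj} => [|j] jmin; first by rewrite /c big_ord0.
by rewrite leNgt; apply/negP => /jmin; rewrite ltnn.
Qed.

Let cell_indexP n j x a : 0 <= a < 1 ->
  cell_index n (x, a) = j <-> (j < 2 ^ n)%N /\ c n j x <= a < c n j.+1 x.
Proof.
move=> /cell_ex => /(_ n x)[k kn ck]; split; last by case; exact: cell_indexE.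
by rewrite (cell_indexE kn ck) => <-.
Qed.

Let cell_index_half n x a : 0 <= a < 1 ->
  (cell_index n.+1 (x, a))./2 = cell_index n (x, a).
Proof.
move=> a01; have [k kn /andP[ck ck']] := cell_ex n.+1 x a01.
rewrite (cell_indexE kn) ?ck//; apply/esym/cell_indexE.
  by move: kn; rewrite expnS mul2n; lia.
rewrite -(c_double n k./2 x) -(c_double n k./2.+1 x).
by apply/andP; split; [apply: le_trans ck|apply: lt_le_trans ck' _]; apply: c_le; lia.
Qed.

(** Bit m tells whether the cell of level m + 1 is the left or the right child of its parent; level
    0 has a single cell, hence the shift. *)
Definition code_of_mass (z : S * R) : code := fun m => odd (cell_index m.+1 z).

Let prefix_code_of_mass n x a : 0 <= a < 1 ->
  prefix (code_of_mass (x, a)) n = cell_index n (x, a).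
Proof.
move=> a01; elim: n => [|n IH].
  have [k] := cell_ex 0 x a01; rewrite expn0 ltnS leqn0 => /eqP -> ck.
  by rewrite (cell_indexE _ ck).
by rewrite [LHS]/= IH -cell_index_half// odd_double_half.
Qed.

Lemma measurable_code_of_mass : measurable_fun setT code_of_mass.
Proof.
apply: measurable_code => n.
apply: (@measurableT_comp _ _ _ _ _ _ odd _ (cell_index n.+1)) => //.
have mc j : measurable_fun setT (fun z : S * R => c n.+1 j z.1).
  apply: (@measurableT_comp _ _ _ _ _ _ (c n.+1 j) _ fst) => //.
  rewrite /c; elim: j => [|j IH].
    by under eq_fun do rewrite big_ord0; exact: measurable_cst.
  by under eq_fun do rewrite big_ord_recr/=; exact: measurable_funD.
rewrite /cell_index; elim: (2 ^ n.+1)%N => [|k IH].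
  by under eq_fun do rewrite big_ord0; exact: measurable_cst.
under eq_fun do rewrite big_ord_recr/=.
apply: (measurable_fun_addn IH).
apply: (@measurableT_comp _ _ _ _ _ _ nat_of_bool) => //.
exact: measurable_fun_ler.
Qed.

Lemma code_of_mass_cyl n j x : (j < 2 ^ n)%N ->
  unif01 [set a | cyl n j (code_of_mass (x, a))] = (p n j x)%:E.
Proof.
move=> jn; rewrite /unif01 /mrestr.
have c0 : 0 <= c n j x by rewrite /c sumr_ge0.
have c1 : c n j.+1 x <= 1 by rewrite -(c_total n x) c_le.
rewrite (_ : _ `&` _ = `[c n j x, c n j.+1 x[%classic).
  rewrite lebesgue_measure_itv/= lte_fin.
  have -> : c n j.+1 x = c n j x + p n j x by rewrite /c big_ord_recr.
  rewrite ltrDl -EFinB addrAC subrr add0r lt_neqAle p_ge0 andbT.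
  by case: eqVneq => [<-|].
apply/seteqP; split => a /=; rewrite !in_itv/=.
  by move=> [+ a01]; rewrite /cyl/= prefix_code_of_mass// => /cell_indexP -[].
move=> /andP[ca ac]; have a01 : 0 <= a < 1.
  by rewrite (le_trans c0 ca) (lt_le_trans ac c1).
by split => //; rewrite /cyl/= prefix_code_of_mass//; apply/cell_indexP => //; rewrite ca.
Qed.

Lemma code_of_mass_law (nu : probability S R) n j A : (j < 2 ^ n)%N -> measurable A ->
  (nu \x unif01)%E [set z | A z.1 /\ cyl n j (code_of_mass z)] =
  (\int[nu]_(x in A) (p n j x)%:E)%E.
Proof.
move=> jn mA; rewrite /product_measure1 [RHS]integral_mkcond.
apply: eq_integral => x _ /=; rewrite patchE.
case: ifPn => [|] xA.
  rewrite -code_of_mass_cyl//; congr (unif01 _).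
  apply/seteqP; split => a; rewrite /xsection/= inE/=; first by case.
  by split => //; rewrite inE in xA.
rewrite (_ : xsection _ _ = set0) ?measure0//.
by apply/seteqP; split => a //; rewrite /xsection/= inE/= => -[Ax _]; rewrite notin_setE in xA.
Qed.

End mass_tree.

(** * Limits of plans with a fixed marginal *)

Section young.
Context {R : realType} {I : Type} (F : set_system I) (UF : UltraFilter F).
Context d (S : measurableType d) (nu : probability S R).
Variable G : I -> probability (S * code)%type R.
Hypothesis marg : forall i A, measurable A -> G i (A `*` setT) = nu A.

Let mass i n j A := fine (G i (A `*` cyl n j)).

Let m n j A := lim (mass i n j A @[i --> F]).

Let mass_le i n j A : measurable A -> mass i n j A <= fine (nu A).
Proof.
move=> mA; have mc := measurableX mA (measurable_cyl n j).
rewrite /mass fine_le ?fin_num_measure// -(marg i)// le_measure ?inE//.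
  by apply: measurableX.
by move=> -[x y] []/=.
Qed.

Let mass_cvg n j A : measurable A -> mass i n j A @[i --> F] --> m n j A.
Proof.
move=> mA; have : cvg (mass i n j A @[i --> F]) by
  apply: ultra_cvg_bdd; exists (fine (nu A)) => i; rewrite ger0_norm ?mass_le// fine_ge0.
by [].
Qed.

Let m_cyl n j A : measurable A -> m n j A = m n.+1 j.*2 A + m n.+1 j.*2.+1 A.
Proof.
move=> mA; apply/cvg_lim => //.
rewrite (_ : (fun i => _) = (fun i => mass i n.+1 j.*2 A + mass i n.+1 j.*2.+1 A)).
  by apply: cvgD; exact: mass_cvg.
apply/funext => i; have mc k l := measurableX mA (measurable_cyl k l).
rewrite /mass -fineD ?fin_num_measure// -measureU//.
  congr (fine (G i _)); apply/seteqP; split => -[x c]; rewrite /cyl/=.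
    by move=> [Ax <-]; case: (c n); [right|left].
  by move=> [|] [Ax cj]; split => //; rewrite -(prefix_half c n) [X in X./2]cj; lia.
apply/seteqP; split => // -[x c] [[_ +] [_]]; rewrite /cyl/= => -> /eqP; lia.
Qed.

Let m0 j A : measurable A -> m 0 j A = (j == 0%N)%:R * fine (nu A).
Proof.
move=> mA; apply/cvg_lim => //.
rewrite (_ : (fun i => _) = cst ((j == 0%N)%:R * fine (nu A))); first exact: cvg_cst.
apply/funext => i; rewrite /mass; case: eqVneq => [->|j0].
  by rewrite cyl0 marg// mul1r.
rewrite (_ : cyl _ _ = set0) ?setX0 ?measure0 ?mul0r//.
by apply/seteqP; split => // c; rewrite /cyl/= => h; rewrite -h in j0.
Qed.

Let g_ex n j : exists g : S -> R, [/\ forall x, 0 <= g x, nu.-integrable setT (EFin \o g) &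
  forall A, measurable A -> (m n j A)%:E = (\int[nu]_(x in A) (g x)%:E)%E].
Proof.
(* [dominated_density] asks for nonnegativity on every set, while on a non-measurable one the limit
   defining [m] need not exist; the value 0 is put there. *)
pose m' A := if pselect (measurable A) is left _ then m n j A else 0.
have m'E A : measurable A -> m' A = m n j A by rewrite /m'; case: pselect.
have [] := @dominated_density R _ _ nu m'.
- move=> A; rewrite /m'; case: pselect => // mA.
  apply: limr_ge; first exact/cvgP/mass_cvg.
  by apply: nearW => i; rewrite fine_ge0.
- move=> A mA; rewrite m'E//; apply: limr_le; first exact/cvgP/mass_cvg.
  by apply: nearW => i; exact: mass_le.
- move=> A B mA mB AB; rewrite !m'E//; last exact: measurableU.
  apply/cvg_lim => //.
  rewrite (_ : (fun i => _) = (fun i => mass i n j A + mass i n j B)).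
    by apply: cvgD; exact: mass_cvg.
  apply/funext => i; have mc C (mC : measurable C) := measurableX mC (measurable_cyl n j).
  rewrite /mass -fineD ?fin_num_measure//; try exact: mc.
  rewrite -measureU//; try exact: mc; first by congr (fine (G i _)); apply/seteqP; split => -[x c] /=; tauto.
  apply/seteqP; split => // -[x c] [[/= Ax _] [/= Bx _]].
  by have : (A `&` B) x by []; rewrite AB.
move=> g [g0 gi] gE; exists g; split => // A mA; by rewrite -gE// m'E.
Qed.

Let g n j := sval (cid (g_ex n j)).

Let g_ge0 n j x : 0 <= g n j x.
Proof. by rewrite /g; case: cid => h []. Qed.

Let g_int n j : nu.-integrable setT (EFin \o g n j).
Proof. by rewrite /g; case: cid => h []. Qed.

Let gE n j A : measurable A -> (m n j A)%:E = (\int[nu]_(x in A) (g n j x)%:E)%E.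
Proof. by rewrite /g; case: cid => h [] ? ?; exact. Qed.

Let g_meas n j : measurable_fun setT (g n j).
Proof. by apply/measurable_EFinP; case/integrableP: (g_int n j). Qed.

(* The densities g only split almost everywhere; truncating them by the mass of
   the parent cell yields versions that split exactly. *)
Let p := fix p n j : S -> R := match n with
  | 0%N => fun=> (j == 0%N)%:R
  | n'.+1 => fun x => let q := Num.min (g n j./2.*2 x) (p n' j./2 x) in
             if odd j then p n' j./2 x - q else q
  end.

Let p_ge0 n j x : 0 <= p n j x.
Proof.
elim: n j => [|n IH] j /=; first by rewrite ler0n.
by case: ifP => _; rewrite ?subr_ge0 ?ge_min ?lexx ?orbT// le_min g_ge0 IH.
Qed.

Let p_S n j x : p n j x = p n.+1 j.*2 x + p n.+1 j.*2.+1 x.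
Proof. by rewrite /= odd_double /= uphalf_double half_double addrC subrK. Qed.

Let p_meas n j : measurable_fun setT (p n j).
Proof.
elim: n j => [|n IH] j /=; first exact: measurable_cst.
have mq : measurable_fun setT (fun x => Num.min (g n.+1 j./2.*2 x) (p n j./2 x)).
  exact: measurable_minr.
by case: (odd j) => //; exact: measurable_funB.
Qed.

Let gS n j : {ae nu, forall x, g n j x = g n.+1 j.*2 x + g n.+1 j.*2.+1 x}.
Proof.
have : ae_eq nu setT (EFin \o g n j) (fun x => (g n.+1 j.*2 x + g n.+1 j.*2.+1 x)%:E).
  apply: integral_ae_eq => //; first by apply/measurable_EFinP; exact: measurable_funD.
  move=> A _ mA; rewrite -gE// m_cyl// EFinD !gE// -integralD//.
  - exact: integrableS (g_int _ _).
  - exact: integrableS (g_int _ _).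
by apply: filterS => x /= /(_ Logic.I)[].
Qed.

Let g0E j : {ae nu, forall x, g 0 j x = (j == 0%N)%:R}.
Proof.
have : ae_eq nu setT (EFin \o g 0 j) (fun x => (j == 0%N)%:R%:E).
  apply: integral_ae_eq => //.
  by move=> A _ mA; rewrite -gE// m0// integral_cst// EFinM fineK// fin_num_measure.
by apply: filterS => x /= /(_ Logic.I)[].
Qed.

(** Almost everywhere the truncation is inactive, because the densities of the two children are
    nonnegative and add up to the density of the parent. *)
Let pg n j : {ae nu, forall x, p n j x = g n j x}.
Proof.
elim: n j => [|n IH] j.
  by apply: filterS (g0E j) => x ->.
have := gS n j./2; have := IH j./2.
apply: filterS2 => x /= px gx.
have hd : j = (odd j + j./2.*2)%N by rewrite odd_double_half.
have le : g n.+1 j./2.*2 x <= p n j./2 x by rewrite px gx lerDl.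
rewrite min_l//; case: (odd j) hd => /= hd.
  by rewrite px gx addrC addKr {2}hd.
by rewrite {2}hd.
Qed.

(* The limit of the plans is realized as the law of (x, X (x, u)) with u uniform
   and independent of x: this gives compactness and disintegration at once. *)
Lemma young_representation : exists2 X : S * R -> code, measurable_fun setT X &
  forall A n j, measurable A -> fine (G i (A `*` cyl n j)) @[i --> F] -->
    fine ((nu \x unif01)%E [set z | A z.1 /\ cyl n j (X z)]).
Proof.
exists (code_of_mass p); first exact: measurable_code_of_mass.
move=> A n j mA; have [jn|nj] := ltnP j (2 ^ n).
  have := @code_of_mass_law R _ S p p_ge0 (fun=> erefl) p_S nu n j A jn mA.
  move=> ->.
  rewrite (_ : (\int[nu]_(x in A) (p n j x)%:E)%E = (m n j A)%:E); first exact: mass_cvg.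
  rewrite gE//; apply: ae_eq_integral => //.
  - by apply: measurable_funTS; apply/measurable_EFinP.
  - by apply: measurable_funTS; apply/measurable_EFinP.
  - by apply: filterS (pg n j) => x ->.
have -> : cyl n j = set0.
  apply/seteqP; split => // c; rewrite /cyl/= => cj.
  by have := prefix_lt c n; rewrite cj ltnNge nj.
rewrite (_ : [set _ | _] = set0); last by apply/seteqP; split => // z [].
by rewrite measure0; under eq_fun do rewrite setX0 measure0; exact: cvg_cst.
Qed.

End young.

Section convergence_class.
Context {R : realType} {I : Type} (F : set_system I) (PF : ProperFilter F).
Context d (S : measurableType d) (P : I -> probability S R) (Q : probability S R).

Definition test_cvg (f : S -> R) := bmeas f /\ \int[P i]_x f x @[i --> F] --> \int[Q]_x f x.

Lemma test_cvgD f g : test_cvg f -> test_cvg g -> test_cvg (fun x => f x + g x).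
Proof.
move=> [bf cf] [bg cg]; split; first exact: bmeasD.
by rewrite expectD//; under eq_fun do rewrite expectD//; exact: cvgD.
Qed.

Lemma test_cvgZ c f : test_cvg f -> test_cvg (fun x => c * f x).
Proof.
move=> [bf cf]; split; first exact: bmeasZ.
by rewrite expectZ//; under eq_fun do rewrite expectZ//; apply: cvgM => //; exact: cvg_cst.
Qed.

Lemma test_cvg_cst c : test_cvg (fun=> c).
Proof.
split; first exact: bmeas_cst.
by rewrite expect_cst; under eq_fun do rewrite expect_cst; exact: cvg_cst.
Qed.

Lemma test_cvg_sum (J : Type) (r : seq J) (f : J -> S -> R) :
  (forall j, test_cvg (f j)) -> test_cvg (fun x => \sum_(j <- r) f j x).
Proof.
move=> h; elim: r => [|j r IH].
  by under eq_fun do rewrite big_nil; exact: test_cvg_cst.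
by under eq_fun do rewrite big_cons; exact: test_cvgD.
Qed.

Lemma test_cvg_unif f : bmeas f ->
  (forall e, 0 < e -> exists2 g, test_cvg g & forall x, `|f x - g x| <= e) ->
  test_cvg f.
Proof.
move=> bf h; split => //; apply/cvgrPdist_le => e e0.
have e3 : 0 < e / 3 by rewrite divr_gt0.
have [g [bg cg] fg] := h _ e3.
have dist (M : probability S R) : `|\int[M]_x f x - \int[M]_x g x| <= e / 3.
  by rewrite -expectB//; apply: expect_bound => //; exact: bmeasB.
move/cvgrPdist_le : cg => /(_ _ e3); apply: filterS => i gi.
have := dist Q; have := dist (P i); move: gi; rewrite !ler_norml.
by move=> /andP[? ?] /andP[? ?] /andP[? ?]; apply/andP; split; lra.
Qed.

Lemma test_cvg_indic A : measurable A -> fine (P i A) @[i --> F] --> fine (Q A) ->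
  test_cvg (\1_A : S -> R).
Proof.
move=> mA; split; first exact: bmeas_indic.
by rewrite expect_indic//; under eq_fun do rewrite expect_indic//.
Qed.

End convergence_class.

Section layers.
Context {R : realType}.

(** The sum counts the positive integers not exceeding y, so it is the integral part of y. *)
Lemma layer_count (y : R) N : 0 <= y <= N%:R ->
  `|y - \sum_(k < N) (k.+1%:R <= y)%R%:R| <= 1.
Proof.
elim: N => [|N IH] /andP[y0 yN].
  by rewrite big_ord0 subr0 ger0_norm// (le_trans yN)// ler01.
rewrite big_ord_recr/=; have [yN'|Ny] := leP y N%:R.
  have /IH : 0 <= y <= N%:R by rewrite y0.
  rewrite (_ : (N.+1%:R <= y) = false) ?addr0//.
  by apply/negbTE; rewrite -ltNge (le_lt_trans yN')// ltr_nat.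
rewrite (eq_bigr (fun=> 1)); last first.
  by move=> k _; rewrite (le_trans _ (ltW Ny))// ler_nat.
rewrite sumr_const card_ord; move: yN; rewrite -natr1 => yN.
case: (leP (N%:R + 1) y) => h /=; rewrite ler_norml; apply/andP; split; lra.
Qed.

(** Layer-cake approximation: f is rescaled to y = (f + M) / e, and the integral part of y is a sum
    of indicators of superlevel sets. *)
Lemma unif_simple d (S : measurableType d) (f : S -> R) e : bmeas f -> 0 < e ->
  exists N (c k : R) (A : nat -> set S), (forall j, measurable (A j)) /\
    forall x, `|f x - (c + \sum_(j < N) k * \1_(A j) x)| <= e.
Proof.
move=> [mf [M fM]] e0.
pose N := (Num.truncn (2 * M / e)).+1.
pose y x := (f x + M) / e.
have M0 x : 0 <= y x <= N%:R.
  have := fM x; rewrite ler_norml => /andP[h1 h2]; apply/andP; split.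
    by apply: divr_ge0; [lra|exact: ltW].
  rewrite (@le_trans _ _ (2 * M / e))//; last first.
    by rewrite ltW// /N truncnS_gt.
  by rewrite ler_pM2r ?invr_gt0//; lra.
exists N, (- M), e, (fun j => [set x | j.+1%:R <= y x]); split.
  move=> j; rewrite -[X in measurable X]setTI.
  have my : measurable_fun setT y.
    by apply: measurable_funM => //; apply: measurable_funD.
  rewrite (_ : setT `&` _ = setT `&` (fun x => j.+1%:R <= y x)%R @^-1` [set true]).
    by apply: measurable_fun_ler.
  by apply/seteqP; split => x [_ h]; split.
move=> x; have := layer_count (M0 x).
rewrite (eq_bigr (fun k : 'I_N => \1_[set x | k.+1%:R <= y x] x)); last first.
  by move=> k _; rewrite indicE; congr (nat_of_bool _)%:R; apply/idP/idP; rewrite inE.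
rewrite -mulr_sumr; set s := \sum_(_ < _) _ => h.
have -> : f x - (- M + e * s) = e * (y x - s).
  by rewrite /y; field; rewrite gt_eqF.
by rewrite normrM gtr0_norm// -[leRHS]mulr1 ler_wpM2l// ltW.
Qed.

End layers.

(** * Compactness and disintegration through codes *)

Section coding.
Context {R : realType}.

(** Neither map is asked to be continuous, and [dec] may be many-to-one: limits are taken among
    codes and brought back by [dec]. *)
Definition coding d (Y : measurableType d) (enc : Y -> code) (dec : code -> Y) :=
  [/\ measurable_fun setT enc, measurable_fun setT dec & cancel enc dec].

(* Substitute for continuity in the second variable: an approximate dependence
   on finitely many bits of its code. *)
Definition prefix_test d (S : measurableType d) d' (Y : measurableType d')
    (dec : code -> Y) (g : S * Y -> R) :=
  bmeas g /\ forall e, 0 < e -> exists n, forall x c c', prefix c n = prefix c' n ->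
    `|g (x, dec c) - g (x, dec c')| <= e.

Context d (S : measurableType d) d' (Y : measurableType d').
Context (enc : Y -> code) (dec : code -> Y) (cY : coding enc dec).

Lemma measurable_fun_pair_map d1 (S1 : measurableType d1) d2 (S2 : measurableType d2)
  (f : S1 -> S2) : measurable_fun setT f ->
  measurable_fun setT (fun z : S * S1 => (z.1, f z.2)).
Proof.
move=> mf; apply: measurable_fun_pair => //.
exact: (@measurableT_comp _ _ _ _ _ _ f _ snd).
Qed.

Section compactness.
Context {I : Type} (F : set_system I) (UF : UltraFilter F).
Context (nu : probability S R) (G : I -> probability (S * Y)%type R).
Hypothesis marg : forall i A, measurable A -> G i (A `*` setT) = nu A.

(** Convergence extends from rectangles to products of a function of x with the indicator of a
    cylinder, by simple functions, and then to prefix tests, which are uniformly close to finite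
    sums of such products. *)
Lemma young_compactness : exists X : S * R -> Y, measurable_fun setT X /\
  forall g, prefix_test dec g ->
    \int[G i]_z g z @[i --> F] --> \int[(nu \x unif01)%E]_z g (z.1, X z).
Proof.
have [menc mdec encK] := cY.
have me := measurable_fun_pair_map menc.
pose G' i : probability (S * code)%type R := law (G i) me.
have [|X mX cX] := @young_representation R I F UF _ S nu G'.
  by move=> i A mA; rewrite /G' lawE -(marg i mA); congr (G i _); apply/seteqP; split => -[].
exists (dec \o X); split; first exact: measurableT_comp.
have mX1 : measurable_fun setT (fun z : S * R => (z.1, X z)).
  exact: measurable_fun_pair.
pose Q : probability (S * code)%type R := law (nu \x unif01)%E mX1.
have rect A n j : measurable A -> test_cvg F G' Q (\1_(A `*` cyl n j)).
  move=> mA; apply: test_cvg_indic; first exact: measurableX (measurable_cyl _ _).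
  by rewrite lawE; exact: cX.
have slice (h : S -> R) n j : bmeas h ->
    test_cvg F G' Q (fun z => h z.1 * \1_(cyl n j) z.2).
  move=> bh; apply: test_cvg_unif.
    apply: bmeasM; first exact: (bmeas_comp (h := fst)).
    have bc : @bmeas R _ code (\1_(cyl n j)) by apply: bmeas_indic; exact: measurable_cyl.
    exact: (bmeas_comp measurable_snd bc).
  move=> e e0; have [N [c [k [A [mA hA]]]]] := unif_simple bh e0.
  exists (fun z => c * \1_(setT `*` cyl n j) z + \sum_(i < N) k * \1_(A i `*` cyl n j) z).
    apply: test_cvgD; first by apply: test_cvgZ; exact: rect.
    by apply: test_cvg_sum => i; apply: test_cvgZ; exact: rect.
  move=> [x b]; have indX (B : set S) : \1_(B `*` cyl n j) (x, b) = \1_B x * \1_(cyl n j) b :> R.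
    by rewrite !indicE in_setX/=; case: (x \in B); case: (b \in _); rewrite ?mul1r ?mul0r.
  rewrite indX indicT mul1r.
  rewrite (eq_bigr (fun i : 'I_N => k * \1_(A i) x * \1_(cyl n j) b)); last first.
    by move=> i _; rewrite indX mulrA.
  rewrite -mulr_suml -mulrDl -mulrBl normrM (le_trans _ (hA x))// ler_piMr//.
  by rewrite indicE; case: (b \in _); rewrite ?normr1 ?normr0.
move=> g [bg ug].
have : test_cvg F G' Q (fun z => g (z.1, dec z.2)).
  apply: test_cvg_unif.
    apply: bmeas_comp bg; exact: measurable_fun_pair_map.
  move=> e /ug[n hn].
  (* A representative code of each cylinder; the default value is harmless, as the indicator of an
     empty cylinder is 0. *)
  pose w j : code := if pselect (exists c, prefix c n = j) is left h then sval (cid h) else fun=> false.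
  have wP c : prefix (w (prefix c n)) n = prefix c n.
    rewrite /w; case: pselect => [h|[]]; last by exists c.
    by case: cid.
  exists (fun z : S * code => \sum_(j < 2 ^ n) g (z.1, dec (w j)) * \1_(cyl n j) z.2).
    apply: test_cvg_sum => j; apply: (slice (fun x => g (x, dec (w j)))).
    by apply: bmeas_comp bg; exact: pair2_measurable.
  move=> [x c] /=; rewrite (bigD1 (Ordinal (prefix_lt c n)))//= big1 ?addr0.
    rewrite indicE (_ : c \in cyl n (prefix c n)); last by rewrite inE.
    by rewrite mulr1; apply: hn; rewrite wP.
  move=> j jc; rewrite indicE (_ : c \in cyl n j = false) ?mulr0//.
  apply/negP; rewrite inE /cyl/= => cj; move/negP : jc; apply.
  by apply/eqP/val_inj; rewrite /= cj.
move=> [_]; rewrite expect_law; last first.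
  by apply: bmeas_comp bg; exact: measurable_fun_pair_map.
apply: cvg_trans; apply: near_eq_cvg; apply: nearW => i.
rewrite expect_law; last by apply: bmeas_comp bg; exact: measurable_fun_pair_map.
by apply: eq_Rintegral => -[x y] _ /=; rewrite encK.
Qed.

End compactness.

(** This is [young_representation] for a constant family along the principal ultrafilter on [unit]:
    the limit is then the plan itself. *)
Lemma disintegration (nu : probability S R) (G : probability (S * Y)%type R) :
  (forall A, measurable A -> G (A `*` setT) = nu A) ->
  exists X : S * R -> Y, measurable_fun setT X /\
  forall f, bmeas f -> \int[G]_z f z = \int[(nu \x unif01)%E]_z f (z.1, X z).
Proof.
move=> marg; have [menc mdec encK] := cY.
have me := measurable_fun_pair_map menc.
pose G' : probability (S * code)%type R := law G me.
have UF := @principal_filter_ultra _ tt.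
have [|X mX cX] := @young_representation R unit _ UF _ S nu (fun=> G').
  by move=> _ A mA; rewrite /G' lawE -(marg A mA); congr (G _); apply/seteqP; split => -[].
exists (dec \o X); split; first exact: measurableT_comp.
have mX1 : measurable_fun setT (fun z : S * R => (z.1, X z)).
  exact: measurable_fun_pair.
pose Q : probability (S * code)%type R := law (nu \x unif01)%E mX1.
move=> f bf; have bf' := bmeas_comp (measurable_fun_pair_map mdec) bf.
have <- : \int[G']_z f (z.1, dec z.2) = \int[G]_z f z.
  by rewrite expect_law//; apply: eq_Rintegral => -[x y] _ /=; rewrite encK.
have <- : \int[Q]_z f (z.1, dec z.2) = \int[(nu \x unif01)%E]_z f (z.1, (dec \o X) z).
  by rewrite expect_law.
apply: probability_ext => //; apply: cylinder_unique => A n j mA.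
have mc := measurableX mA (measurable_cyl n j).
have := cX A n j mA; rewrite -[X in _ --> X](_ : fine (Q (A `*` cyl n j)) = _)//.
move=> /(cvg_unique (@norm_hausdorff _ R)) /(_ (cvg_cst _)) h.
by rewrite -[LHS]fineK ?fin_num_measure// -[RHS]fineK ?fin_num_measure// h.
Qed.

End coding.

(** * The torus *)

Section borel.
Context {R : realType}.

Lemma cvgr_sum (I : Type) (F : set_system I) (FF : Filter F) (J : Type) (r : seq J)
  (f : J -> I -> R) (l : J -> R) : (forall j, f j i @[i --> F] --> l j) ->
  \sum_(j <- r) f j i @[i --> F] --> \sum_(j <- r) l j.
Proof.
move=> h; elim: r => [|j r IH].
  by rewrite big_nil; under eq_fun do rewrite big_nil; exact: cvg_cst.
by rewrite big_cons; under eq_fun do rewrite big_cons; exact: cvgD.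
Qed.

Lemma measurable_of_open d (X : measurableType d) (f : X -> R) :
  (forall a b, measurable (f @^-1` `]a, b[)) -> measurable_fun setT f.
Proof.
move=> mf mD; apply: (measurability _ (RGenOpens.measurableE R)) => //.
by move=> _ [_ [a [b ->]] <-]; rewrite setTI.
Qed.

Context {d : nat}.
Local Notation Rd := 'rV[R]_d.

Lemma open_measurable_rV (A : set Rd) : open A -> measurable A.
Proof. by move=> oA; apply: sub_gen_smallest. Qed.

Lemma continuous_measurable_rV (f : Rd -> R) : continuous f -> measurable_fun setT f.
Proof.
move=> cf; apply: measurable_of_open => a b; apply: open_measurable_rV.
by apply: open_comp => [x _|]; [exact: cf|exact: interval_open].
Qed.

Lemma measurable_coord (i : 'I_d) : measurable_fun setT (fun v : Rd => v 0 i).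
Proof. by apply: continuous_measurable_rV => v; exact: coord_continuous. Qed.

(** An open set of R^d is the countable union of the rational boxes that it contains, and the
    preimage of a box only involves coordinates. *)
Lemma measurable_rV d' (S : measurableType d') (f : S -> Rd) :
  (forall i, measurable_fun setT (fun x => f x 0 i)) -> measurable_fun setT f.
Proof.
move=> mf; apply: (measurability (@open Rd)) => //.
move=> _ [A oA <-]; rewrite setTI.
pose q (k : 'rV[rat]_d * nat) : Rd := \row_i ratr (k.1 0 i).
pose box k := \bigcap_(i in [set: 'I_d]) ((fun x => f x 0 i) @^-1` ball (q k 0 i) k.2.+1%:R^-1).
pose good k := ball (q k) (k.2.+1%:R^-1 : R) `<=` A.
have mbox k : measurable (box k).
  apply: fin_bigcap_measurable; first exact: finite_finset.
  by move=> i _; rewrite -[X in measurable X]setTI; apply: mf => //; exact: measurable_ball.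
rewrite (_ : f @^-1` A = \bigcup_k (if `[< good k >] then box k else set0)).
  apply: countable_bigcupT_measurable; first exact: countableP.
  by move=> k; case: ifP.
apply/seteqP; split => x /=; last first.
  move=> [k _]; case: ifPn => // /asboolP gk bk; apply: gk.
  by split => [|i j]; [rewrite invr_gt0|rewrite ord1; exact: bk].
move=> Afx; have /nbhs_ballP[e /= e0 eA] : nbhs (f x) A by exact: open_nbhs_nbhs.
pose n := Num.truncn (2 / e).
have n2 : 2 / n.+1%:R < e.
  by rewrite ltr_pdivrMr ?ltr0n// mulrC -ltr_pdivrMr// truncnS_gt.
have rq i : exists r : rat, `|f x 0 i - ratr r| < n.+1%:R^-1.
  have n0 : 0 < n.+1%:R^-1 :> R by rewrite invr_gt0.
  move: (n.+1%:R^-1) n0 => w w0.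
  have [|r] := @rat_in_itvoo R (f x 0 i - w) (f x 0 i + w); first lra.
  by rewrite in_itv/= => /andP[h1 h2]; exists r; rewrite ltr_norml; apply/andP; split; lra.
pose k : 'rV[rat]_d * nat := (\row_i projT1 (cid (rq i)), n).
have kx i : `|q k 0 i - f x 0 i| < n.+1%:R^-1.
  by rewrite !mxE distrC; case: cid.
exists k => //; case: ifPn => [_ i _ /=|/asboolP[]]; first exact: kx.
move=> v [_ vk]; apply: eA; split => // i j; rewrite ord1.
have := vk 0 j; have := kx j; rewrite /ball/= => h1 h2.
have -> : f x 0 j - v 0 j = (q k 0 j - v 0 j) - (q k 0 j - f x 0 j) by ring.
rewrite (le_lt_trans (ler_normB _ _))// (lt_trans _ n2)//.
by rewrite mulr_natl mulr2n ltrD.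
Qed.

End borel.

Section torus_trig.
Context {R : realType} {d : nat}.
Local Notation Td := (torus R d).
Local Notation Rd := 'rV[R]_d.
Local Notation pr := (\pi_Td : Rd -> Td).

Lemma cos_period (a : R) (z : int) : cos (a + (pi *+ 2) * z%:~R) = cos a.
Proof.
case: (intP z) => [|n|n]; first by rewrite mulr0 addr0.
  by rewrite -pmulrn mulr_natr periodicn//; exact: cosD2pi.
rewrite mulrNz -pmulrn mulrN mulr_natr.
by rewrite -{2}[a](subrK (pi *+ 2 *+ n.+1)) (periodicn (@cosD2pi R)).
Qed.

Lemma sin_period (a : R) (z : int) : sin (a + (pi *+ 2) * z%:~R) = sin a.
Proof. by rewrite -!cosBpihalf addrAC cos_period. Qed.

Lemma pi_eqP (u v : Rd) : (\pi_Td u = \pi_Td v) <-> exists z : 'I_d -> int, forall i, u 0 i = v 0 i + (z i)%:~R.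
Proof.
have -> : (\pi_Td u = \pi_Td v) <-> (u - v \in @lattice R d).
  by rewrite -[X in _ <-> is_true X]/((u - v) \in [the zmodClosed _ of @lattice R d]) Quotient.idealrBE; split => [->//|/eqP].
split=> [/mxOverP h|[z hz]].
  have {}h i : exists z : int, u 0 i = v 0 i + z%:~R.
    by have /intrP[z] := h 0 i; rewrite !mxE => hz; exists z; rewrite -hz; ring.
  by exists (fun i => projT1 (cid (h i))) => i; case: cid.
by apply/mxOverP => j i; rewrite ord1 !mxE hz addrC addKr; apply/intrP; exists (z i).
Qed.

(** [repr] is an arbitrary representative; by periodicity the value does not depend on it
    ([cs_pi]). *)
Definition cs (x : Td) (i : 'I_d) : R := cos ((pi *+ 2) * (repr x : Rd) 0 i).
Definition sn (x : Td) (i : 'I_d) : R := sin ((pi *+ 2) * (repr x : Rd) 0 i).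

Lemma repr_piE (v : Rd) : exists z : 'I_d -> int, forall i, (repr (\pi_Td v) : Rd) 0 i = v 0 i + (z i)%:~R.
Proof. by apply/pi_eqP; rewrite reprK. Qed.

Lemma cs_pi (v : Rd) i : cs (\pi_Td v) i = cos ((pi *+ 2) * v 0 i).
Proof. by have [z zE] := repr_piE v; rewrite /cs zE mulrDr cos_period. Qed.

Lemma sn_pi (v : Rd) i : sn (\pi_Td v) i = sin ((pi *+ 2) * v 0 i).
Proof. by have [z zE] := repr_piE v; rewrite /sn zE mulrDr sin_period. Qed.

Lemma piD (u v : Rd) : \pi_Td (u + v) = \pi_Td u + \pi_Td v.
Proof. exact: raddfD. Qed.

Lemma piB (u v : Rd) : \pi_Td (u - v) = \pi_Td u - \pi_Td v.
Proof. exact: raddfB. Qed.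

Lemma csD x y i : cs (x + y) i = cs x i * cs y i - sn x i * sn y i.
Proof. by rewrite -[x]reprK -[y]reprK -piD !(cs_pi, sn_pi) mxE mulrDr cosD. Qed.

Lemma csB x y i : cs (x - y) i = cs x i * cs y i + sn x i * sn y i.
Proof. by rewrite -[x]reprK -[y]reprK -piB !(cs_pi, sn_pi) !mxE mulrBr cosB. Qed.

Lemma snD x y i : sn (x + y) i = sn x i * cs y i + cs x i * sn y i.
Proof. by rewrite -[x]reprK -[y]reprK -piD !(cs_pi, sn_pi) mxE mulrDr sinD. Qed.

Lemma snB x y i : sn (x - y) i = sn x i * cs y i - cs x i * sn y i.
Proof. by rewrite -[x]reprK -[y]reprK -piB !(cs_pi, sn_pi) !mxE mulrBr sinB. Qed.

Lemma cs0 i : cs 0 i = 1.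
Proof. by rewrite -(raddf0 \pi_Td) cs_pi mxE mulr0 cos0. Qed.

Lemma sn0 i : sn 0 i = 0.
Proof. by rewrite -(raddf0 \pi_Td) sn_pi mxE mulr0 sin0. Qed.

Lemma csN x i : cs (- x) i = cs x i.
Proof. by rewrite -[- x]sub0r csB cs0 sn0 mul1r mul0r addr0. Qed.

Lemma snN x i : sn (- x) i = - sn x i.
Proof. by rewrite -[- x]sub0r snB cs0 sn0 mul1r mul0r sub0r. Qed.

Lemma cs2Dsn2 x i : cs x i ^+ 2 + sn x i ^+ 2 = 1.
Proof. exact: cos2Dsin2. Qed.

Lemma cs_bound x i : `|cs x i| <= 1. Proof. exact: cos_max. Qed.
Lemma sn_bound x i : `|sn x i| <= 1. Proof. exact: sin_max. Qed.

Lemma continuous_torus (f : Td -> R) : continuous (f \o pr) -> continuous f.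
Proof. by move=> cf; apply/(@quotient_continuous Rd _ R f). Qed.

Lemma open_measurable_torus (A : set Td) : open A -> measurable A.
Proof. by move=> oA; apply: sub_gen_smallest. Qed.

Lemma continuous_measurable_torus (f : Td -> R) : continuous f -> measurable_fun setT f.
Proof.
move=> cf; apply: measurable_of_open => a b; apply: open_measurable_torus.
by apply: open_comp => [x _|]; [exact: cf|exact: interval_open].
Qed.

Lemma measurable_pi : measurable_fun setT pr.
Proof.
apply: (measurability (@open Td)) => //.
move=> _ [A oA <-]; rewrite setTI; apply: open_measurable_rV.
by apply: open_comp => // x _; exact: pi_continuous.
Qed.

Lemma continuous_cs i : continuous (cs ^~ i).
Proof.
apply: continuous_torus => v.
rewrite (_ : _ \o _ = (fun v : Rd => cos ((pi *+ 2) * v 0 i))); last first.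
  by apply/funext => u /=; rewrite cs_pi.
apply: continuous_comp; last exact: continuous_cos.
apply: (@continuous_comp _ _ _ (fun u : Rd => u 0 i) (fun t => (pi *+ 2) * t)).
  exact: coord_continuous.
exact: mulrl_continuous.
Qed.

Lemma continuous_sn i : continuous (sn ^~ i).
Proof.
apply: continuous_torus => v.
rewrite (_ : _ \o _ = (fun v : Rd => sin ((pi *+ 2) * v 0 i))); last first.
  by apply/funext => u /=; rewrite sn_pi.
apply: continuous_comp; last exact: continuous_sin.
apply: (@continuous_comp _ _ _ (fun u : Rd => u 0 i) (fun t => (pi *+ 2) * t)).
  exact: coord_continuous.
exact: mulrl_continuous.
Qed.

Lemma bmeas_cs i : bmeas (cs ^~ i).
Proof.
split; first by apply: continuous_measurable_torus; exact: continuous_cs.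
by exists 1 => x; exact: cs_bound.
Qed.

Lemma bmeas_sn i : bmeas (sn ^~ i).
Proof.
split; first by apply: continuous_measurable_torus; exact: continuous_sn.
by exists 1 => x; exact: sn_bound.
Qed.

(* Smooth substitute for the squared distance to 0, which it dominates. *)
Definition cost (x : Td) : R := \sum_(i < d) (1 - cs x i).

Lemma cost_ge0 x : 0 <= cost x.
Proof.
apply: sumr_ge0 => i _; rewrite subr_ge0.
by have := cs_bound x i; rewrite ler_norml => /andP[].
Qed.

Lemma cost0 : cost 0 = 0.
Proof. by rewrite /cost big1// => i _; rewrite cs0 subrr. Qed.

Lemma costN x : cost (- x) = cost x.
Proof. by apply: eq_bigr => i _; rewrite csN. Qed.

End torus_trig.

(** * Elementary inequalities for sine and cosine *)

Section trig_inequalities.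
Context {R : realType}.
Implicit Types x y : R.

Lemma mean_value (f df : R -> R) a b : a < b -> (forall x, is_derive x 1 f (df x)) ->
  exists2 c, a < c < b & f b - f a = df c * (b - a).
Proof.
move=> ab fd; have cf : {within `[a, b], continuous f}.
  apply: continuous_subspaceT => x; apply: differentiable_continuous.
  exact/derivable1_diffP/ex_derive.
have [c] := @MVT R f df a b ab (fun x _ => fd x) cf.
by rewrite in_itv/=; exists c.
Qed.

Lemma sin_norm_le x : `|sin x| <= `|x|.
Proof.
wlog x0 : x / 0 <= x.
  move=> h; case: (leP 0 x) => [/h//|x0].
  by rewrite -normrN -sinN -[leRHS]normrN h// oppr_ge0 ltW.
move: x0; rewrite le_eqVlt => /predU1P[<-|x0]; first by rewrite sin0.
have [c _] := mean_value x0 (@is_derive_sin R).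
by rewrite sin0 !subr0 => ->; rewrite normrM ler_piMl// cos_max.
Qed.

Lemma one_sub_cos x : 1 - cos x = 2 * sin (x / 2) ^+ 2.
Proof.
have -> : cos x = cos ((x / 2) *+ 2) by congr cos; rewrite mulr2n; lra.
by rewrite cos_mulr2n sin2cos2; lra.
Qed.

Lemma one_sub_cos_ge0 x : 0 <= 1 - cos x.
Proof. by rewrite subr_ge0 cos_le1. Qed.

Lemma one_sub_cos_le x : 1 - cos x <= x ^+ 2 / 2.
Proof.
rewrite one_sub_cos; have := sin_norm_le (x / 2).
rewrite -(@ler_pXn2r _ 2)// ?nnegrE// !real_normK ?num_real// => h.
by rewrite exprMn in h; lra.
Qed.

Lemma sin_sub_le x : `|x - sin x| <= `|x| ^+ 3 / 2.
Proof.
wlog x0 : x / 0 <= x.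
  move=> h; case: (leP 0 x) => [/h//|x0].
  have := h (- x); rewrite oppr_ge0 ltW// sinN -opprD !normrN => /(_ isT).
  by [].
move: x0; rewrite le_eqVlt => /predU1P[<-|x0].
  by rewrite sin0 subr0 normr0 expr0n/= mul0r.
have [c /andP[c0 cx]] := @mean_value (fun y => y - sin y) (fun y => 1 - cos y) 0 x x0
  (fun y => is_deriveB _ _).
rewrite sin0 !subr0 => ->.
rewrite normrM ger0_norm ?one_sub_cos_ge0// exprSr -mulrAC ler_wpM2r//.
rewrite (le_trans (one_sub_cos_le c))// ler_wpM2r ?invr_ge0//.
rewrite real_normK ?num_real//.
by rewrite ler_pXn2r ?nnegrE ?ltW// (lt_trans c0).
Qed.

Lemma cos_taylor x : `|1 - cos x - x ^+ 2 / 2| <= x ^+ 4.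
Proof.
rewrite one_sub_cos; set h := x / 2.
have -> : 2 * sin h ^+ 2 - x ^+ 2 / 2 = - (2 * ((h - sin h) * (h + sin h))).
  by rewrite /h; field.
rewrite normrN !normrM ger0_norm//.
have h1 := sin_sub_le h; have h2 : `|h + sin h| <= 2 * `|h|.
  by rewrite (le_trans (ler_normD _ _))//; have := sin_norm_le h; lra.
rewrite (@le_trans _ _ (2 * (`|h| ^+ 3 / 2 * (2 * `|h|))))//.
  by rewrite ler_pM2l// ler_pM.
have -> : x ^+ 4 = `|x| ^+ 4 by rewrite -normrX ger0_norm// (exprM x 2 2) sqr_ge0.
have -> : `|x| = 2 * `|h| by rewrite /h normrM (ger0_norm (x := 2^-1)) ?invr_ge0//; lra.
have : 0 <= `|h| ^+ 4 by rewrite exprn_ge0.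
by move: `|h| => k k0; rewrite !exprS expr0 in k0 *; lra.
Qed.

(** With sin x = 2 cos (x / 2) sin (x / 2) and sin (x / 2) = cos c * (x / 2) for some c < x / 2,
    monotonicity of the cosine gives sin x >= cos (x / 2) ^ 2 * x = (1 + cos x) / 2 * x. *)
Lemma sin_ge_half x : 0 <= x <= pi / 2 -> x / 2 <= sin x.
Proof.
move=> /andP[]; rewrite le_eqVlt => /predU1P[<-|x0] xpi; first by rewrite mul0r sin0.
have [|c /andP[c0 cx]] := mean_value (a := 0) (b := x / 2) _ (@is_derive_sin R); first lra.
rewrite sin0 !subr0 => sE.
have pi0 := @pi_gt0 R.
have cc : cos (x / 2) <= cos c.
  have [->//|ne] := eqVneq c (x / 2).
  by apply/ltW; rewrite ltr_cos ?in_itv/=; first by []; apply/andP; split; lra.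
have cosx : 0 <= cos x by apply: cos_ge0_pihalf; apply/andP; split; lra.
have cosh : 0 <= cos (x / 2) by apply: cos_ge0_pihalf; apply/andP; split; lra.
have -> : sin x = 2 * (cos (x / 2) * sin (x / 2)).
  by rewrite mulr_natl -sin_mulr2n; congr sin; rewrite mulr2n; lra.
have h2 : cos (x / 2) ^+ 2 = (1 + cos x) / 2.
  by have := one_sub_cos x; rewrite sin2cos2; lra.
rewrite sE; have : cos (x / 2) * (cos c * (x / 2)) >= cos (x / 2) ^+ 2 * (x / 2).
  by rewrite expr2 -mulrA ler_wpM2l// ler_wpM2r//; lra.
by rewrite h2; nra.
Qed.

(** The left side of 2 sin (pi x) ^ 2 = 1 - cos (2 pi x) is bounded below by [sin_ge_half], as pi
    |x| <= pi / 2; then pi >= 2 gives sin (pi |x|) >= |x|. *)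
Lemma one_sub_cos2pi_ge x : `|x| <= 2^-1 -> x ^+ 2 <= 1 - cos ((pi *+ 2) * x).
Proof.
move=> x2; rewrite one_sub_cos.
have -> : (pi *+ 2) * x / 2 = pi * x by rewrite mulr2n; lra.
have -> : sin (pi * x) ^+ 2 = sin (pi * `|x|) ^+ 2.
  by case: (lerP 0 x) => x0; rewrite ?(ger0_norm x0) ?(ltr0_norm x0) ?mulrN ?sinN ?sqrrN.
have pi0 := @pi_ge2 R.
have h : pi * `|x| / 2 <= sin (pi * `|x|).
  by apply: sin_ge_half; rewrite mulr_ge0 ?ler_pM2l//; lra.
have {}h : `|x| <= sin (pi * `|x|) by apply: le_trans h; have := normr_ge0 x; nra.
have := h; rewrite -(@ler_pXn2r _ 2)// ?nnegrE ?(le_trans _ h)//.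
by rewrite real_normK ?num_real//; have := sqr_ge0 x; lra.
Qed.

End trig_inequalities.

Section euclidean_norm.
Context {R : realType} {d : nat}.
Implicit Types u v : 'rV[R]_d.

Lemma dotC u v : dot u v = dot v u.
Proof. by apply: eq_bigr => i _; rewrite mulrC. Qed.

Lemma dotDl u u' v : dot (u + u') v = dot u v + dot u' v.
Proof. by rewrite /dot -big_split; apply: eq_bigr => i _; rewrite mxE mulrDl. Qed.

Lemma dotZl a u v : dot (a *: u) v = a * dot u v.
Proof. by rewrite /dot mulr_sumr; apply: eq_bigr => i _; rewrite mxE mulrA. Qed.

Lemma dotNl u v : dot (- u) v = - dot u v.
Proof. by rewrite -scaleN1r dotZl mulN1r. Qed.

Lemma dot_ge0 v : 0 <= dot v v.
Proof. by apply: sumr_ge0 => i _; rewrite -expr2 sqr_ge0. Qed.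

Lemma enorm_ge0 v : 0 <= enorm v. Proof. exact: sqrtr_ge0. Qed.

Lemma enorm_sqr v : enorm v ^+ 2 = dot v v.
Proof. by rewrite sqr_sqrtr// dot_ge0. Qed.

Lemma enorm_le v c : 0 <= c -> dot v v <= c ^+ 2 -> enorm v <= c.
Proof. by move=> c0 h; rewrite -(@ler_pXn2r _ 2)// ?nnegrE ?enorm_ge0// enorm_sqr. Qed.

Lemma coord_le_enorm v i : `|v 0 i| <= enorm v.
Proof.
rewrite -(@ler_pXn2r _ 2)// ?nnegrE ?enorm_ge0// enorm_sqr real_normK ?num_real//.
by rewrite /dot (bigD1 i)//= -expr2 lerDl sumr_ge0// => j _; rewrite -expr2 sqr_ge0.
Qed.

Lemma dot_le u v : dot u v <= enorm u * enorm v.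
Proof.
have [u0|u0] := eqVneq (enorm u) 0.
  rewrite u0 mul0r /dot big1// => i _; have := coord_le_enorm u i.
  by rewrite u0 normr_le0 => /eqP ->; rewrite mul0r.
have [v0|v0] := eqVneq (enorm v) 0.
  rewrite v0 mulr0 /dot big1// => i _; have := coord_le_enorm v i.
  by rewrite v0 normr_le0 => /eqP ->; rewrite mulr0.
have up : 0 < enorm u by rewrite lt_neqAle eq_sym u0 enorm_ge0.
have vp : 0 < enorm v by rewrite lt_neqAle eq_sym v0 enorm_ge0.
(* With |u| for [enorm u], the square of |v| u - |u| v is 2 |u| |v| (|u| |v| - u.v). *)
have := dot_ge0 (enorm v *: u + - (enorm u *: v)).
rewrite !(dotDl, dotNl, dotZl) ![dot _ (_ + _)]dotC !(dotDl, dotNl, dotZl).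
rewrite -!enorm_sqr (dotC v u) => h.
have : 0 <= (enorm u * enorm v) * (2 * (enorm u * enorm v - dot u v)) by nra.
by rewrite pmulr_rge0 ?mulr_gt0// pmulr_rge0// subr_ge0.
Qed.

Lemma enormN v : enorm (- v) = enorm v.
Proof. by rewrite /enorm dotNl dotC dotNl opprK. Qed.

Lemma normr_dot_le u v : `|dot u v| <= enorm u * enorm v.
Proof. by rewrite ler_norml dot_le andbT lerNl -dotNl (le_trans (dot_le _ _))// enormN. Qed.

Lemma enormD u v : enorm (u + v) <= enorm u + enorm v.
Proof.
apply: enorm_le; first by rewrite addr_ge0 ?enorm_ge0.
rewrite dotDl ![dot _ (_ + _)]dotC !dotDl -!enorm_sqr (dotC v u).
by have := dot_le u v; nra.
Qed.

Lemma enormZ a v : enorm (a *: v) = `|a| * enorm v.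
Proof. by rewrite /enorm dotZl dotC dotZl mulrA -expr2 sqrtrM ?sqr_ge0// sqrtr_sqr. Qed.

Lemma enorm_le_sum v : enorm v <= \sum_(i < d) `|v 0 i|.
Proof.
apply: enorm_le; first by apply: sumr_ge0.
rewrite expr2 mulr_suml; apply: ler_sum => i _.
rewrite -expr2 -real_normK ?num_real// expr2 ler_wpM2l//.
by rewrite (bigD1 i)//= lerDl sumr_ge0.
Qed.

Lemma enorm_coords_le v c : (forall i, `|v 0 i| <= c) -> enorm v <= d%:R * c.
Proof.
move=> h; rewrite (le_trans (enorm_le_sum v))//.
by rewrite (@le_trans _ _ (\sum_(i < d) c)) ?ler_sum// sumr_const card_ord mulr_natl.
Qed.

Lemma continuous_enorm : continuous (enorm : 'rV[R]_d -> R).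
Proof.
move=> v; apply: (@continuous_comp _ _ _ (fun u => dot u u) Num.sqrt).
  apply: (@cvgr_sum _ _ (nbhs v) (nbhs_filter v) _ _ (fun i u => u 0 i * u 0 i) (fun i => v 0 i * v 0 i)) => i.
  by apply: cvgM; exact: coord_continuous.
exact: sqrt_continuous.
Qed.

Lemma measurable_enorm : measurable_fun setT (enorm : 'rV[R]_d -> R).
Proof. by apply: continuous_measurable_rV; exact: continuous_enorm. Qed.

End euclidean_norm.

Section torus_distance.
Context {R : realType} {d : nat}.
Local Notation Td := (torus R d).
Local Notation Rd := 'rV[R]_d.
Implicit Types x y z : Td.

Lemma tdist_ge0 x y : 0 <= tdist x y.
Proof.
rewrite /tdist; apply: lb_le_inf; first by exists (enorm (repr (x - y) : Rd)), (repr (x - y)) => //; rewrite /= reprK.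
by move=> _ [v _ <-]; exact: enorm_ge0.
Qed.

Lemma tdist_le x y (v : Rd) : \pi_Td v = x - y -> tdist x y <= enorm v.
Proof.
move=> h; apply: ge_inf; last by exists v.
by exists 0 => _ [u _ <-]; exact: enorm_ge0.
Qed.

Lemma centered_repr x : exists2 v : Rd, \pi_Td v = x & forall i, `|v 0 i| <= 2^-1.
Proof.
pose r : Rd := repr x.
exists (\row_i (r 0 i - (Num.floor (r 0 i + 2^-1))%:~R)).
  rewrite -[RHS]reprK; apply/pi_eqP.
  by exists (fun i => - Num.floor (r 0 i + 2^-1)) => i; rewrite mxE intrN.
move=> i; rewrite mxE ler_norml.
have := floor_le (r 0 i + 2^-1); have := floorD1_gt (r 0 i + 2^-1); rewrite intrD1.
by move: (Num.floor _)%:~R => n h1 h2; apply/andP; split; lra.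
Qed.

Lemma tdist_bound x y : tdist x y <= d%:R.
Proof.
have [v vx vh] := centered_repr (x - y).
rewrite (le_trans (tdist_le vx))// -[leRHS]mulr1 enorm_coords_le// => i.
by rewrite (le_trans (vh i))//; lra.
Qed.

(** The distance is at most the norm of the representative with coordinates in [-1/2, 1/2], to which
    [one_sub_cos2pi_ge] applies in each coordinate. *)
Lemma tdist_cost x y : tdist x y ^+ 2 <= cost (x - y).
Proof.
have [v vx vh] := centered_repr (x - y).
rewrite (@le_trans _ _ (enorm v ^+ 2))//.
  by rewrite ler_pXn2r ?nnegrE ?tdist_ge0 ?enorm_ge0// tdist_le.
rewrite enorm_sqr -vx /cost; apply: ler_sum => i _.
by rewrite cs_pi -expr2 one_sub_cos2pi_ge.
Qed.

Variable delta : Td -> Td -> Rd.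
Hypothesis delta_min : minimal_difference delta.

Lemma delta_pi x y : \pi_Td (delta x y) = x - y.
Proof. by have [_ /(_ x y)[]] := delta_min. Qed.

Lemma enorm_delta x y : enorm (delta x y) = tdist x y.
Proof. by have [_ /(_ x y)[]] := delta_min. Qed.

Lemma measurable_delta : measurable_fun setT (fun q : Td * Td => delta q.1 q.2).
Proof. by case: delta_min. Qed.

Lemma bmeas_delta i : bmeas (fun q : Td * Td => delta q.1 q.2 0 i).
Proof.
split; first exact: (measurableT_comp (measurable_coord i) measurable_delta).
by exists d%:R => q; rewrite (le_trans (coord_le_enorm _ _))// enorm_delta tdist_bound.
Qed.

Lemma bmeas_tdist : bmeas (fun q : Td * Td => tdist q.1 q.2).
Proof.
split; last by exists d%:R => q; rewrite ger0_norm ?tdist_ge0// tdist_bound.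
rewrite (_ : (fun q => _) = (fun q : Td * Td => enorm (delta q.1 q.2))).
  exact: (measurableT_comp measurable_enorm measurable_delta).
by apply/funext => q; rewrite enorm_delta.
Qed.

End torus_distance.

(** * Binary expansion of real numbers *)

Section binary_expansion.
Context {R : realType}.

Lemma measurable_truncn : measurable_fun setT (Num.truncn : R -> nat).
Proof.
move=> _ Y _; rewrite setTI.
have mle n : measurable [set x : R | (Num.truncn x <= n)%N].
  rewrite (_ : [set _ | _] = `]-oo, n.+1%:R[%classic); first exact: measurable_itv.
  by apply/seteqP; split => x /=; rewrite in_itv/= truncn_le_nat.
rewrite (_ : _ @^-1` Y = \bigcup_(n in Y) [set x : R | Num.truncn x = n]).
  apply: bigcup_measurable => -[|n] _.
    by rewrite (_ : [set x : R | _] = [set x : R | (Num.truncn x <= 0)%N])//;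
       apply/seteqP; split => x /=; rewrite leqn0 => /eqP.
  rewrite (_ : [set x : R | _] = [set x : R | (Num.truncn x <= n.+1)%N] `\` [set x | (Num.truncn x <= n)%N]).
    exact: measurableD.
  apply/seteqP; split => x /=; first by move=> ->; rewrite leqnn ltnn.
  by move=> [h1 /negP]; rewrite -ltnNge => h2; apply/eqP; rewrite eqn_leq h1.
by apply/seteqP; split => x /= => [Yx|[n Yn ->]//]; exists (Num.truncn x).
Qed.

Definition digit (r : R) (l : nat) : bool := odd (Num.truncn (2 ^+ l.+1 * r)).

Definition partial_val (b : nat -> bool) n : R := \sum_(l < n) (b l)%:R / 2 ^+ l.+1.

Lemma partial_val_mono b n m : (n <= m)%N ->
  partial_val b n <= partial_val b m <= partial_val b n + (2 ^+ n)^-1 - (2 ^+ m)^-1.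
Proof.
elim: m => [|m IH]; first by rewrite leqn0 => /eqP ->; rewrite addrK lexx.
rewrite leq_eqVlt ltnS => /predU1P[<-|/IH /andP[h1 h2]]; first by rewrite addrK lexx.
rewrite /partial_val big_ord_recr/= -!/(partial_val b _).
have m0 : 0 < (2 ^+ m.+1)^-1 :> R by rewrite invr_gt0 exprn_gt0.
have m1 : (2 ^+ m)^-1 = 2 * (2 ^+ m.+1)^-1 :> R.
  by rewrite exprS invfM mulrA divff ?mul1r// pnatr_eq0.
have b0 : 0 <= (b m)%:R / 2 ^+ m.+1 :> R by case: (b m); rewrite ?mul1r ?mul0r// ltW.
have b1 : (b m)%:R / 2 ^+ m.+1 <= (2 ^+ m.+1)^-1 :> R.
  by case: (b m); rewrite ?mul1r ?mul0r// ltW.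
by rewrite m1 in h2; apply/andP; split; lra.
Qed.

Lemma partial_val_cvg b : cvg (partial_val b @ \oo).
Proof.
apply: nondecreasing_is_cvgn; first by move=> n m /(partial_val_mono b) /andP[].
exists 1 => _ [n _ <-]; have /andP[_] := partial_val_mono b (leq0n n).
rewrite /partial_val big_ord0 add0r expr0 invr1 => h; apply: le_trans h _.
by rewrite gerBl invr_ge0 exprn_ge0.
Qed.

Definition val b : R := lim (partial_val b @ \oo).

Lemma val_approx b n : partial_val b n <= val b <= partial_val b n + (2 ^+ n)^-1.
Proof.
apply/andP; split.
  apply: limr_ge; first exact: partial_val_cvg.
  by exists n => // m /= /(partial_val_mono b) /andP[].
apply: limr_le; first exact: partial_val_cvg.
exists n => // m /= /(partial_val_mono b) /andP[_] h; rewrite (le_trans h)//.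
by rewrite gerBl invr_ge0 exprn_ge0.
Qed.

Lemma val_close b b' n : (forall l, (l < n)%N -> b l = b' l) ->
  `|val b - val b'| <= (2 ^+ n)^-1.
Proof.
move=> bb'; have E : partial_val b n = partial_val b' n.
  by apply: eq_bigr => l _; rewrite bb'.
have /andP[h1 h2] := val_approx b n; have /andP[h3 h4] := val_approx b' n.
by rewrite E in h1 h2; rewrite ler_norml; apply/andP; split; lra.
Qed.

Lemma val_unit b : 0 <= val b <= 1.
Proof. by have := val_approx b 0; rewrite /partial_val big_ord0 add0r expr0 invr1. Qed.

Lemma truncn_half (x : R) : 0 <= x ->
  (Num.truncn (2 * x) = odd (Num.truncn (2 * x)) + (Num.truncn x).*2)%N.
Proof.
move=> x0; rewrite -[LHS]odd_double_half; congr (_ + _.*2)%N.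
have := @truncn_itv R _ (mulr_ge0 (ler0n R 2) x0); set n := Num.truncn (2 * x).
move=> /andP[n1 n2]; apply/esym/truncn_def.
have En : n = (odd n + n./2.*2)%N by rewrite odd_double_half.
have hh : n%:R <= 2 * n./2%:R + 1 :> R.
  by rewrite -natrM natr1 ler_nat {1}En mul2n; case: (odd n).
have hh' : 2 * n./2%:R <= n%:R :> R by rewrite -natrM ler_nat mul2n {2}En leq_addl.
rewrite -natr1 in n2; rewrite -natr1; apply/andP; split; first lra.
have : n%:R + 1 <= 2 * n./2%:R + 2 :> R by lra.
by lra.
Qed.

Lemma partial_val_digit (r : R) n : 0 <= r < 1 ->
  partial_val (digit r) n = (Num.truncn (2 ^+ n * r))%:R / 2 ^+ n.
Proof.
move=> /andP[r0 r1]; elim: n => [|n IH].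
  rewrite /partial_val big_ord0 expr0 mul1r divr1; apply/esym.
  by rewrite (@truncn_def _ _ 0)// r0.
rewrite /partial_val big_ord_recr/= -/(partial_val _ _) IH /digit.
have p0 : 2 ^+ n != 0 :> R by rewrite expf_neq0.
rewrite exprS -mulrA [in RHS]truncn_half ?mulr_ge0 ?exprn_ge0//.
by rewrite natrD -mul2n natrM; field.
Qed.

Lemma val_digit (r : R) : 0 <= r < 1 -> val (digit r) = r.
Proof.
move=> r01; apply/eqP; rewrite -subr_eq0 -normr_le0; apply/ler_addgt0Pr => e e0.
rewrite add0r.
pose n := Num.truncn (e^-1).
have n2 : (2 ^+ n)^-1 <= e.
  rewrite -[leRHS]invrK lef_pV2 ?posrE ?exprn_gt0 ?invr_gt0//.
  rewrite (le_trans (ltW (truncnS_gt _)))// -natrX ler_nat -/n; exact: ltn_expl.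
have /andP[h1 h2] := val_approx (digit r) n.
have p0 : 0 < 2 ^+ n :> R by rewrite exprn_gt0.
have /andP[r0 r1] := r01.
have := @truncn_itv R (2 ^+ n * r); rewrite mulr_ge0 ?exprn_ge0// => /(_ isT)/andP[t1 t2].
move: h1 h2; rewrite partial_val_digit//; set t := (Num.truncn _)%:R => h1 h2.
have t1' : t / 2 ^+ n <= r by rewrite ler_pdivrMr// mulrC.
have t2' : r < t / 2 ^+ n + (2 ^+ n)^-1.
  by rewrite -[X in _ + X]mul1r -mulrDl ltr_pdivlMr// mulrC natr1.
by apply: le_trans n2; rewrite ler_norml; apply/andP; split; lra.
Qed.

Lemma measurable_val d (S : measurableType d) (b : S -> nat -> bool) :
  (forall l, measurable_fun setT (fun x => b x l)) -> measurable_fun setT (fun x => val (b x)).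
Proof.
move=> mb; apply: (@measurable_fun_cvg _ _ _ _ (fun n x => partial_val (b x) n)).
  move=> n; rewrite /partial_val; elim: n => [|n IH].
    by under eq_fun do rewrite big_ord0; exact: measurable_cst.
  under eq_fun do rewrite big_ord_recr/=; apply: measurable_funD => //.
  apply: measurable_funM => //.
  exact: (@measurableT_comp _ _ _ _ _ _ (fun t : bool => t%:R : R)).
by move=> x _; exact: partial_val_cvg.
Qed.

End binary_expansion.

Lemma filter_ex2 (T : Type) (F : set_system T) (PF : ProperFilter F) (A B : set T) :
  F A -> F B -> exists x, A x /\ B x.
Proof. move=> FA FB; have FAB : F (A `&` B) by exact: filterI.
by have [x [Ax Bx]] := filter_ex FAB; exists x. Qed.

Section digital.
Context {R : realType}.

(* Functions that depend, up to a uniformly small error, on finitely many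
   digits only: the analogue on coded spaces of continuous functions. *)
Definition digital (Y : Type) (dec : code -> Y) (f : Y -> R) :=
  bdd f /\ forall e, 0 < e -> exists n, forall c c', prefix c n = prefix c' n ->
    `|f (dec c) - f (dec c')| <= e.

Context (Y : Type) (dec : code -> Y).
Implicit Types f g : Y -> R.

Lemma digital_cst k : digital dec (fun=> k).
Proof. by split; first (by exists `|k|); move=> e /ltW e0; exists 0%N => c c' _; rewrite subrr normr0. Qed.

Lemma digitalD f g : digital dec f -> digital dec g -> digital dec (fun x => f x + g x).
Proof.
move=> [[M fM] df] [[N gN] dg]; split.
  by exists (M + N) => x; rewrite (le_trans (ler_normD _ _))// lerD.
move=> e e0; have e2 : 0 < e / 2 by rewrite divr_gt0.
have [n hn] := df _ e2; have [m hm] := dg _ e2; exists (maxn n m) => c c' E.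
rewrite opprD addrACA (le_trans (ler_normD _ _))// [leRHS]splitr lerD//.
  by apply: hn; apply: eq_prefix E; rewrite leq_maxl.
by apply: hm; apply: eq_prefix E; rewrite leq_maxr.
Qed.

Lemma digitalM f g : digital dec f -> digital dec g -> digital dec (fun x => f x * g x).
Proof.
move=> [[M fM] df] [[N gN] dg]; split.
  by exists (M * N) => x; rewrite normrM ler_pM.
move=> e e0; pose K := `|M| + `|N| + 1.
have K0 : 0 < K by rewrite ltr_wpDl// addr_ge0.
have e2 : 0 < e / K / 2 by rewrite !divr_gt0.
have [n hn] := df _ e2; have [m hm] := dg _ e2; exists (maxn n m) => c c' E.
have h1 : `|f (dec c) - f (dec c')| <= e / K / 2 by apply: hn; apply: eq_prefix E; rewrite leq_maxl.
have h2 : `|g (dec c) - g (dec c')| <= e / K / 2 by apply: hm; apply: eq_prefix E; rewrite leq_maxr.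
have -> : f (dec c) * g (dec c) - f (dec c') * g (dec c') =
  (f (dec c) - f (dec c')) * g (dec c) + f (dec c') * (g (dec c) - g (dec c')) by ring.
have fK : `|f (dec c')| <= K.
  by rewrite (le_trans (fM _))// (le_trans (ler_norm M))// /K -addrA lerDl addr_ge0.
have gK : `|g (dec c)| <= K.
  by rewrite (le_trans (gN _))// (le_trans (ler_norm N))// /K addrAC lerDr addr_ge0.
rewrite (le_trans (ler_normD _ _))// !normrM.
rewrite (@le_trans _ _ (e / K / 2 * K + K * (e / K / 2)))//.
  by rewrite lerD// ler_pM.
by rewrite le_eqVlt; apply/orP; left; apply/eqP; field; rewrite gt_eqF.
Qed.

Lemma digitalZ k f : digital dec f -> digital dec (fun x => k * f x).
Proof. by move=> df; apply: digitalM => //; exact: digital_cst. Qed.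

Lemma digital_sum (I : Type) (r : seq I) (F : I -> Y -> R) :
  (forall i, digital dec (F i)) -> digital dec (fun x => \sum_(i <- r) F i x).
Proof.
move=> dF; elim: r => [|i r IH].
  by under eq_fun do rewrite big_nil; exact: digital_cst.
by under eq_fun do rewrite big_cons; exact: digitalD.
Qed.

End digital.

Section product_coding.
Context {R : realType} d1 (Y1 : measurableType d1) d2 (Y2 : measurableType d2).
Context (enc1 : Y1 -> code) (dec1 : code -> Y1) (c1 : coding enc1 dec1).
Context (enc2 : Y2 -> code) (dec2 : code -> Y2) (c2 : coding enc2 dec2).

Definition enc_prod (y : Y1 * Y2) : code :=
  fun n => if odd n then enc2 y.2 n./2 else enc1 y.1 n./2.
Definition dec_prod (c : code) : Y1 * Y2 :=
  (dec1 (fun n => c n.*2), dec2 (fun n => c n.*2.+1)).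

Lemma coding_prod : coding enc_prod dec_prod.
Proof.
have [me1 md1 k1] := c1; have [me2 md2 k2] := c2; split.
- apply: measurable_code => n; rewrite /enc_prod; case: (odd n).
    by apply: (@measurableT_comp _ _ _ _ _ _ (fun c : code => c n./2) _ (enc2 \o snd));
      [exact: measurable_bit|exact: measurableT_comp].
  by apply: (@measurableT_comp _ _ _ _ _ _ (fun c : code => c n./2) _ (enc1 \o fst));
      [exact: measurable_bit|exact: measurableT_comp].
- have mb (h : nat -> nat) : measurable_fun setT (fun c : code => (fun n => c (h n)) : code).
    by apply: measurable_code => n; exact: measurable_bit.
  apply: measurable_fun_pair.
    exact: (measurableT_comp md1 (mb double)).
  exact: (measurableT_comp md2 (mb (fun n => n.*2.+1))).
move=> [y z]; rewrite /dec_prod /enc_prod/=; congr pair.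
  by rewrite -[RHS]k1; congr dec1; apply/funext => n; rewrite odd_double doubleK.
by rewrite -[RHS]k2; congr dec2; apply/funext => n; rewrite /= odd_double/= uphalf_double.
Qed.

Lemma prefix_agree (c c' : code) n : (forall m, (m < n)%N -> c m = c' m) -> prefix c n = prefix c' n.
Proof. by elim: n => //= n IH h; rewrite h// IH// => m mn; apply: h; rewrite ltnW. Qed.

Lemma digital_fst (f : Y1 -> R) : digital dec1 f -> digital dec_prod (f \o fst).
Proof.
move=> [[M fM] df]; split; first by exists M => y; exact: fM.
move=> e /df[n hn]; exists n.*2 => c c' E; apply: hn; apply: prefix_agree => m mn.
by apply: prefix_bit E; rewrite ltn_double.
Qed.

Lemma digital_snd (f : Y2 -> R) : digital dec2 f -> digital dec_prod (f \o snd).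
Proof.
move=> [[M fM] df]; split; first by exists M => y; exact: fM.
move=> e /df[n hn]; exists n.*2 => c c' E; apply: hn; apply: prefix_agree => m mn.
by apply: prefix_bit E; rewrite -doubleS leq_double.
Qed.

End product_coding.

Section prefix_tests.
Context {R : realType} d (S : measurableType d) d' (Y : measurableType d') (dec : code -> Y).

Lemma prefix_test_cst k : prefix_test dec (fun _ : S * Y => k : R).
Proof.
split; first exact: bmeas_cst.
by move=> e e0; exists 0%N => x c c' _; rewrite subrr normr0 ltW.
Qed.

Lemma prefix_testD (f g : S * Y -> R) : prefix_test dec f -> prefix_test dec g ->
  prefix_test dec (fun z => f z + g z).
Proof.
move=> [bf uf] [bg ug]; split; first exact: bmeasD.
move=> e e0; have e2 : 0 < e / 2 by rewrite divr_gt0.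
have [n hn] := uf _ e2; have [m hm] := ug _ e2; exists (maxn n m) => x c c' E.
rewrite opprD addrACA (le_trans (ler_normD _ _))// [leRHS]splitr lerD//.
  by apply: hn; apply: eq_prefix E; rewrite leq_maxl.
by apply: hm; apply: eq_prefix E; rewrite leq_maxr.
Qed.

Lemma prefix_testM (f : S -> R) (g : Y -> R) : bmeas f -> bmeas g -> digital dec g ->
  prefix_test dec (fun z => f z.1 * g z.2).
Proof.
move=> bf bg [_ dg]; split.
  by apply: bmeasM; [exact: (bmeas_comp measurable_fst)|exact: (bmeas_comp measurable_snd)].
have [mf [M fM]] := bf => e e0; have M1 : 0 < `|M| + 1 by rewrite ltr_wpDl.
have [n hn] := dg (e / (`|M| + 1)) (divr_gt0 e0 M1); exists n => x c c' E.
rewrite -mulrBr normrM -[leRHS](@divfK _ (`|M| + 1)) ?gt_eqF// mulrC ler_pM//.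
  exact: hn.
by rewrite (le_trans (fM _))// (le_trans (ler_norm M))// lerDl.
Qed.

Lemma prefix_test_snd (g : Y -> R) : bmeas g -> digital dec g ->
  prefix_test dec (fun z : S * Y => g z.2).
Proof.
move=> bg dg; have := prefix_testM (bmeas_cst S 1) bg dg.
by under eq_fun do rewrite mul1r.
Qed.

Lemma prefix_test_sum (I : Type) (r : seq I) (F : I -> S * Y -> R) :
  (forall i, prefix_test dec (F i)) -> prefix_test dec (fun x => \sum_(i <- r) F i x).
Proof.
move=> dF; elim: r => [|i r IH].
  by under eq_fun do rewrite big_nil; exact: prefix_test_cst.
by under eq_fun do rewrite big_cons; exact: prefix_testD.
Qed.

End prefix_tests.

(** * Coding of the torus and continuous functions *)

Section torus_coding.
Context {R : realType} {d : nat} (d_gt0 : (0 < d)%N).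
Local Notation Td := (torus R d).
Local Notation Rd := 'rV[R]_d.
Variable delta : Td -> Td -> Rd.
Hypothesis delta_min : minimal_difference delta.

Let idx k : 'I_d := Ordinal (ltn_pmod k d_gt0).

Let shifted (x : Td) i : R := delta x 0 0 i + d%:R.
Let fr x i : R := shifted x i - (Num.truncn (shifted x i))%:R.

Let shifted_ge0 x i : 0 <= shifted x i.
Proof.
have := coord_le_enorm (delta x 0) i; rewrite enorm_delta// => h.
have := le_trans h (tdist_bound x 0); rewrite ler_norml /shifted => /andP[? _]; lra.
Qed.

Let fr_unit x i : 0 <= fr x i < 1.
Proof.
have /andP[h1 h2] := truncn_itv (shifted_ge0 x i).
by rewrite -natr1 in h2; rewrite /fr; apply/andP; split; lra.
Qed.

(* The binary digits of the d coordinates are interleaved; adding d makes the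
   coordinates of delta x 0 nonnegative, so that truncn is their integral part. *)
Definition enc_torus (x : Td) : code := fun k => digit (fr x (idx k)) (k %/ d).

Definition cube_point (c : code) : Rd := \row_i val (fun l => c (l * d + i)%N).

Definition dec_torus (c : code) : Td := \pi_Td (cube_point c).

Lemma coding_torus : coding enc_torus dec_torus.
Proof.
have mdel i : measurable_fun setT (fun x : Td => delta x 0 0 i).
  have [+ _] := bmeas_delta delta_min i.
  by move=> /(@measurableT_comp _ _ _ _ _ _ _ _ (pair^~ (0 : Td))); apply; exact: pair2_measurable.
have msh i : measurable_fun setT (shifted^~ i) by exact: measurable_funD.
have mfr i : measurable_fun setT (fr^~ i).
  apply: measurable_funB => //.
  apply: (@measurableT_comp _ _ _ _ _ _ (fun n : nat => n%:R : R)) => //.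
  exact: (measurableT_comp measurable_truncn).
split.
- apply: measurable_code => k; rewrite /enc_torus /digit.
  apply: (@measurableT_comp _ _ _ _ _ _ odd) => //.
  apply: (measurableT_comp measurable_truncn); exact: measurable_funM.
- apply: (measurableT_comp measurable_pi); apply: measurable_rV => i.
  rewrite [X in measurable_fun _ X](_ : _ = (fun c : code => val (fun l => c (l * d + i)%N))).
    by apply: (@measurable_val R _ code (fun c l => c (l * d + i)%N)) => l; exact: measurable_bit.
  by apply/funext => c; rewrite mxE.
move=> x; rewrite /dec_torus -[RHS]subr0 -(delta_pi delta_min).
apply/pi_eqP; exists (fun i => d%:Z - (Num.truncn (shifted x i))%:Z) => i.
rewrite mxE (_ : (fun l => _) = digit (fr x i)); last first.
  apply/funext => l; rewrite /enc_torus divnMDl// divn_small// addn0; congr (digit (fr x _) _).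
  by apply/val_inj; rewrite /= modnMDl modn_small.
by rewrite val_digit ?fr_unit// /fr /shifted intrB -!pmulrn; ring.
Qed.

(** Codes sharing n * d bits have cube points within 2^-n in each coordinate. The cube being
    compact, two sequences of such points have a common limit along an ultrafilter, which
    contradicts a fixed gap between the values of f. *)
Lemma digital_continuous (f : Td -> R) : continuous f -> digital dec_torus f.
Proof.
move=> cf; pose g : Rd -> R := f \o \pi_Td.
have cg : continuous g by apply/(@quotient_continuous Rd _ R f).
pose K : set Rd := [set v | forall i, `[0, 1]%classic (v 0 i)].
have cK : compact K.
  apply: (@rV_compact R d (fun=> `[0, 1]%classic)) => i; exact: segment_compact.
have Kc c : K (cube_point c).
  by move=> i; rewrite mxE /= in_itv/=; exact: val_unit.
have [U [UU oU]] := @ultraFilterLemma nat (\oo : set_system nat) _.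
have close c c' n : prefix c (n * d) = prefix c' (n * d) -> forall i,
    `|cube_point c 0 i - cube_point c' 0 i| <= (2 ^+ n)^-1.
  move=> E i; rewrite !mxE; apply: val_close => l ln; apply: prefix_bit E.
  by rewrite (@leq_trans (l.+1 * d))// ?leq_mul2r ?ln ?orbT// mulSn addnC ltn_add2r.
have small e : 0 < e -> \forall n \near U, (2 ^+ n)^-1 < e :> R.
  move=> e0; apply: oU; exists (Num.truncn e^-1).+1 => // n /= hn.
  rewrite -[ltRHS]invrK ltf_pV2 ?posrE ?exprn_gt0 ?invr_gt0//.
  rewrite (lt_le_trans (truncnS_gt _))// -natrX ler_nat (leq_trans hn)//.
  by rewrite ltnW// ltn_expl.
split.
  apply: contrapT => nb.
  have hx n : exists x, n%:R < `|f x|.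
    apply: contrapT => h; apply: nb; exists n%:R => x; rewrite leNgt; apply/negP => fx.
    by apply: h; exists x.
  pose x n := projT1 (cid (hx n)).
  have encK : cancel enc_torus dec_torus by case: coding_torus.
  have [p Kp xp] := ultra_cvg_compact UU cK (fun n => Kc (enc_torus (x n))).
  have : g (cube_point (enc_torus (x n))) @[n --> U] --> g p by apply: cvg_comp xp (cg p).
  move/cvgrPdist_le => /(_ 1 ltr01) h.
  have [n [h1 h2]] : exists n, `|g p - f (x n)| <= 1 /\ `|g p| + 1 < n%:R.
    have h' : \forall n \near U, `|g p| + 1 < n%:R.
      apply: oU; exists (Num.truncn (`|g p| + 1)).+1 => // n /= hn.
      by rewrite (lt_le_trans (truncnS_gt _))// ler_nat.
    have [n [/= h1 h2]] := filter_ex2 _ h h'; exists n; split => //.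
    by move: h1; rewrite /g/= -/(dec_torus _) encK.
  have := projT2 (cid (hx n)); rewrite -/(x n) => h3.
  have := lerB_dist (f (x n)) (g p); rewrite distrC => h4; lra.
move=> e e0; apply: contrapT => nh.
have hc n : exists cc : code * code, prefix cc.1 (n * d) = prefix cc.2 (n * d) /\
    e < `|f (dec_torus cc.1) - f (dec_torus cc.2)|.
  apply: contrapT => h; apply: nh; exists (n * d)%N => c c' E.
  by rewrite leNgt; apply/negP => fc; apply: h; exists (c, c').
pose c n := (projT1 (cid (hc n))).1; pose c' n := (projT1 (cid (hc n))).2.
have cP n : prefix (c n) (n * d) = prefix (c' n) (n * d) by rewrite /c /c'; case: cid => ? [].
have ce n : e < `|f (dec_torus (c n)) - f (dec_torus (c' n))| by rewrite /c /c'; case: cid => ? [].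
have [p Kp xp] := ultra_cvg_compact UU cK (fun n => Kc (c n)).
have xp' : cube_point (c' n) @[n --> U] --> p.
  apply/cvg_ballP => r r0; have r2 : 0 < r / 2 by rewrite divr_gt0.
  move/cvg_ballP : xp => /(_ _ r2) h.
  apply: filterS2 h (small _ r2) => n [_ /= h1] h2; split => // i j; rewrite ord1.
  have := h1 0 j; have := close _ _ _ (cP n) j; rewrite /ball/= => h3 h4.
  have -> : p 0 j - cube_point (c' n) 0 j = (p 0 j - cube_point (c n) 0 j) +
     (cube_point (c n) 0 j - cube_point (c' n) 0 j) by ring.
  by rewrite (le_lt_trans (ler_normD _ _))// [ltRHS]splitr ltrD// (le_lt_trans h3).
have h1 : g (cube_point (c n)) @[n --> U] --> g p by apply: cvg_comp xp (cg p).
have h2 : g (cube_point (c' n)) @[n --> U] --> g p by apply: cvg_comp xp' (cg p).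
have h3 : g (cube_point (c n)) - g (cube_point (c' n)) @[n --> U] --> (0 : R).
  by rewrite -(subrr (g p)); exact: cvgB.
move/cvgrPdist_lt : h3 => /(_ _ e0) h3; have [n] := filter_ex h3.
by rewrite sub0r normrN => /(lt_trans (ce n)); rewrite /g/= ltxx.
Qed.

End torus_coding.

(** * Trigonometric sums and the resolvent of the Laplacian *)

Section trigonometric_sums.
Context {R : realType} {d : nat}.
Local Notation Td := (torus R d).
Local Notation Rd := 'rV[R]_d.
Local Notation twopi := ((pi : R) *+ 2).

(* The mode (c, m, b) stands for w |-> c * cos (2 pi m.w + b). *)
Definition mode := (R * Rd * R)%type.
Implicit Types (e : mode) (l : seq mode) (w v u : Rd).

Definition phase e w : R := twopi * dot e.1.2 w + e.2.
Definition freq e : R := twopi ^+ 2 * dot e.1.2 e.1.2.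

Definition trig l w : R := \sum_(e <- l) e.1.1 * cos (phase e w).
Definition trig_lap l w : R := \sum_(e <- l) - (e.1.1 * freq e * cos (phase e w)).
Definition trig_grad l w : Rd := \sum_(e <- l) (- (e.1.1 * twopi * sin (phase e w))) *: e.1.2.
Definition trig_hess l w : 'M[R]_d :=
  \sum_(e <- l) (- (e.1.1 * twopi ^+ 2 * cos (phase e w))) *: (e.1.2^T *m e.1.2).

Definition integral_modes l := forall e, e \in l -> forall i, exists z : int, e.1.2 0 i = z%:~R.

Lemma freq_ge0 e : 0 <= freq e.
Proof. by rewrite mulr_ge0 ?sqr_ge0 ?dot_ge0. Qed.

Lemma dotDr v u u' : dot v (u + u') = dot v u + dot v u'.
Proof. by rewrite dotC dotDl !(dotC v). Qed.

Lemma dotZr a v u : dot v (a *: u) = a * dot v u.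
Proof. by rewrite dotC dotZl (dotC v). Qed.

Lemma dot_outer v u : dot v (v *m (u^T *m u)) = dot u v ^+ 2.
Proof.
rewrite mulmxA (_ : v *m u^T = (dot v u)%:M); last first.
  apply/matrixP => i j; rewrite !ord1 !mxE eqxx mulr1n; apply: eq_bigr => k _.
  by rewrite mxE.
by rewrite mul_scalar_mx dotC dotZl (dotC v u) expr2.
Qed.

Lemma trig_hess_sym l w : (trig_hess l w)^T = trig_hess l w.
Proof.
rewrite /trig_hess; elim: l => [|e l IH]; first by rewrite !big_nil trmx0.
by rewrite !big_cons linearD/= IH linearZ/= trmx_mul trmxK.
Qed.

Lemma trig_hess_tr l w : \tr (trig_hess l w) = trig_lap l w.
Proof.
rewrite /trig_hess /trig_lap; elim: l => [|e l IH]; first by rewrite !big_nil linear0.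
rewrite !big_cons linearD/= IH linearZ/=; congr (_ + _).
have -> : \tr (e.1.2^T *m e.1.2) = dot e.1.2 e.1.2.
  by rewrite /mxtrace /dot; apply: eq_bigr => i _; rewrite !mxE big_ord1 mxE.
by rewrite /freq; ring.
Qed.

Lemma cos_taylor2 (t s : R) :
  `|cos (t + s) - cos t + s * sin t + s ^+ 2 / 2 * cos t| <= `|s| ^+ 3 / 2 + s ^+ 4.
Proof.
have -> : cos (t + s) - cos t + s * sin t + s ^+ 2 / 2 * cos t =
  sin t * (s - sin s) - cos t * (1 - cos s - s ^+ 2 / 2) by rewrite cosD; lra.
rewrite (le_trans (ler_normB _ _))// !normrM lerD//.
  by rewrite -[leRHS]mul1r ler_pM// ?sin_max// sin_sub_le.
by rewrite -[leRHS]mul1r ler_pM// ?cos_max// cos_taylor.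
Qed.

(** Mode by mode from [cos_taylor2]. The bound holds for every v, not only for small ones, which is
    why the fourth power is kept beside the third. *)
Lemma trig_taylor l : exists2 C, 0 <= C & forall w v,
  `|trig l (w + v) - trig l w - dot (trig_grad l w) v
     - 2^-1 * dot v (v *m trig_hess l w)| <= C * (enorm v ^+ 3 + enorm v ^+ 4).
Proof.
elim: l => [|e l [C C0 hC]].
  exists 0 => // w v; rewrite /trig /trig_grad /trig_hess !big_nil mulmx0.
  by rewrite /dot !big1 => [|i _|i _]; rewrite ?mxE ?mul0r ?mulr0// !subr0 normr0.
pose k := twopi * enorm e.1.2.
have k0 : 0 <= k by rewrite mulr_ge0 ?enorm_ge0// mulrn_wge0// pi_ge0.
exists (C + `|e.1.1| * (k ^+ 3 + k ^+ 4)).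
  by rewrite addr_ge0// mulr_ge0// addr_ge0 ?exprn_ge0.
move=> w v; pose s := twopi * dot e.1.2 v.
have phD : phase e (w + v) = phase e w + s.
  by rewrite /phase (dotC _ (w + v)) dotDl !(dotC _ e.1.2) /s; ring.
have sk : `|s| <= k * enorm v.
  have tp : 0 <= twopi by rewrite mulrn_wge0 ?pi_ge0.
  by rewrite /s /k normrM (ger0_norm tp) -mulrA ler_wpM2l// normr_dot_le.
have -> : trig (e :: l) (w + v) - trig (e :: l) w - dot (trig_grad (e :: l) w) v
     - 2^-1 * dot v (v *m trig_hess (e :: l) w) =
   (trig l (w + v) - trig l w - dot (trig_grad l w) v - 2^-1 * dot v (v *m trig_hess l w)) +
   e.1.1 * (cos (phase e w + s) - cos (phase e w) + s * sin (phase e w) + s ^+ 2 / 2 * cos (phase e w)).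
  rewrite /trig /trig_grad /trig_hess !big_cons phD dotDl dotZl mulmxDr -scalemxAr.
  rewrite dotDr dotZr dot_outer.
  set g := dot (\sum_(_ <- l) _) v; set q := dot v (v *m _).
  by rewrite /s; field.
rewrite (le_trans (ler_normD _ _))// mulrDl lerD//.
rewrite normrM -[leRHS]mulrA ler_wpM2l//.
apply: le_trans (cos_taylor2 _ _) _.
have v0 := enorm_ge0 v.
clearbody k s; have kv : 0 <= k * enorm v by exact: mulr_ge0.
have h3 : `|s| ^+ 3 <= (k * enorm v) ^+ 3 by rewrite ler_pXn2r ?nnegrE.
have h4 : s ^+ 4 <= (k * enorm v) ^+ 4.
  have -> : s ^+ 4 = `|s| ^+ 4 by rewrite -normrX ger0_norm// (exprM s 2 2) sqr_ge0.
  by rewrite ler_pXn2r ?nnegrE.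
rewrite !exprMn in h3 h4.
have k3 : 0 <= k ^+ 3 by rewrite exprn_ge0.
have k4 : 0 <= k ^+ 4 by rewrite exprn_ge0.
have v3 : 0 <= enorm v ^+ 3 by rewrite exprn_ge0.
have v4 : 0 <= enorm v ^+ 4 by rewrite exprn_ge0.
have s3 : 0 <= `|s| ^+ 3 by rewrite exprn_ge0.
have := mulr_ge0 k3 v4; have := mulr_ge0 k4 v3; lra.
Qed.

Lemma trig_periodic l u v : integral_modes l -> \pi_Td u = \pi_Td v -> trig l u = trig l v.
Proof.
move=> il /pi_eqP[z zE]; rewrite /trig !big_seq; apply: eq_bigr => e el; congr (_ * _).
have [y yE] := choice (il e el).
rewrite -(cos_period (phase e v) (\sum_i y i * z i)) /phase; congr cos.
rewrite addrAC -mulrDr; congr (_ * _ + _); rewrite rmorph_sum/= /dot -big_split/=.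
by apply: eq_bigr => i _; rewrite zE mulrDr intrM yE.
Qed.

Lemma trig_cat l l' w : trig (l ++ l') w = trig l w + trig l' w.
Proof. by rewrite /trig big_cat. Qed.

Definition trig_scale (k : R) l : seq mode := [seq (k * e.1.1, e.1.2, e.2) | e <- l].

Lemma trig_scaleE k l w : trig (trig_scale k l) w = k * trig l w.
Proof. by rewrite /trig big_map mulr_sumr; apply: eq_bigr => e _; rewrite mulrA. Qed.

Lemma trig_lap_scale k l w : trig_lap (trig_scale k l) w = k * trig_lap l w.
Proof.
rewrite /trig_lap big_map mulr_sumr; apply: eq_bigr => e _.
by rewrite mulrN -!mulrA.
Qed.

Definition trig_mul l l' : seq mode :=
  flatten [seq [:: (e.1.1 * e'.1.1 / 2, e.1.2 + e'.1.2, e.2 + e'.2);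
                   (e.1.1 * e'.1.1 / 2, e.1.2 - e'.1.2, e.2 - e'.2)] | e <- l, e' <- l'].

Lemma trig_mulE l l' w : trig (trig_mul l l') w = trig l w * trig l' w.
Proof.
rewrite /trig /trig_mul big_flatten/= big_allpairs_dep mulr_suml; apply: eq_bigr => e _.
rewrite mulr_sumr; apply: eq_bigr => e' _; rewrite !big_cons big_nil addr0/=.
have -> : phase (e.1.1 * e'.1.1 / 2, e.1.2 + e'.1.2, e.2 + e'.2) w = phase e w + phase e' w.
  by rewrite /phase/= dotDl; ring.
have -> : phase (e.1.1 * e'.1.1 / 2, e.1.2 - e'.1.2, e.2 - e'.2) w = phase e w - phase e' w.
  by rewrite /phase/= dotDl dotNl; ring.
by rewrite cosD cosB; field.
Qed.

(* (1 - Laplacian / a)^-1, mode by mode. *)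
Definition resolvent (a : R) l : seq mode :=
  [seq (e.1.1 * (a / (a + freq e)), e.1.2, e.2) | e <- l].

Lemma resolventE a l w : 0 < a ->
  trig_lap (resolvent a l) w = a * (trig (resolvent a l) w - trig l w).
Proof.
move=> a0; rewrite /trig_lap /trig !big_map -sumrB mulr_sumr; apply: eq_bigr => e _ /=.
have -> : freq (e.1.1 * (a / (a + freq e)), e.1.2, e.2) = freq e by [].
have -> : phase (e.1.1 * (a / (a + freq e)), e.1.2, e.2) w = phase e w by [].
have f0 : a + freq e != 0 by rewrite gt_eqF// ltr_wpDr// freq_ge0.
by field.
Qed.

Lemma integral_modes_cat l l' : integral_modes l -> integral_modes l' -> integral_modes (l ++ l').
Proof. by move=> h h' e; rewrite mem_cat => /orP[/h|/h']. Qed.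

Lemma integral_modes_map l (f : mode -> R) : integral_modes l ->
  integral_modes [seq (f e, e.1.2, e.2) | e <- l].
Proof. by move=> h _ /mapP[e el ->] i; exact: (h e el i). Qed.

Lemma integral_modes_mul l l' : integral_modes l -> integral_modes l' -> integral_modes (trig_mul l l').
Proof.
move=> h h' x /flattenP[_ /allpairsP[[e e'] [/= el el' ->]]].
rewrite !inE => /orP[] /eqP -> i /=; rewrite !mxE;
  have [z ->] := h e el i; have [z' ->] := h' e' el' i.
  by exists (z + z'); rewrite intrD.
by exists (z - z'); rewrite intrB.
Qed.

End trigonometric_sums.

Section ultra_maxima.
Context {R : realType}.

Lemma nat_ultrafilter : exists U : set_system nat, UltraFilter U /\ (\oo : set_system nat) `<=` U.
Proof. exact: ultraFilterLemma. Qed.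

(** The last hypothesis merges compactness and upper semicontinuity along one ultrafilter, so that X
    needs no topology; it is applied to a maximizing sequence. *)
Lemma ultra_max (U : set_system nat) (UU : UltraFilter U) (oU : (\oo : set_system nat) `<=` U)
    (X : Type) (f : X -> R) (x0 : X) :
  (exists M, forall x, f x <= M) ->
  (forall x : nat -> X, exists y, forall e, 0 < e -> \forall n \near U, f (x n) <= f y + e) ->
  exists y, forall x, f x <= f y.
Proof.
move=> [M fM] cf; pose s := sup (range f).
have hs : has_sup (range f) by split; [exists (f x0), x0|exists M => _ [x _ <-]].
have app n : exists x, s - n.+1%:R^-1 < f x.
  have [|_ [x _ <-]] := @sup_adherent _ (range f) n.+1%:R^-1 _ hs; first by rewrite invr_gt0.
  by exists x.
pose x n := projT1 (cid (app n)).
have xs n : s - n.+1%:R^-1 < f (x n) by rewrite /x; case: cid.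
have [y hy] := cf x; exists y => z; apply: (@le_trans _ _ s).
  by apply: ub_le_sup; [case: hs|exists z].
apply/ler_addgt0Pr => e e0; have e2 : 0 < e / 2 by rewrite divr_gt0.
have h : \forall n \near U, n.+1%:R^-1 < e / 2 :> R.
  by apply: oU; exact: near_infty_natSinv_lt (PosNum e2).
have [n [h1 h2]] := filter_ex2 _ (hy _ e2) h.
by have := xs n; move: h1 h2 => /=; move: (n.+1%:R^-1) => k; lra.
Qed.

Context {d : nat}.
Local Notation Td := (torus R d).
Local Notation Rd := 'rV[R]_d.

Lemma torus_ultra (I : Type) (U : set_system I) (UU : UltraFilter U) (x : I -> Td) :
  exists y : Td, x n @[n --> U] --> y.
Proof.
have h n : exists v : Rd, \pi_Td v = x n /\ forall i, `|v 0 i| <= 2^-1.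
  by have [v v1 v2] := centered_repr (x n); exists v.
pose v n := projT1 (cid (h n)).
have vx n : \pi_Td (v n) = x n by rewrite /v; case: cid => ? [].
have vb n i : `|v n 0 i| <= 2^-1 by rewrite /v; case: cid => ? [].
have cK := @rV_compact R d (fun=> `[- 2^-1, 2^-1]%classic) (fun=> @segment_compact _ _ _).
have [|p Kp vp] := ultra_cvg_compact UU cK (f := v).
  by move=> n i /=; rewrite in_itv/= -ler_norml; exact: vb.
exists (\pi_Td p); rewrite (_ : x = \pi_Td \o v); last by apply/funext => n /=; rewrite vx.
by apply: cvg_comp vp _; exact: pi_continuous.
Qed.

Lemma torus_min (f : Td -> R) : continuous f -> exists y, forall x, f y <= f x.
Proof.
move=> cf; have [U [UU oU]] := nat_ultrafilter.
have key (x : nat -> Td) : exists y, forall e, 0 < e -> \forall n \near U, `|f y - f (x n)| <= e.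
  have [y xy] := torus_ultra UU x; exists y => e e0.
  have fy : f (x n) @[n --> U] --> f y by apply: cvg_comp xy (cf y).
  by move/cvgrPdist_le : fy => /(_ _ e0).
have [||y hy] := @ultra_max U UU oU Td (fun x => - f x) (0 : Td).
- apply: contrapT => nb.
  have hx n : exists x, f x < - n%:R.
    apply: contrapT => h; apply: nb; exists n%:R => x; rewrite lerNl leNgt; apply/negP => fx.
    by apply: h; exists x.
  pose x n := projT1 (cid (hx n)).
  have xn n : f (x n) < - n%:R by rewrite /x; case: cid.
  have [y hy] := key x.
  have h : \forall n \near U, `|f y| + 1 < n%:R.
    apply: oU; exists (Num.truncn (`|f y| + 1)).+1 => // n /= hn.
    by rewrite (lt_le_trans (truncnS_gt _))// ler_nat.
  have [n [/= h1 h2]] := filter_ex2 _ (hy 1 ltr01) h.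
  have := xn n; move: h1; rewrite ler_norml => /andP[_ h1].
  by have := ler_norm (- f y); rewrite normrN => *; lra.
- move=> x; have [y hy] := key x; exists y => e /hy; apply: filterS => n.
  by rewrite ler_norml => /andP[? ?]; lra.
by exists y => x; rewrite -lerN2.
Qed.

End ultra_maxima.

Section torus_trig_sums.
Context {R : realType} {d : nat}.
Local Notation Td := (torus R d).
Local Notation Rd := 'rV[R]_d.
Implicit Types (l : seq (mode (R := R) (d := d))) (x y : Td).

Definition tsum l x : R := trig l (repr x).
Definition tlap l x : R := trig_lap l (repr x).

Lemma tsum_pi l (v : Rd) : integral_modes l -> tsum l (\pi_Td v) = trig l v.
Proof. by move=> il; apply: trig_periodic => //; rewrite reprK. Qed.

(* Second-order expansion of f at x, tested on every representative of x' - x. *)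
Definition taylor2 (f : Td -> R) x (p : Rd) (X : 'M[R]_d) :=
  X^T = X /\ exists2 C, 0 <= C & forall x' v, \pi_Td v = x' - x ->
    `|f x' - f x - dot p v - 2^-1 * dot v (v *m X)| <= C * (enorm v ^+ 3 + enorm v ^+ 4).

Lemma taylor2_tsum l x : integral_modes l ->
  taylor2 (tsum l) x (trig_grad l (repr x)) (trig_hess l (repr x)).
Proof.
move=> il; split; first exact: trig_hess_sym.
have [C C0 hC] := trig_taylor l; exists C => // x' v vx.
have -> : tsum l x' = trig l (repr x + v).
  rewrite /tsum; apply: trig_periodic => //.
  by rewrite piD !reprK vx addrC subrK.
exact: hC.
Qed.

Lemma taylor2_shift f a x p X : taylor2 f (x - a) p X -> taylor2 (fun y => f (y - a)) x p X.
Proof.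
move=> [sX [C C0 hC]]; split => //; exists C => // x' v vx; apply: hC.
by rewrite vx opprD addrACA subrr addr0.
Qed.

Lemma continuous_tsum l : integral_modes l -> continuous (tsum l).
Proof.
move=> il; apply: continuous_torus => v.
have -> : tsum l \o \pi_Td = trig l by apply/funext => u /=; rewrite tsum_pi.
apply: (@cvgr_sum _ _ (nbhs v) (nbhs_filter v) _ _ (fun e u => e.1.1 * cos (phase e u))
  (fun e => e.1.1 * cos (phase e v))) => e.
apply: cvgM; first exact: cvg_cst.
apply: (@continuous_comp _ _ _ (phase e) cos); last exact: continuous_cos.
have h : dot e.1.2 u @[u --> v] --> dot e.1.2 v.
  apply: (@cvgr_sum _ _ (nbhs v) (nbhs_filter v) _ _ (fun i u => e.1.2 0 i * u 0 i)
    (fun i => e.1.2 0 i * v 0 i)) => i.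
  by apply: cvgM; [exact: cvg_cst|exact: coord_continuous].
exact: (cvgD (cvgM (cvg_cst (pi *+ 2)) h) (cvg_cst e.2)).
Qed.

(** Adding the expansions at x + t e_i and x - t e_i cancels the gradient, whence X i i >= - 4 C t
    for 0 < t < 1. The final t makes 8 (C + 1) t at most - X i i, which is contradictory if X i i <
    0. *)
Lemma taylor2_min f x p X : taylor2 f x p X -> (forall y, f x <= f y) -> 0 <= \tr X.
Proof.
move=> [sX [C C0 hC]] fmin; apply: sumr_ge0 => i _.
have hX t : 0 < t -> t < 1 -> - (4 * C * t) <= X i i.
  move=> t0 t1; pose v : Rd := t *: 'e_i.
  have nv : enorm v = t.
    rewrite enormZ gtr0_norm// /enorm /dot (bigD1 i)//= big1 ?addr0.
      by rewrite !mxE !eqxx mulr1 sqrtr1 mulr1.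
    by move=> j ji; rewrite !mxE (negbTE ji) andbF mul0r.
  have qv : dot v (v *m X) = t ^+ 2 * X i i.
    rewrite /v -scalemxAl dotZl dotZr mulrA -expr2; congr (_ * _).
    rewrite -rowE /dot (bigD1 i)//= big1 ?addr0; first by rewrite !mxE !eqxx mul1r.
    by move=> j ji; rewrite !mxE (negbTE ji) andbF mul0r.
  have h1 := hC (x + \pi_Td v) v; have h2 := hC (x - \pi_Td v) (- v).
  move: h1 h2; rewrite !(addrC x) !addrK => /(_ erefl) h1.
  rewrite raddfN/= => /(_ erefl) h2; move: h1 h2.
  have q2 : dot (- v) (- v *m X) = t ^+ 2 * X i i.
    by rewrite mulNmx dotNl dotC dotNl opprK dotC qv.
  have d2 : dot p (- v) = - dot p v by rewrite dotC dotNl dotC.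
  rewrite q2 qv d2 enormN nv.
  rewrite !ler_norml => /andP[_ h1] /andP[_ h2].
  have f1 := fmin (\pi_Td v + x); have f2 := fmin (- \pi_Td v + x).
  have t2 : 0 < t ^+ 2 by rewrite exprn_gt0.
  have h3 : - (2 * C * (t ^+ 3 + t ^+ 4)) <= t ^+ 2 * X i i by lra.
  have t34 : t ^+ 3 + t ^+ 4 <= 2 * t * t ^+ 2.
    by rewrite !exprS expr0; nra.
  rewrite -(ler_pM2l t2); apply: le_trans h3.
  have := ler_wpM2l C0 t34; lra.
rewrite leNgt; apply/negP => X0.
pose t := Num.min (2^-1) (- X i i / (8 * (C + 1))).
have C1 : 0 < C + 1 by lra.
have t0 : 0 < t by rewrite lt_min invr_gt0 ltr0n/= divr_gt0 ?oppr_gt0// mulr_gt0.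
have t1 : t < 1 by rewrite gt_min invf_lt1 ?ltr1n.
have t2 : t <= - X i i / (8 * (C + 1)) by rewrite ge_min lexx orbT.
have := hX t t0 t1; rewrite ler_pdivlMr ?mulr_gt0// in t2; nra.
Qed.

(* Maximum principle: at a minimum point the Laplacian is nonnegative, so
   resolventE bounds the resolvent from below by the nonnegative sum l. *)
Lemma resolvent_ge0 a l : 0 < a -> integral_modes l -> (forall x, 0 <= tsum l x) ->
  forall x, 0 <= tsum (resolvent a l) x.
Proof.
move=> a0 il l0 x.
have ir : integral_modes (resolvent a l) by exact: integral_modes_map.
have [y ymin] := torus_min (continuous_tsum ir).
apply: le_trans (ymin x).
have := taylor2_min (taylor2_tsum y ir) ymin; rewrite trig_hess_tr resolventE//.
rewrite pmulr_rge0// subr_ge0; apply: le_trans; exact: l0.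
Qed.

Lemma resolvent_le a l l' : 0 < a -> integral_modes l -> integral_modes l' ->
  (forall x, tsum l x <= tsum l' x) ->
  forall x, tsum (resolvent a l) x <= tsum (resolvent a l') x.
Proof.
move=> a0 il il' ll' x.
have := @resolvent_ge0 a (l' ++ trig_scale (-1) l) a0.
have E y : tsum (resolvent a (l' ++ trig_scale (-1) l)) y = tsum (resolvent a l') y - tsum (resolvent a l) y.
  rewrite /resolvent map_cat /tsum trig_cat; congr (_ + _).
  rewrite -[RHS]mulN1r -trig_scaleE; congr trig; rewrite /trig_scale -!map_comp.
  by apply: eq_map => e /=; congr (_, _, _); rewrite -[RHS]/(_ * (_ * _)) !mulrA.
move=> /(_ _ _ x); rewrite E subr_ge0; apply.
  by apply: integral_modes_cat => //; exact: integral_modes_map.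
by move=> y; rewrite /tsum trig_cat trig_scaleE mulN1r subr_ge0; exact: ll'.
Qed.

End torus_trig_sums.

(** * Uniform approximation by trigonometric sums *)

Section trig_approximation.
Context {R : realType} {d : nat}.
Local Notation Td := (torus R d).
Local Notation Rd := 'rV[R]_d.
Local Notation twopi := ((pi : R) *+ 2).
Implicit Types (l : seq (mode (R := R) (d := d))) (x y : Td) (f g : Td -> R).

Definition tapx f := forall e, 0 < e -> exists l, integral_modes l /\
  forall x, `|f x - tsum l x| <= e.

Definition cst_modes (k : R) : seq (mode (R := R) (d := d)) := [:: (k, 0, 0)].

Lemma integral_cst k : integral_modes (cst_modes k).
Proof. by move=> e; rewrite inE => /eqP -> i; exists 0; rewrite mxE. Qed.

Lemma dot0l (v : Rd) : dot 0 v = 0.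
Proof. by rewrite /dot big1// => i _; rewrite mxE mul0r. Qed.

Lemma trig_cst k v : trig (cst_modes k) v = k.
Proof. by rewrite /trig big_seq1 /phase/= dot0l mulr0 addr0 cos0 mulr1. Qed.

Definition cost_modes y : seq (mode (R := R) (d := d)) :=
  cst_modes d%:R ++ [seq (-1, 'e_i, - (twopi * (repr y : Rd) 0 i)) | i <- enum 'I_d].

Lemma integral_cost y : integral_modes (cost_modes y).
Proof.
apply: integral_modes_cat; first exact: integral_cst.
move=> e /mapP[i _ ->] j; rewrite /= mxE eqxx/=.
by exists (j == i)%:R; case: (j == i).
Qed.

Lemma dot_basis i (v : Rd) : dot 'e_i v = v 0 i.
Proof.
rewrite /dot (bigD1 i)//= big1 ?addr0; first by rewrite mxE !eqxx mul1r.
by move=> j ji; rewrite mxE (negbTE ji) andbF mul0r.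
Qed.

Lemma freq_cost i (b c : R) : freq (c, 'e_i : Rd, b) = twopi ^+ 2.
Proof. by rewrite /freq/= dot_basis mxE !eqxx mulr1. Qed.

Lemma tsum_cost y x : tsum (cost_modes y) x = cost (x - y).
Proof.
rewrite /tsum trig_cat trig_cst /trig big_map big_enum/= /cost sumrB sumr_const card_ord.
congr (_ + _); rewrite -sumrN; apply: eq_bigr => i _; rewrite mulN1r; congr (- _).
by rewrite /phase/= dot_basis csB -cosB.
Qed.

Lemma tapx_cst k : tapx (fun=> k).
Proof.
move=> e e0; exists (cst_modes k); split; first exact: integral_cst.
by move=> x; rewrite /tsum trig_cst subrr normr0 ltW.
Qed.

Lemma tapx_cost y : tapx (fun x => cost (x - y)).
Proof.
move=> e e0; exists (cost_modes y); split; first exact: integral_cost.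
by move=> x; rewrite tsum_cost subrr normr0 ltW.
Qed.

Lemma tapxD f g : tapx f -> tapx g -> tapx (fun x => f x + g x).
Proof.
move=> tf tg e e0; have e2 : 0 < e / 2 by rewrite divr_gt0.
have [l [il hl]] := tf _ e2; have [l' [il' hl']] := tg _ e2; exists (l ++ l').
split; first exact: integral_modes_cat.
move=> x; rewrite /tsum trig_cat opprD addrACA (le_trans (ler_normD _ _))//.
by rewrite [leRHS]splitr lerD// ?hl ?hl'.
Qed.

Lemma tsum_bdd l : exists2 M, 0 < M & forall x, `|tsum l x| <= M.
Proof.
exists (1 + \sum_(e <- l) `|e.1.1|); first by rewrite ltr_pwDl// sumr_ge0.
move=> x; rewrite /tsum /trig (le_trans (ler_norm_sum _ _ _))// ler_wpDl//.
by apply: ler_sum => e _; rewrite normrM ler_piMr// cos_max.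
Qed.

Lemma tapx_bdd f : tapx f -> exists2 M, 0 < M & forall x, `|f x| <= M.
Proof.
move=> /(_ 1 ltr01)[l [_ hl]]; have [M M0 hM] := tsum_bdd l.
exists (1 + M); first by rewrite addr_gt0.
move=> x; rewrite -[f x](subrK (tsum l x)) (le_trans (ler_normD _ _))//.
by rewrite lerD// ?hl.
Qed.

Lemma tapxM f g : tapx f -> tapx g -> tapx (fun x => f x * g x).
Proof.
move=> tf tg e e0; have [M M0 hM] := tapx_bdd tf; have [N N0 hN] := tapx_bdd tg.
pose e1 := Num.min 1 (e / (M + N + 1)).
have K0 : 0 < M + N + 1 by rewrite !addr_gt0.
have e10 : 0 < e1 by rewrite lt_min ltr01 divr_gt0.
have e11 : e1 <= 1 by rewrite ge_min lexx.
have e1e : e1 * (M + N + 1) <= e by rewrite -ler_pdivlMr// ge_min lexx orbT.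
have [l [il hl]] := tf _ e10; have [l' [il' hl']] := tg _ e10; exists (trig_mul l l').
split; first exact: integral_modes_mul.
move=> x; rewrite /tsum trig_mulE -!/(tsum _ _).
have -> : f x * g x - tsum l x * tsum l' x =
  (f x - tsum l x) * g x + f x * (g x - tsum l' x) - (f x - tsum l x) * (g x - tsum l' x) by ring.
rewrite (le_trans (ler_normB _ _))// (le_trans (lerD (ler_normD _ _) (lexx _)))// !normrM.
apply: le_trans e1e; rewrite (_ : e1 * _ = e1 * N + M * e1 + e1 * 1); last by ring.
by rewrite !lerD// ?ler_pM// (le_trans (hl' x)).
Qed.

Lemma tapx_unif f : (forall e, 0 < e -> exists2 g, tapx g & forall x, `|f x - g x| <= e) -> tapx f.
Proof.
move=> h e e0; have e2 : 0 < e / 2 by rewrite divr_gt0.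
have [g /(_ _ e2)[l [il hl]] fg] := h _ e2; exists l; split => // x.
rewrite -[f x](subrK (g x)) -addrA (le_trans (ler_normD _ _))//.
by rewrite [leRHS]splitr lerD// ?hl.
Qed.

(* Newton-type iteration of the Stone-Weierstrass theorem. *)
Fixpoint abs_approx n (x : R) : R :=
  if n is n'.+1 then abs_approx n' x + (x ^+ 2 - abs_approx n' x ^+ 2) / 2 else 0.

(** The error s = |x| - p becomes at most s (1 - s / 2), because p >= 0. This is increasing in s on
    [0, 1], and the bound 2 / m is mapped to 2 (m - 1) / m^2 <= 2 / (m + 1). *)
Lemma abs_approxP n (x : R) : `|x| <= 1 ->
  0 <= `|x| - abs_approx n x <= 2 / n.+2%:R /\ 0 <= abs_approx n x.
Proof.
move=> x1; elim: n => [|n [/andP[h1 h2] h3]] /=.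
  by rewrite subr0 normr_ge0 divff ?pnatr_eq0.
have -> : x ^+ 2 = `|x| ^+ 2 by rewrite real_normK ?num_real.
move: h1 h2 h3; set p := abs_approx n x; move: `|x| (normr_ge0 x) x1 => a a0 a1 h1 h2 h3.
have -> : a - (p + (a ^+ 2 - p ^+ 2) / 2) = (a - p) * (1 - (a + p) / 2) by field.
have n2 : 0 < n.+2%:R :> R by rewrite ltr0n.
have n3 : 0 < n.+3%:R :> R by rewrite ltr0n.
split; last by nra.
have r0 : 0 <= 1 - (a + p) / 2 by lra.
rewrite mulr_ge0//=.
set c := 2 / n.+2%:R in h2 *.
have c1 : c <= 1 by rewrite /c ler_pdivrMr// mul1r ler_nat.
have : (a - p) * (1 - (a + p) / 2) <= c * (1 - c / 2) by nra.
move=> h; apply: le_trans h _.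
rewrite /c (_ : n.+3%:R = n.+2%:R + 1); last by rewrite natr1.
move: n2; move: (n.+2%:R : R) => m m0.
rewrite (_ : 2 / m * (1 - 2 / m / 2) = (2 * (m - 1)) / (m * m)); last by field; rewrite gt_eqF.
rewrite ler_pdivrMr ?mulr_gt0// mulrAC ler_pdivlMr ?addr_gt0//; nra.
Qed.

Lemma tapx_norm f : tapx f -> tapx (fun x => `|f x|).
Proof.
move=> tf; have [M M0 hM] := tapx_bdd tf.
have tf1 : tapx (fun x => M^-1 * f x) by apply: tapxM => //; exact: tapx_cst.
have tp n : tapx (fun x => abs_approx n (M^-1 * f x)).
  elim: n => [|n IH] /=; first exact: tapx_cst.
  apply: tapxD => //; apply: tapxM; last exact: tapx_cst.
  apply: tapxD; first exact: tapxM.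
  under eq_fun do rewrite -mulN1r; apply: tapxM; first exact: tapx_cst.
  exact: tapxM.
apply: tapx_unif => e e0; pose n := Num.truncn (2 * M / e).
exists (fun x => M * abs_approx n (M^-1 * f x)).
  by apply: tapxM => //; exact: tapx_cst.
move=> x; have y1 : `|M^-1 * f x| <= 1.
  by rewrite normrM gtr0_norm ?invr_gt0// mulrC ler_pdivrMr// mul1r.
have [/andP[h1 h2] _] := abs_approxP n y1.
have -> : `|f x| = M * `|M^-1 * f x|.
  by rewrite normrM gtr0_norm ?invr_gt0// mulrA divff ?mul1r// gt_eqF.
rewrite -mulrBr ger0_norm ?mulr_ge0 ?(ltW M0)//.
apply: (@le_trans _ _ (M * (2 / n.+2%:R))); first by rewrite ler_pM2l.
rewrite mulrA ler_pdivrMr ?ltr0n// mulrC (mulrC e) -ler_pdivrMr//.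
by apply/ltW/(lt_le_trans (truncnS_gt _)); rewrite ler_nat.
Qed.

Lemma tapx_min f g : tapx f -> tapx g -> tapx (fun x => Num.min (f x) (g x)).
Proof.
move=> tf tg.
have tN h : tapx h -> tapx (fun x => - h x).
  by move=> th; under eq_fun do rewrite -mulN1r; apply: tapxM => //; exact: tapx_cst.
have -> : (fun x => Num.min (f x) (g x)) = (fun x => 2^-1 * (f x + g x + - `|f x + - g x|)).
  by apply/funext => x; rewrite minr_absE; lra.
apply: tapxM; first exact: tapx_cst.
apply: tapxD; first exact: tapxD.
by apply/tN/tapx_norm/tapxD => //; exact: tN.
Qed.

Lemma tapx_bigmin (J : Type) (r : seq J) (F : J -> Td -> R) f :
  tapx f -> (forall j, tapx (F j)) -> tapx (fun x => \big[Num.min/f x]_(j <- r) F j x).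
Proof.
move=> tf tF; elim: r => [|j r IH].
  by under eq_fun do rewrite big_nil.
by under eq_fun do rewrite big_cons; exact: tapx_min.
Qed.

Lemma torus_grid e : 0 < e -> exists G : seq Td, forall x, exists2 z, z \in G & cost (x - z) <= e.
Proof.
move=> e0; pose K := twopi ^+ 2 * d%:R.
have K0 : 0 <= K by rewrite mulr_ge0 ?sqr_ge0.
pose N := (Num.truncn (K / e)).+1.
have N0 : 0 < N%:R :> R by rewrite ltr0n.
have NK : K / N%:R <= e.
  by rewrite ler_pdivrMr// mulrC -ler_pdivrMr// ltW// truncnS_gt.
pose pt (h : {ffun 'I_d -> 'I_N}) : Td := \pi_Td (\row_i ((h i)%:R / N%:R) : Rd).
exists [seq pt h | h : {ffun 'I_d -> 'I_N} <- enum {ffun 'I_d -> 'I_N}] => x.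
pose r : Rd := repr x; pose u i : R := r 0 i - (Num.floor (r 0 i))%:~R.
have u01 i : 0 <= u i < 1.
  have := floor_le (r 0 i); have := floorD1_gt (r 0 i); rewrite intrD1 /u.
  by move: (Num.floor _)%:~R => n h1 h2; apply/andP; split; lra.
have tN i : (Num.truncn (N%:R * u i) < N)%N.
  have /andP[u0 u1] := u01 i.
  by rewrite truncn_lt_nat ?mulr_ge0// -[ltRHS]mulr1 ltr_pM2l.
pose h : {ffun 'I_d -> 'I_N} := [ffun i => Ordinal (tN i)].
exists (pt h); first by apply: map_f; rewrite mem_enum.
have -> : x - pt h = \pi_Td (\row_i (u i - (h i)%:R / N%:R) : Rd).
  rewrite -[x]reprK /pt -piB; apply/pi_eqP; exists (fun i => Num.floor (r 0 i)) => i.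
  by rewrite !mxE /u -/r; ring.
rewrite /cost; apply: le_trans NK.
rewrite (_ : K / N%:R = \sum_(i < d) twopi ^+ 2 / N%:R); last first.
  by rewrite sumr_const card_ord -[RHS]mulr_natr /K mulrAC.
apply: ler_sum => i _; rewrite cs_pi mxE (le_trans (one_sub_cos_le _))//.
rewrite exprMn -mulrA ler_wpM2l ?sqr_ge0// ffunE/=.
have /andP[u0 u1] := u01 i.
have /andP[t1 t2] := @truncn_itv _ _ (mulr_ge0 (ltW N0) u0).
set t := (Num.truncn _)%:R in t1 *.
rewrite -natr1 -/t in t2.
have h1 : t / N%:R <= u i by rewrite ler_pdivrMr// mulrC.
have h2 : u i <= t / N%:R + N%:R^-1.
  by rewrite -[X in _ + X]mul1r -mulrDl ler_pdivlMr// mulrC ltW.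
have h3 : N%:R^-1 <= 1 :> R by rewrite invf_le1// ler1n.
have : 0 < N%:R^-1 :> R by rewrite invr_gt0.
move: (t / N%:R) (N%:R^-1) h1 h2 h3 => a b h1 h2 h3 b0; nra.
Qed.

(** A modulus of continuity written with [cost]; the additive e compensates for [cost] being
    quadratic near 0. *)
Definition cost_regular f := forall e, 0 < e -> exists2 K, 0 < K &
  forall x y, f x <= f y + e + K * cost (x - y).

(** f is close to the minimum, over the points z of a finite grid, of f z + K cost (x - z):
    regularity bounds this minimum from below, and a nearby grid point from above. *)
Lemma tapx_regular f : cost_regular f -> tapx f.
Proof.
move=> rf; apply: tapx_unif => e e0; have e3 : 0 < e / 3 by rewrite divr_gt0.
have [K K0 hK] := rf _ e3.
have eK : 0 < e / 3 / K by rewrite divr_gt0.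
have [G hG] := torus_grid eK.
have [z0 z0G _] := hG 0.
pose F z x := f z + K * cost (x - z).
have tF z : tapx (F z).
  apply: tapxD; first exact: tapx_cst.
  by apply: tapxM; [exact: tapx_cst|exact: tapx_cost].
exists (fun x => \big[Num.min/F z0 x]_(z <- G) F z x); first exact: tapx_bigmin.
move=> x; set m := \big[_/_]_(_ <- _) _.
have h1 : f x - e / 3 <= m.
  have hF z : f x - e / 3 <= F z x by have := hK x z; rewrite /F; lra.
  by apply: (big_ind (fun z => f x - e / 3 <= z)) => // a b ha hb; rewrite le_min ha.
have h2 : m <= f x + 2 * (e / 3) + e / 3.
  have [z zG zx] := hG x.
  apply: (@le_trans _ _ (F z x)).
    rewrite /m; elim: (G) zG => // a s IH; rewrite in_cons big_cons ge_min.
    by case/orP => [/eqP<-|/IH->]; rewrite ?lexx ?orbT.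
  have := hK z x; have := costN (x - z); rewrite opprB => ->.
  have := ler_wpM2l (ltW K0) zx; rewrite [X in _ <= X]mulrC divfK ?gt_eqF// /F; lra.
by rewrite ler_norml; apply/andP; split; lra.
Qed.

(** Let u, v be the cosine and sine of the difference in one coordinate, and r, s those of y. The
    delicate term is s v: since s^2 <= 1 and v^2 <= 2 (1 - u), Young's inequality bounds it by a / 2
    + (1 - u) / a. *)
Lemma cost_split e : 0 < e -> exists2 K, 0 < K & forall x y, cost x <= cost y + e + K * cost (x - y).
Proof.
move=> e0; have n0 : 0 < d%:R + 1 :> R by rewrite ltr_wpDl.
pose a : R := e / (d%:R + 1); have a0 : 0 < a by rewrite divr_gt0.
have ad : a * d%:R <= e.
  by rewrite /a -mulrA ler_piMr ?(ltW e0)// mulrC ler_pdivrMr// mul1r lerDl.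
exists (1 + 1 / a); first by rewrite ltr_wpDr// divr_ge0// ltW.
move=> x y; suff : cost x - cost y - (1 + 1 / a) * cost (x - y) <= a * d%:R by lra.
rewrite mulr_natr -[X in _ *+ X]card_ord -sumr_const /cost mulr_sumr -!sumrB.
apply: ler_sum => i _; rewrite csB.
have := cs2Dsn2 x i; have := cs2Dsn2 y i.
move: (cs x i) (sn x i) (cs y i) (sn y i) => p q r s h1 h2.
pose u := p * r + q * s; pose v := q * r - p * s.
have uv : u ^+ 2 + v ^+ 2 = 1.
  transitivity ((p ^+ 2 + q ^+ 2) * (r ^+ 2 + s ^+ 2)); last by rewrite h1 h2 mulr1.
  by rewrite /u /v; ring.
have pE : p = r * u - s * v.
  by transitivity (p * (r ^+ 2 + s ^+ 2)); [rewrite h1 mulr1|rewrite /u /v; ring].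
rewrite -/u pE; clear pE; clearbody u v; clear h2 p q.
have u1 : u <= 1 by nra.
have r1 : -1 <= r by nra.
have v2 : v ^+ 2 <= 2 * (1 - u) by nra.
have s2 : s ^+ 2 <= 1 by have := sqr_ge0 r; lra.
have sv : s * v <= a / 2 + (1 - u) / a.
  rewrite -(ler_pM2r a0) mulrDl divfK ?gt_eqF//.
  have := sqr_ge0 (s * a - v); have : s ^+ 2 * a ^+ 2 <= a ^+ 2 by rewrite ler_piMl ?sqr_ge0.
  nra.
have h : (r - 1) * (1 - u) <= 0 by rewrite mulr_le0_ge0 ?subr_ge0// subr_le0; nra.
rewrite mulrDl mul1r mulrAC mul1r; lra.
Qed.

Definition paraboloid (m k : R) y := cst_modes m ++ trig_scale k (cost_modes y).

Lemma integral_paraboloid m k y : integral_modes (paraboloid m k y).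
Proof.
apply: integral_modes_cat; first exact: integral_cst.
exact: integral_modes_map (fun e => k * e.1.1) (@integral_cost y).
Qed.

Lemma tsum_paraboloid m k y x : tsum (paraboloid m k y) x = m + k * cost (x - y).
Proof. by rewrite /tsum trig_cat trig_cst trig_scaleE -tsum_cost. Qed.

(** All the cosines in [cost] have frequency (2 pi)^2, so d - cost is an eigenfunction, which the
    resolvent multiplies by a / (a + (2 pi)^2). *)
Lemma resolvent_paraboloid a m k y x : 0 < a -> tsum (resolvent a (paraboloid m k y)) x =
  m + k * (cost (x - y) + (d%:R - cost (x - y)) * (twopi ^+ 2 / (a + twopi ^+ 2))).
Proof.
move=> a0; have f0 (c : R) : freq (c, 0 : Rd, 0) = 0 by rewrite /freq dot0l mulr0.
rewrite -tsum_cost /tsum /resolvent /paraboloid /trig_scale /cost_modes !map_cat !trig_cat !trig_cst.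
rewrite /= !f0 addr0 divff ?gt_eqF// !mulr1; congr (_ + _).
pose F (i : 'I_d) := cos (phase (1, 'e_i, - (twopi * (repr y : Rd) 0 i)) (repr x)).
have E1 : trig [seq (-1, 'e_i, - (twopi * (repr y : Rd) 0 i)) | i <- enum 'I_d] (repr x) = - \sum_i F i.
  by rewrite /trig big_map big_enum -sumrN; apply: eq_bigr => i _; rewrite mulN1r.
rewrite E1 /trig 3!big_map big_enum /=.
transitivity (k * d%:R - k * (a / (a + twopi ^+ 2)) * \sum_i F i); last first.
  by field; rewrite gt_eqF// ltr_wpDr// sqr_ge0.
congr (_ + _); rewrite mulr_sumr -sumrN; apply: eq_bigr => i _.
by rewrite freq_cost /F /phase/= mulrN1 !mulNr.
Qed.

(* The paraboloids touching f at wb from both sides bound the Laplacian of its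
   resolvent there, and resolventE compares Laplacians through the values of
   f - tsum l: no second-order differentiability of f is needed. *)
Lemma resolvent_approx f k wb xb yb e : cost_regular f -> 0 <= k -> 0 < e ->
  (forall w, f w <= f wb + k * (cost (w - yb) - cost (wb - yb))) ->
  (forall w, f wb - k * (cost (w - xb) - cost (wb - xb)) <= f w) ->
  exists l, [/\ integral_modes l, forall w, `|f w - tsum l w| <= e,
    `|tlap l wb| <= k * twopi ^+ 2 * d%:R + e,
    forall w, f wb - tsum l wb <= f w - tsum l w -> tlap l w <= tlap l wb + e &
    forall w, f w - tsum l w <= f wb - tsum l wb -> tlap l wb - e <= tlap l w].
Proof.
move=> rf k0 e0 hup hlo; have e8 : 0 < e / 8 by rewrite divr_gt0.
have [K K0 hK] := rf _ e8.
pose W : R := twopi ^+ 2.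
have W0 : 0 < W by rewrite exprn_gt0// mulrn_wgt0// pi_gt0.
(* Large enough for the resolvent of a paraboloid of opening K to differ from it by at most e / 8 at
   its vertex. *)
pose a : R := 1 + 8 * K * d%:R * W / e.
have a0 : 0 < a by rewrite ltr_pwDl// divr_ge0 ?(ltW e0)// mulr_ge0 ?(ltW W0)// mulr_ge0// mulr_ge0 ?(ltW K0).
have aW : 0 < a + W by rewrite addr_gt0.
have ha : K * (d%:R * (W / (a + W))) <= e / 8.
  rewrite [d%:R * _]mulrA [K * _]mulrA ler_pdivrMr//.
  have : e * a = e + 8 * K * d%:R * W by rewrite /a mulrDr mulr1 mulrCA divff ?mulr1 ?gt_eqF.
  have : 0 < e * W by rewrite mulr_gt0.
  by move=> h1 h2; lra.
(* The Laplacian of the resolvent multiplies the error of [l0] by a, hence the bound e / 4 / a. *)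
pose e1 := Num.min (e / 8) (e / 4 / a).
have e10 : 0 < e1 by rewrite lt_min e8/= !divr_gt0.
have e1e : e1 <= e / 8 by rewrite /e1 ge_min lexx.
have e1a : a * e1 <= e / 4.
  by rewrite mulrC -ler_pdivlMr// /e1 ge_min lexx orbT.
have [l0 [il0 hl0]] := tapx_regular rf e10.
pose l := resolvent a l0; exists l.
have il : integral_modes l by exact: integral_modes_map.
have lapE w : tlap l w = a * (tsum l w - tsum l0 w) by exact: resolventE.
have close w : `|tlap l w - a * (tsum l w - f w)| <= e / 4.
  rewrite lapE -mulrBr (_ : _ - _ - _ = f w - tsum l0 w); last by lra.
  by rewrite normrM gtr0_norm// (le_trans _ e1a)// ler_pM2l.
have up m k' y : (forall x, tsum l0 x <= m + k' * cost (x - y)) ->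
    forall x, tsum l x <= m + k' * (cost (x - y) + (d%:R - cost (x - y)) * (W / (a + W))).
  move=> h x; rewrite -resolvent_paraboloid//.
  apply: resolvent_le => //; first exact: integral_paraboloid.
  by move=> z; rewrite tsum_paraboloid.
have lo m k' y : (forall x, m + k' * cost (x - y) <= tsum l0 x) ->
    forall x, m + k' * (cost (x - y) + (d%:R - cost (x - y)) * (W / (a + W))) <= tsum l x.
  move=> h x; rewrite -resolvent_paraboloid//.
  apply: resolvent_le => //; first exact: integral_paraboloid.
  by move=> z; rewrite tsum_paraboloid.
have hq w : f w - e1 <= tsum l0 w <= f w + e1.
  by have := hl0 w; rewrite ler_norml => /andP[? ?]; apply/andP; split; lra.
have WaW : 0 <= W / (a + W) by rewrite divr_ge0// ltW.
have WaW1 : a * (W / (a + W)) <= W.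
  by rewrite mulrCA ger_pMr// ler_pdivrMr// mul1r lerDl ltW.
split=> //.
- move=> w.
  have h1 : tsum l w <= f w + e / 8 + e1 + K * (d%:R * (W / (a + W))).
    have /up/(_ w) : forall x, tsum l0 x <= f w + e / 8 + e1 + K * cost (x - w).
      by move=> x; have := hK x w; have /andP[_] := hq x; lra.
    by rewrite subrr cost0 add0r subr0.
  have h2 : f w - e / 8 - e1 - K * (d%:R * (W / (a + W))) <= tsum l w.
    have /lo/(_ w) : forall x, f w - e / 8 - e1 + - K * cost (x - w) <= tsum l0 x.
      move=> x; have := hK w x; have := costN (x - w); rewrite opprB => ->.
      by have /andP[+ _] := hq x; lra.
    by rewrite subrr cost0 add0r subr0 mulNr.
  by rewrite ler_norml; apply/andP; split; lra.
(* Multiplied by a, these bounds control the Laplacian at wb, since a * (W / (a + W)) <= W; the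
   value k W d is the Laplacian of k cost at its vertex. *)
- have h1 : tsum l wb <= f wb + e1 + k * ((d%:R - cost (wb - yb)) * (W / (a + W))).
    have /up/(_ wb) : forall x, tsum l0 x <= f wb + e1 - k * cost (wb - yb) + k * cost (x - yb).
      by move=> x; have := hup x; have /andP[_] := hq x; lra.
    by lra.
  have h2 : f wb - e1 - k * ((d%:R - cost (wb - xb)) * (W / (a + W))) <= tsum l wb.
    have /lo/(_ wb) : forall x, f wb - e1 + k * cost (wb - xb) + - k * cost (x - xb) <= tsum l0 x.
      by move=> x; have := hlo x; have /andP[+ _] := hq x; lra.
    by lra.
  have c1 : d%:R - cost (wb - yb) <= d%:R by rewrite gerBl cost_ge0.
  have c2 : d%:R - cost (wb - xb) <= d%:R by rewrite gerBl cost_ge0.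
  have g1 y : a * (k * ((d%:R - cost (wb - y)) * (W / (a + W)))) <= k * W * d%:R.
    rewrite mulrCA -[leRHS]mulrA ler_wpM2l//.
    rewrite mulrCA mulrC; apply: (@le_trans _ _ (a * (W / (a + W)) * d%:R)).
      by apply: ler_wpM2l; [exact: mulr_ge0 (ltW a0) WaW|rewrite gerBl cost_ge0].
    by rewrite ler_wpM2r.
  have := close wb; have := g1 xb; have := g1 yb.
  have := ler_wpM2l (ltW a0) h1; have := ler_wpM2l (ltW a0) h2.
  rewrite !ler_norml -/W => i1 i2 i3 i4 /andP[i5 i6]; apply/andP; split; lra.
- move=> w h; have := close w; have := close wb; rewrite !ler_norml => /andP[i1 i2] /andP[i3 i4].
  have : a * (tsum l w - f w) <= a * (tsum l wb - f wb) by rewrite ler_pM2l//; lra.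
  lra.
- move=> w h; have := close w; have := close wb; rewrite !ler_norml => /andP[i1 i2] /andP[i3 i4].
  have : a * (tsum l wb - f wb) <= a * (tsum l w - f w) by rewrite ler_pM2l//; lra.
  lra.
Qed.

End trig_approximation.

(** * Jets at touching points *)

Section jet_remainder.
Context {R : realType}.

(** In a jet, r dominates |t' - t|, the root of the transport cost and |w' - w|^2: squares of the
    first two are at most r^2, and the cubic error in w is at most r^(3/2). *)
Definition jet_omega (A C r : R) := A * r ^+ 2 + C * (`|r| * Num.sqrt `|r|).

Lemma jet_omega_little A C : jet_omega A C =o_ (0 : R) id.
Proof.
apply/eqoP => e e0; pose D : R := `|A| + `|C| + 1.
have D0 : 0 < D by rewrite ltr_wpDl.
have eD : 0 < e / D by rewrite divr_gt0.
pose b : R := Num.min 1 ((e / D) ^+ 2).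
have b0 : 0 < b by rewrite lt_min ltr01 exprn_gt0.
near=> x.
have xb : `|x| <= b.
  near: x; have := @nbhs0_le _ R b b0; apply: filterS => z /=.
  by [].
have x1 : `|x| <= 1 by rewrite (le_trans xb)// ge_min lexx.
have x2 : Num.sqrt `|x| <= e / D.
  have : Num.sqrt `|x| <= Num.sqrt ((e / D) ^+ 2).
    by rewrite ler_wsqrtr// (le_trans xb)// ge_min lexx orbT.
  by rewrite sqrtr_sqr (gtr0_norm eD).
have x3 : `|x| <= Num.sqrt `|x|.
  have : Num.sqrt (`|x| ^+ 2) <= Num.sqrt `|x| by rewrite ler_wsqrtr// expr2 ler_piMr.
  by rewrite sqrtr_sqr normr_id.
rewrite /jet_omega (le_trans (ler_normD _ _))//.
rewrite normrM normrX normrM normrM normr_id (ger0_norm (sqrtr_ge0 _)).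
have h1 : `|A| * `|x| ^+ 2 <= `|A| * (`|x| * (e / D)).
  by rewrite ler_wpM2l// expr2 ler_wpM2l// (le_trans x3).
have h2 : `|C| * (`|x| * Num.sqrt `|x|) <= `|C| * (`|x| * (e / D)).
  by rewrite ler_wpM2l// ler_wpM2l.
rewrite (le_trans (lerD h1 h2))// -mulrDl mulrA (mulrC _ `|x|) -mulrA mulrC ler_wpM2r//.
by rewrite mulrA ler_pdivrMr// mulrC ler_wpM2l ?(ltW e0)// lerDl.
Unshelve. all: by end_near. Qed.

Lemma jet_remainder_le A B C t c s : 0 <= A -> 0 <= B -> 0 <= C -> 0 <= t -> 0 <= c -> 0 <= s ->
  B * t ^+ 2 + A * c + C * (s ^+ 3 + s ^+ 4) <=
  jet_omega (A + B + C) C (t + Num.sqrt c + s ^+ 2).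
Proof.
move=> A0 B0 C0 t0 c0 s0; have q0 := sqrtr_ge0 c.
have := sqr_sqrtr c0; move: (Num.sqrt c) q0 => q q0 <-; rewrite /jet_omega.
set r := t + q + s ^+ 2; have s2 := sqr_ge0 s.
have r0 : 0 <= r by rewrite !addr_ge0.
rewrite (ger0_norm r0).
have h1 : t ^+ 2 <= r ^+ 2 by rewrite ler_pXn2r ?nnegrE// /r -addrA lerDl addr_ge0.
have h2 : q ^+ 2 <= r ^+ 2 by rewrite ler_pXn2r ?nnegrE// /r addrAC lerDr addr_ge0.
have h3 : s ^+ 2 <= r by rewrite /r lerDr addr_ge0.
have h4 : s ^+ 4 <= r ^+ 2 by rewrite (exprM s 2 2) ler_pXn2r ?nnegrE.
have h5 : s ^+ 3 <= r * Num.sqrt r.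
  rewrite exprSr ler_pM//.
  by have := ler_wsqrtr h3; rewrite sqrtr_sqr ger0_norm.
have := ler_wpM2l B0 h1; have := ler_wpM2l A0 h2; have := ler_wpM2l C0 h4; have := ler_wpM2l C0 h5.
lra.
Qed.

End jet_remainder.

Section marginals.
Context {R : realType}.

Lemma probability_eq d (S : measurableType d) d' (S' : measurableType d')
    (P : probability S R) (Q : probability S' R) A B :
  measurable A -> measurable B -> fine (P A) = fine (Q B) -> P A = Q B.
Proof.
move=> mA mB h; rewrite -[LHS]fineK ?fin_num_measure// -[RHS]fineK ?fin_num_measure//.
by rewrite h.
Qed.

Lemma expect_law_comp d (S : measurableType d) d' (S' : measurableType d')
    (P : probability S R) (h : S -> S') (mh : measurable_fun setT h) (f : S' -> R) :
  measurable_fun setT f -> bmeas (fun x => f (h x)) ->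
  \int[law P mh]_x f x = \int[P]_x f (h x).
Proof.
move=> mf bf; rewrite /Rintegral integral_distribution//=.
  exact/measurable_EFinP.
exact: bmeas_integrable.
Qed.

Context d (S : measurableType d) d' (S' : measurableType d').

Lemma expect_fst (G : probability (S * S')%type R) (P : probability S R) f :
  (forall A, measurable A -> G (A `*` setT) = P A) -> bmeas f ->
  \int[G]_z f z.1 = \int[P]_x f x.
Proof.
move=> h bf; rewrite -(expect_law G measurable_fst)//; apply: probability_ext => // A mA.
by rewrite lawE -h// setXT.
Qed.

Lemma expect_snd (G : probability (S * S')%type R) (P : probability S' R) f :
  (forall A, measurable A -> G (setT `*` A) = P A) -> bmeas f ->
  \int[G]_z f z.2 = \int[P]_x f x.
Proof.
move=> h bf; rewrite -(expect_law G measurable_snd)//; apply: probability_ext => // A mA.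
by rewrite lawE -h// setTX.
Qed.

Lemma measurable_swap : measurable_fun setT (fun z : S * S' => (z.2, z.1)).
Proof. by apply: measurable_fun_pair. Qed.

Definition swap_law (G : probability (S * S')%type R) : probability (S' * S)%type R :=
  law G measurable_swap.

Lemma swap_lawE (G : probability (S * S')%type R) A B : swap_law G (A `*` B) = G (B `*` A).
Proof.
rewrite lawE; congr (G _); apply/seteqP; split => -[x y] [] //=.
Qed.

Lemma expect_seed (G : probability (S * S')%type R) (P : probability S R) (F : S * R -> R) :
  (forall A, measurable A -> G (A `*` setT) = P A) -> bmeas F ->
  \int[(G \x unif01)%E]_z F (z.1.1, z.2) = \int[(P \x unif01)%E]_z F z.
Proof.
move=> h bF.
have bF' : bmeas (fun z : (S * S') * R => F (z.1.1, z.2)).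
  apply: bmeas_comp bF; apply: measurable_fun_pair => //.
  exact: (measurableT_comp measurable_fst measurable_fst).
have [_ ->] := expect_prod G unif01 bF'; have [b1 ->] := expect_prod P unif01 bF.
exact: (expect_fst h b1).
Qed.

End marginals.

Section random_law.
Context {R : realType} d (S : measurableType d) d' (S' : measurableType d').

(** The sigma-algebra on probability measures is generated by evaluation at measurable sets, and
    each evaluation is the measure of a section of k^-1 (B). *)
Lemma measurable_random_law (k : S * R -> S') (mk : measurable_fun setT k)
    (mk1 : forall x, measurable_fun setT (fun u => k (x, u))) :
  measurable_fun setT (fun x => law unif01 (mk1 x) : pprobability S' R).
Proof.
apply: (measurability (@pset _ _ _ : set (set (pprobability _ R)))) => //.
move=> _ -[_ [r r01] [B mB <-]] <-; apply: emeasurable_fun_infty_o => //=.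
have mkB : measurable (k @^-1` B) by rewrite -[X in measurable X]setTI; exact: mk.
have := measurable_fun_xsection unif01 mkB.
congr measurable_fun; apply/funext => x /=; congr (unif01 _).
by apply/seteqP; split => u /=; rewrite /xsection/= inE.
Qed.

End random_law.

(** * Jets at a maximum over plans with a frozen marginal *)

Section touching.
Context {R : realType} {d : nat}.
Local Notation Td := (torus R d).
Local Notation Pd := (Ptorus R d).
Local Notation Rd := 'rV[R]_d.
Context (delta : Td -> Td -> Rd) (delta_min : minimal_difference delta) (T : R).
Context dY (Y : measurableType dY) (enc : Y -> code) (dec : code -> Y) (cY : coding enc dec).

Definition plan_of (gb : probability Y R) (mu : Pd) (G : probability (Y * Td)%type R) :=
  (forall A, measurable A -> G (A `*` setT) = gb A) /\
  (forall B, measurable B -> G (setT `*` B) = mu B).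

Section jet.
Variables (gb : probability Y R) (G : R -> Pd -> Td -> R) (tau : R -> R)
  (a : Y * Td -> R) (g : Y * Td -> Rd) (f : Td -> R) (A B M theta t : R)
  (mu : Pd) (Gam : probability (Y * Td)%type R) (w : Td) (p : Rd) (X : 'M[R]_d).
Hypotheses (A0 : 0 <= A) (B0 : 0 <= B) (ba : bmeas a) (mg : measurable_fun setT g)
  (bg : forall z, enorm (g z) <= M)
  (ha : forall y x x', a (y, x') <= a (y, x) + dot (g (y, x)) (delta x' x) + A * tdist x' x ^+ 2)
  (htau : forall t', t <= t' <= T -> tau t' <= tau t + theta * (t' - t) + B * (t' - t) ^+ 2)
  (hf : taylor2 f w p X)
  (plan : plan_of gb mu Gam)
  (maxi : forall t' mu' Gam' w', t <= t' <= T -> plan_of gb mu' Gam' ->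
    G t' mu' w' - tau t' - \int[Gam']_z a z - f w' <= G t mu w - tau t - \int[Gam]_z a z - f w).

(* A maximum point of G - test over plans with a fixed marginal on Y is moved by
   an arbitrary coupling of mu and mu', glued through the conditional law of Y. *)
Lemma touching_jet : exists psi, superjet delta T G t mu w (theta, psi, p, X) /\
  forall F : Td * Rd -> R, measurable_fun setT F -> bdd (fun z : Y * Td => F (z.2, g z)) ->
    \int[mu]_x \int[psi x]_z F (x, z) = \int[Gam]_z F (z.2, g z).
Proof.
have [plan1 plan2] := plan.
have margS B' : measurable B' -> swap_law Gam (B' `*` setT) = mu B'.
  by move=> mB'; rewrite swap_lawE plan2.
have [W [mW hW]] := disintegration cY margS.
pose k (z : Td * R) := g (W z, z.1).
have mk : measurable_fun setT k.
  apply: (measurableT_comp mg); exact: measurable_fun_pair.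
have mk1 x : measurable_fun setT (fun u => k (x, u)).
  apply: (measurableT_comp mk); exact: pair1_measurable.
have kM z : enorm (k z) <= M by exact: bg.
have M0 : 0 <= M by exact: le_trans (enorm_ge0 _) (kM (0, 0)).
pose psi x : pprobability Rd R := law unif01 (mk1 x).
exists psi; split; last first.
  move=> F mF bF.
  have bF1 : bmeas (fun z : Td * R => F (z.1, k z)).
    split; first by apply: (measurableT_comp mF); exact: measurable_fun_pair.
    by have [N hN] := bF; exists N => z; exact: (hN (W z, z.1)).
  have bF2 : bmeas (fun z : Y * Td => F (z.2, g z)).
    by split=> //; apply: (measurableT_comp mF); exact: measurable_fun_pair.
  transitivity (\int[mu]_x \int[unif01]_u F (x, k (x, u))).
    apply: eq_Rintegral => x _; rewrite expect_law_comp//.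
      by apply: (measurableT_comp mF); exact: pair1_measurable.
    exact: bmeas_section1 bF1.
  have [_ <-] := expect_prod mu unif01 bF1.
  have bF3 : bmeas (fun z : Td * Y => F (z.1, g (z.2, z.1))).
    exact: (bmeas_comp (h := fun z : Td * Y => (z.2, z.1)) (@measurable_swap _ _ _ _) bF2).
  have := hW _ bF3; rewrite /k => <-.
  by rewrite (expect_law Gam (@measurable_swap _ _ _ _) bF3); apply: eq_Rintegral => -[].
split.
- exact: measurable_random_law.
(* The momenta have norm at most M, so the open set of norms above M is null for psi x and misses
   the support; M + 1 makes the inequality strict. *)
- exists (M + 1) => x z /= h; rewrite ltNge; apply/negP => Mz.
  have oM : open [set v : Rd | M < enorm v].
    have : open (enorm @^-1` [set s : R | M < s] : set Rd).
      by apply: open_comp; [move=> ? _; exact: continuous_enorm|exact: open_gt].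
    by [].
  have /(_ oM) := h [set v : Rd | M < enorm v].
  have Mz' : M < enorm z by rewrite (lt_le_trans _ Mz)// ltrDl.
  move=> /(_ Mz'); rewrite lawE (_ : _ @^-1` _ = set0) ?measure0 ?ltxx//.
  by apply/seteqP; split => // u /=; rewrite ltNge kM.
- by case: hf.
have [symX [C C0 hC]] := hf.
exists (jet_omega (A + B + C) C); first exact: jet_omega_little.
move=> t' mu' w' gam tt' cg.
have cg1 A' : measurable A' -> gam (A' `*` setT) = mu A'.
  by move=> mA'; rewrite -(proj1 (cg _ mA')) setXT.
have cg2 A' : measurable A' -> gam (setT `*` A') = mu' A'.
  by move=> mA'; rewrite -(proj2 (cg _ mA')) setTX.
pose Q := (gam \x unif01)%E.
pose m (z : (Td * Td) * R) := (W (z.1.1, z.2), z.1.2).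
have mseed : measurable_fun setT (fun z : (Td * Td) * R => (z.1.1, z.2)).
  by apply: measurable_fun_pair => //; exact: (measurableT_comp measurable_fst measurable_fst).
have mm : measurable_fun setT m.
  apply: measurable_fun_pair; first exact: (measurableT_comp mW mseed).
  exact: (measurableT_comp measurable_snd measurable_fst).
pose Gam' : probability (Y * Td)%type R := law Q mm.
have hWs f' : bmeas f' -> \int[Gam]_z f' z = \int[Q]_z f' (W (z.1.1, z.2), z.1.1).
  move=> bf'.
  have bf2 : bmeas (fun z : Td * Y => f' (z.2, z.1)) by exact: (bmeas_comp (h := fun z : Td * Y => (z.2, z.1)) (@measurable_swap _ _ _ _) bf').
  have mWz : measurable_fun setT (fun z : Td * R => (W z, z.1)) by exact: measurable_fun_pair.
  rewrite (expect_seed (F := fun z => f' (W z, z.1)) cg1); last exact: bmeas_comp bf'.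
  by have := hW _ bf2; rewrite /= => <-; rewrite (expect_law Gam (@measurable_swap _ _ _ _) bf2); apply: eq_Rintegral => -[].
have plan' : plan_of gb mu' Gam'.
  split => A' mA'.
    rewrite -plan1//; apply: probability_eq; [exact: measurableX|exact: measurableX|].
    have b1 : bmeas (\1_(A' `*` setT) : Y * Td -> R) by apply: bmeas_indic; exact: measurableX.
    rewrite -!expect_indic; [|exact: measurableX|exact: measurableX].
    by rewrite hWs// expect_law.
  rewrite -cg2//; apply: probability_eq; [exact: measurableX|exact: measurableX|].
  rewrite -!expect_indic; [|exact: measurableX|exact: measurableX].
  have b1 : bmeas (\1_(setT `*` A') : Td * Td -> R) by apply: bmeas_indic; exact: measurableX.
  have b2 : bmeas (\1_(setT `*` A') : Y * Td -> R) by apply: bmeas_indic; exact: measurableX.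
  rewrite expect_law//.
  have [_ ->] := expect_prod gam unif01 (bmeas_comp mm b2).
  apply: eq_Rintegral => z _ /=.
  transitivity (\int[@unif01 R]_u (\1_(setT `*` A') z : R)); last exact: expect_cst.
  apply: eq_Rintegral => u _.
  have E : (m (z, u) \in setT `*` A') = (z \in setT `*` A').
    by apply/idP/idP; rewrite !inE.
  exact: (congr1 (fun b : bool => b%:R : R) E).
have bdot : bmeas (fun z : (Td * Td) * R => dot (k (z.1.1, z.2)) (delta z.1.2 z.1.1)).
  apply: bmeas_sum => i; apply: bmeasM.
    split; last by exists M => z; rewrite (le_trans (coord_le_enorm _ _)).
    exact: (measurableT_comp (measurable_coord i) (measurableT_comp mk mseed)).
  apply: (bmeas_comp (h := fun z : (Td * Td) * R => (z.1.2, z.1.1)) _ (bmeas_delta delta_min i)).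
  by apply: measurable_fun_pair; [exact: (measurableT_comp measurable_snd measurable_fst)|exact: (measurableT_comp measurable_fst measurable_fst)].
have btd : bmeas (fun q : Td * Td => tdist q.1 q.2 ^+ 2) by apply: bmeasX; exact: bmeas_tdist delta_min.
have tdC (x y : Td) : tdist x y = tdist y x.
  have td (x' y' : Td) : tdist x' y' <= tdist y' x'.
    rewrite -(enorm_delta delta_min y') -enormN; apply: tdist_le.
    by rewrite raddfN/= (delta_pi delta_min) opprB.
  by apply/eqP; rewrite eq_le !td.
have key : \int[Gam']_z a z <= \int[Gam]_z a z + \int[gam]_q \int[psi q.1]_z dot z (delta q.2 q.1)
    + A * transport_cost gam.
  have -> : \int[gam]_q \int[psi q.1]_z dot z (delta q.2 q.1) =
      \int[Q]_z dot (k (z.1.1, z.2)) (delta z.1.2 z.1.1).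
    have [_ ->] := expect_prod gam unif01 bdot; apply: eq_Rintegral => q _ /=.
    rewrite expect_law_comp//; last exact: bmeas_section1 bdot.
    apply: continuous_measurable_rV => v.
    apply: (@cvgr_sum _ _ (nbhs v) (nbhs_filter v) _ _ (fun i u => u 0 i * _) (fun i => v 0 i * _)) => i.
    by apply: cvgM; [exact: coord_continuous|exact: cvg_cst].
  have b1 : bmeas (fun z : (Td * Td) * R => A * tdist z.1.1 z.1.2 ^+ 2).
    by apply: bmeasZ; apply: bmeas_comp btd; exact: measurable_fst.
  have -> : A * transport_cost gam = \int[Q]_z (A * tdist z.1.1 z.1.2 ^+ 2).
    have [_ ->] := expect_prod gam unif01 b1.
    rewrite /transport_cost -expectZ//; apply: eq_Rintegral => q _.
    exact: (esym (expect_cst _ _)).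
  have b2 : bmeas (fun z : (Td * Td) * R => a (W (z.1.1, z.2), z.1.1)).
    apply: bmeas_comp ba; apply: measurable_fun_pair; first exact: (measurableT_comp mW mseed).
    exact: (measurableT_comp measurable_fst measurable_fst).
  rewrite hWs// expect_law// -expectD// -expectD//; last exact: bmeasD.
  apply: expect_le; [exact: bmeas_comp ba|by apply: bmeasD => //; exact: bmeasD|].
  by move=> z /=; rewrite (tdC z.1.1); exact: ha.
have fw := hC w' (delta w' w) (delta_pi delta_min _ _).
have tc0 : 0 <= transport_cost gam by apply: expect_ge0 => q; exact: sqr_ge0.
have := jet_remainder_le A0 B0 C0 (normr_ge0 (t' - t)) tc0 (tdist_ge0 w' w).
have := maxi w' tt' plan'; have := htau tt'.
move: fw; rewrite (enorm_delta delta_min) ler_norml real_normK ?num_real// => /andP[_ fw].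
lra.
Qed.

End jet.
End touching.

(** * Weak limits of measures and plans *)

Section weak_limits.
Context {R : realType} {d : nat}.
Local Notation Td := (torus R d).
Local Notation Pd := (Ptorus R d).
Local Notation Rd := 'rV[R]_d.

Lemma Ptorus_cvg (I : Type) (F : set_system I) (FF : Filter F) (mu : I -> Pd) (m : Pd) :
  (forall f : Td -> R, continuous f -> \int[mu i]_x f x @[i --> F] --> \int[m]_x f x) ->
  mu i @[i --> F] --> m.
Proof.
move=> h.
have ci : continuous_integrals (mu i) @[i --> F] --> continuous_integrals m.
  apply/cvg_sup => i0 V. case: i0 => f cf.
  have /= -> := @nbhsE (initial_topology (fun g : {f : Td -> R | continuous f} -> R => g (exist _ f cf))) (continuous_integrals m).
  case=> B [[C oC <-] /= Cm] BV.
  have nC : nbhs (\int[m]_x f x) C by exact: open_nbhs_nbhs.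
  have := h f cf _ nC; rewrite /nbhs/=; apply: filterS => i /= Ci; exact: BV.
move=> A; rewrite nbhsE => -[B [[C oC <-] /= Cm]] BA.
have nC : nbhs (continuous_integrals m) C by exact: open_nbhs_nbhs.
have := ci _ nC; rewrite /nbhs/=; apply: filterS => i /= Ci; exact: BA.
Qed.

Lemma lsc_limit (T : R) (U : R -> Pd -> Td -> R) (I : Type) (F : set_system I) (FF : Filter F)
    (t : I -> R) (mu : I -> Pd) (w : I -> Td) t' mu' w' :
  lsc T U -> (forall i, 0 <= t i <= T) -> 0 <= t' <= T ->
  t i @[i --> F] --> t' -> mu i @[i --> F] --> mu' -> w i @[i --> F] --> w' ->
  forall e, 0 < e -> \forall i \near F, U t' mu' w' <= U (t i) (mu i) (w i) + e.
Proof.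
move=> lU tT t'T ct cmu cw e e0.
have := lU (t', mu', w') (U t' mu' w' - e); rewrite /= lte_fin => /(_ _)[|V].
  by rewrite ltrBlDr ltrDl.
move=> nV hV; have {}nV : within (space_time T) (nbhs ((t', mu'), w')) V.
  by rewrite (@nbhs_subspace_in _ (@space_time R d T) ((t', mu'), w') t'T).
have cq : ((t i, mu i), w i) @[i --> F] --> ((t', mu'), w').
  have c1 : (t i, mu i) @[i --> F] --> (t', mu') by exact: (cvg_pair ct cmu).
  exact: (cvg_pair c1 cw).
have := cq _ nV; rewrite /nbhs/=; apply: filterS => i /= /(_ (tT i))/hV.
by rewrite lte_fin ltrBlDr => /ltW.
Qed.

Lemma usc_limit (T : R) (U : R -> Pd -> Td -> R) (I : Type) (F : set_system I) (FF : Filter F)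
    (t : I -> R) (mu : I -> Pd) (w : I -> Td) t' mu' w' :
  usc T U -> (forall i, 0 <= t i <= T) -> 0 <= t' <= T ->
  t i @[i --> F] --> t' -> mu i @[i --> F] --> mu' -> w i @[i --> F] --> w' ->
  forall e, 0 < e -> \forall i \near F, U (t i) (mu i) (w i) <= U t' mu' w' + e.
Proof.
move=> lU tT t'T ct cmu cw e e0.
have := lsc_limit FF lU tT t'T ct cmu cw e0; apply: filterS => i; lra.
Qed.

Variables (d_gt0 : (0 < d)%N) (delta : Td -> Td -> Rd) (delta_min : minimal_difference delta).

Lemma plan_compact dY (Y : measurableType dY) (gb : probability Y R)
    (I : Type) (U : set_system I) (UU : UltraFilter U)
    (mu : I -> Pd) (G : I -> probability (Y * Td)%type R) :
  (forall i, plan_of gb (mu i) (G i)) ->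
  exists mu' G', [/\ plan_of gb mu' G', mu i @[i --> U] --> mu' &
    forall g, prefix_test dec_torus g -> \int[G i]_z g z @[i --> U] --> \int[G']_z g z].
Proof.
move=> h.
have [X [mX hX]] := young_compactness (coding_torus d_gt0 delta_min) UU (fun i => proj1 (h i)).
have mZ : measurable_fun setT (fun z : Y * R => (z.1, X z)) by exact: measurable_fun_pair.
pose G' : probability (Y * Td)%type R := law (gb \x unif01)%E mZ.
pose mu' : Pd := law G' measurable_snd.
have cG g : prefix_test dec_torus g -> \int[G i]_z g z @[i --> U] --> \int[G']_z g z.
  by move=> tg; rewrite expect_law; [exact: hX|case: tg].
have plan' : plan_of gb mu' G'.
  split=> A mA; last by rewrite lawE setTX.
  apply: probability_eq => //; first exact: measurableX.
  rewrite -!expect_indic//; last exact: measurableX.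
  have b1 : bmeas (\1_(A `*` setT) : Y * Td -> R) by apply: bmeas_indic; exact: measurableX.
  rewrite expect_law//; have [_ ->] := expect_prod gb unif01 (bmeas_comp mZ b1).
  apply: eq_Rintegral => y _.
  transitivity (\int[@unif01 R]_u (\1_A y : R)); last exact: expect_cst.
  apply: eq_Rintegral => u _.
  have E : ((y, X (y, u)) \in A `*` [set: Td]) = (y \in A) by apply/idP/idP; rewrite !inE//= => -[].
  exact: (congr1 (fun b : bool => b%:R : R) E).
exists mu', G'; split => //; apply: Ptorus_cvg => f cf.
have [bdf df] := digital_continuous d_gt0 delta_min cf.
have bf : bmeas f by split; first exact: continuous_measurable_torus.
rewrite (_ : (fun i => _) = (fun i => \int[G i]_z f z.2)); last first.
  by apply/funext => i; rewrite (expect_snd (proj2 (h i)) bf).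
rewrite -(expect_snd (proj2 plan') bf).
exact: cG (prefix_test_snd Y bf (conj bdf df)).
Qed.

End weak_limits.

Section joint_measurability.
Context {R : realType} {d : nat}.
Local Notation Td := (torus R d).
Local Notation Rd := 'rV[R]_d.
Variables (delta : Td -> Td -> Rd) (delta_min : minimal_difference delta).

(** The sigma-algebra on the domain is a product one; F is a continuous function on R^(d + d)
    composed with the measurable lift (x, z) |-> (delta x 0, z). *)
Lemma measurable_torus_space (F : Td * Rd -> R) :
  continuous (fun v : 'rV[R]_(d + d) => F (\pi_Td (lsubmx v), rsubmx v)) ->
  measurable_fun setT F.
Proof.
move=> cF; pose E (z : Td * Rd) : 'rV[R]_(d + d) := row_mx (delta z.1 0) z.2.
have mE : measurable_fun setT E.
  apply: measurable_rV => i; rewrite /E.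
  under [X in measurable_fun _ X]eq_fun do rewrite mxE.
  case: (fintype.split i) => j.
    apply: (measurableT_comp (measurable_coord j)).
    apply: (measurableT_comp (measurable_delta delta_min) (g := fun z : Td * Rd => (z.1, 0 : Td))).
    exact: measurable_fun_pair.
  exact: (measurableT_comp (measurable_coord j) measurable_snd).
have := measurableT_comp (continuous_measurable_rV cF) mE.
congr measurable_fun; apply/funext => -[x z] /=.
by rewrite row_mxKl row_mxKr (delta_pi delta_min) subr0.
Qed.

End joint_measurability.

(** * The potential of the cost and its gradient *)

Section potential.
Context {R : realType} {d : nat}.
Local Notation Td := (torus R d).
Local Notation Rd := 'rV[R]_d.
Local Notation twopi := ((pi : R) *+ 2).

(* With z = ((x, y), x'), a function of x' - x majorizing the variation of
   x' |-> cost (x' - y) to first order. *)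
Definition pot (z : (Td * Td) * Td) : R :=
  \sum_i (sn (z.1.1 - z.1.2) i * sn (z.2 - z.1.1) i + 4 * (1 - cs (z.2 - z.1.1) i)).

(** The gradient of [pot] in the moved point. *)
Definition potg (z : (Td * Td) * Td) : Rd :=
  \row_i (twopi * (sn (z.1.1 - z.1.2) i * cs (z.2 - z.1.1) i + 4 * sn (z.2 - z.1.1) i)).

(** In each coordinate, with P = x' - x and Q = y' - y, the terms beyond first order are at most 3
    (1 - cos P) + 3 (1 - cos Q). The coefficient 4 in [pot] thus leaves one displacement cost to
    spare on each side; this surplus will localize the touching points. *)
Lemma cost_glue (x y x' y' : Td) : cost (x' - y') <= cost (x - y)
  + (pot ((x, y), x') - cost (x' - x)) + (pot ((y, x), y') - cost (y' - y)).
Proof.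
rewrite /cost /pot -!sumrB -!big_split/=; apply: ler_sum => i _.
have -> : x' - y' = (x - y) + ((x' - x) - (y' - y)).
  by rewrite opprB addrCA !subrKA.
have -> : sn (y - x) i = - sn (x - y) i by rewrite -opprB snN.
move: (x - y) (x' - x) (y' - y) => C P Q; rewrite csD csB snB.
have := cs2Dsn2 C i; have := cs2Dsn2 P i; have := cs2Dsn2 Q i.
have := cs_bound C i; have := cs_bound P i; have := cs_bound Q i.
have := sn_bound C i; have := sn_bound P i; have := sn_bound Q i.
rewrite !ler_norml; move: (cs C i) (sn C i) (cs P i) (sn P i) (cs Q i) (sn Q i).
move=> c s cp sp cq sq /andP[q1 q2] /andP[p1 p2] /andP[s1 s2] /andP[cq1 cq2] /andP[cp1 cp2] /andP[c1 c2] hq hp hc.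
pose u : R := 1 - (cp * cq + sp * sq).
have u2 : u <= 2 * (1 - cp) + 2 * (1 - cq).
  have := sqr_ge0 (cp + cq - 2); have := sqr_ge0 (sp + sq); rewrite /u; nra.
have u0 : 0 <= u by have := sqr_ge0 (cp - cq); have := sqr_ge0 (sp - sq); rewrite /u; nra.
have h1 : c * u <= u by rewrite ler_piMl.
have h2 : s * (- sp * (1 - cq) + sq * (1 - cp)) <= (1 - cq) + (1 - cp).
  have a1 : s * - sp <= 1 by nra.
  have a2 : s * sq <= 1 by nra.
  have b1 : 0 <= 1 - cq by lra.
  have b2 : 0 <= 1 - cp by lra.
  rewrite mulrDr mulrA mulrA lerD//; rewrite -[leRHS]mul1r ler_wpM2r//.
rewrite /u in h1 u2; lra.
Qed.

(** The quadratic bound holds for all x, as the expansion of [pot] must hold for every displacement;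
    the cubic bound serves for |x| <= 2 only. *)
Lemma sin_sub_le2 (x : R) : `|x - sin x| <= x ^+ 2.
Proof.
have h := sin_sub_le x; have [x2|x2] := leP `|x| 2.
  rewrite (le_trans h)// exprSr -[X in _ <= X]real_normK ?num_real//.
  by rewrite ler_pdivrMr// ler_wpM2l// exprn_ge0.
rewrite (le_trans (ler_normB _ _))// -[X in _ <= X]real_normK ?num_real//.
have := sin_max x; nra.
Qed.

Variables (delta : Td -> Td -> Rd) (delta_min : minimal_difference delta).

Lemma pot_taylor (q : Td * Td) (x x' : Td) :
  pot (q, x') <= pot (q, x) + dot (potg (q, x)) (delta x' x)
     + 8 * twopi ^+ 2 * tdist x' x ^+ 2.
Proof.
rewrite -(enorm_delta delta_min) enorm_sqr /dot mulr_sumr /pot -!big_split/=.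
apply: ler_sum => i _; rewrite mxE /=.
have -> : x' - q.1 = (x - q.1) + \pi_Td (delta x' x).
  by rewrite (delta_pi delta_min) [RHS]addrC subrKA.
move: (q.1 - q.2) (x - q.1) => Q P; rewrite snD csD sn_pi cs_pi; move: (delta x' x 0 i) => v.
have := cs2Dsn2 P i; have := sn_bound Q i; have := cs_bound P i; have := sn_bound P i.
move: (sn Q i) (sn P i) (cs P i) => s sp cp.
have hv : (twopi * v) ^+ 2 = twopi ^+ 2 * (v * v) by rewrite exprMn -expr2.
have := one_sub_cos_le (twopi * v); have := one_sub_cos_ge0 (twopi * v).
have := sin_sub_le2 (twopi * v).
rewrite !ler_norml -(mulrA 8) -hv.
have -> : twopi * (s * cp + 4 * sp) * v = (s * cp + 4 * sp) * (twopi * v) by ring.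
move: (twopi * v) => h /andP[k1 k2] c0 c1 /andP[p1 p2] /andP[q1 q2] /andP[s1 s2] hp.
pose r : R := h - sin h; pose u : R := 1 - cos h.
have -> : sin h = h - r by rewrite /r; lra.
have -> : cos h = 1 - u by rewrite /u; lra.
have r1 : `|r| <= h ^+ 2 by rewrite ler_norml k1.
have a1 : - (s * sp * u) <= u.
  have : - (s * sp) <= 1 by nra.
  by move=> /(ler_wpM2r c0); rewrite -/u; lra.
have a2 : cp * u <= u by rewrite ler_piMl.
have hh : 0 <= h ^+ 2 by exact: sqr_ge0.
have a3 : - (s * cp * r) <= h ^+ 2.
  have : `|s * cp * r| <= h ^+ 2.
    rewrite normrM; have : `|s * cp| <= 1 by rewrite ler_norml; apply/andP; split; nra.
    move=> /(ler_wpM2r (normr_ge0 r)) /le_trans; apply; rewrite mul1r; exact: r1.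
  by rewrite ler_norml => /andP[? ?]; lra.
have a4 : - (sp * r) <= h ^+ 2.
  have : `|sp * r| <= h ^+ 2.
    rewrite normrM; have : `|sp| <= 1 by rewrite ler_norml; apply/andP; split; lra.
    move=> /(ler_wpM2r (normr_ge0 r)) /le_trans; apply; rewrite mul1r; exact: r1.
  by rewrite ler_norml => /andP[? ?]; lra.
rewrite -/u in c1 c0; lra.
Qed.

Lemma bmeas_csB i : bmeas (fun q : Td * Td => cs (q.1 - q.2) i : R).
Proof.
under [X in bmeas X]eq_fun do rewrite csB.
by apply: bmeasD; apply: bmeasM; (apply: (bmeas_comp _ (bmeas_cs i)) || apply: (bmeas_comp _ (bmeas_sn i))).
Qed.

Lemma bmeas_snB i : bmeas (fun q : Td * Td => sn (q.1 - q.2) i : R).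
Proof.
under [X in bmeas X]eq_fun do rewrite snB.
by apply: bmeasB; apply: bmeasM; (apply: (bmeas_comp _ (bmeas_cs i)) || apply: (bmeas_comp _ (bmeas_sn i))).
Qed.

Lemma bmeas_costB : bmeas (fun q : Td * Td => cost (q.1 - q.2) : R).
Proof.
by apply: bmeas_sum => i; apply: bmeasB; [exact: bmeas_cst|exact: bmeas_csB].
Qed.

Lemma measurable_displacement : measurable_fun setT (fun z : (Td * Td) * Td => (z.2, z.1.1)).
Proof. by apply: measurable_fun_pair => //; exact: (measurableT_comp measurable_fst measurable_fst). Qed.

Lemma bmeas_pot : bmeas (pot : _ -> R).
Proof.
apply: bmeas_sum => i; apply: bmeasD.
  apply: bmeasM; first exact: (bmeas_comp measurable_fst (bmeas_snB i)).
  exact: (bmeas_comp measurable_displacement (bmeas_snB i)).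
apply: bmeasZ; apply: bmeasB; first exact: bmeas_cst.
exact: (bmeas_comp measurable_displacement (bmeas_csB i)).
Qed.

Lemma measurable_potg : measurable_fun setT (potg : _ -> Rd).
Proof.
apply: measurable_rV => i; rewrite [X in measurable_fun _ X](_ : _ = fun z : (Td * Td) * Td =>
  twopi * (sn (z.1.1 - z.1.2) i * cs (z.2 - z.1.1) i + 4 * sn (z.2 - z.1.1) i)); last first.
  by apply/funext => z; rewrite mxE.
have h1 : bmeas (fun z : (Td * Td) * Td => sn (z.1.1 - z.1.2) i : R).
  exact: (bmeas_comp measurable_fst (bmeas_snB i)).
have h2 := bmeas_comp measurable_displacement (bmeas_snB i).
have h3 := bmeas_comp measurable_displacement (bmeas_csB i).
by have [] := bmeasZ twopi (bmeasD (bmeasM h1 h3) (bmeasZ 4 h2)).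
Qed.

Lemma enorm_potg_le z : enorm (potg z) <= d%:R * (5 * twopi).
Proof.
apply: enorm_coords_le => i; have tp : 0 <= twopi by rewrite mulrn_wge0 ?pi_ge0.
rewrite mxE normrM mulrC (ger0_norm tp).
rewrite ler_wpM2r// (le_trans (ler_normD _ _))//.
rewrite !normrM (ger0_norm (_ : 0 <= 4))//.
have := sn_bound (z.1.1 - z.1.2) i; have := cs_bound (z.2 - z.1.1) i; have := sn_bound (z.2 - z.1.1) i.
move: `|sn (z.2 - z.1.1) i| `|cs (z.2 - z.1.1) i| `|sn (z.1.1 - z.1.2) i| (normr_ge0 (cs (z.2 - z.1.1) i)) => a b c ? ? ? ?; nra.
Qed.

Lemma prefix_test_pot (d_gt0 : (0 < d)%N) : prefix_test dec_torus (pot : (Td * Td) * Td -> R).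
Proof.
have dc i : bmeas (fun x : Td => cs x i : R) /\ digital dec_torus (fun x : Td => cs x i : R).
  by split; [exact: bmeas_cs|apply: (digital_continuous d_gt0 delta_min) => ?; exact: continuous_cs].
have ds i : bmeas (fun x : Td => sn x i : R) /\ digital dec_torus (fun x : Td => sn x i : R).
  by split; [exact: bmeas_sn|apply: (digital_continuous d_gt0 delta_min) => ?; exact: continuous_sn].
have b1 i : bmeas (fun q : Td * Td => cs q.1 i : R) by exact: (bmeas_comp measurable_fst (bmeas_cs i)).
have b2 i : bmeas (fun q : Td * Td => sn q.1 i : R) by exact: (bmeas_comp measurable_fst (bmeas_sn i)).
rewrite (_ : pot = fun z : (Td * Td) * Td => \sum_i (
  (sn (z.1.1 - z.1.2) i * cs z.1.1 i - 4 * sn z.1.1 i) * sn z.2 i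
  + ((- sn (z.1.1 - z.1.2) i * sn z.1.1 i - 4 * cs z.1.1 i) * cs z.2 i + 4))); last first.
  apply/funext => -[q x]; apply: eq_bigr => i _ /=.
  by move: (q.1 - q.2) => Q; rewrite snB csB; ring.
apply: prefix_test_sum => i; have [c1 c2] := dc i; have [s1 s2] := ds i.
have f1 : bmeas (fun q : Td * Td => sn (q.1 - q.2) i * cs q.1 i - 4 * sn q.1 i : R).
  by apply: bmeasB; [apply: bmeasM => //; exact: bmeas_snB|exact: bmeasZ].
have f2 : bmeas (fun q : Td * Td => - sn (q.1 - q.2) i * sn q.1 i - 4 * cs q.1 i : R).
  by apply: bmeasB; [apply: bmeasM => //; apply: bmeasN; exact: bmeas_snB|exact: bmeasZ].
apply: prefix_testD; first exact: (prefix_testM f1 s1 s2).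
apply: prefix_testD; first exact: (prefix_testM f2 c1 c2).
exact: prefix_test_cst.
Qed.

End potential.

Section touching_maximum.
Context {R : realType} {d : nat} (d_gt0 : (0 < d)%N).
Local Notation Td := (torus R d).
Local Notation Pd := (Ptorus R d).
Local Notation Rd := 'rV[R]_d.
Variables (delta : Td -> Td -> Rd) (delta_min : minimal_difference delta) (T : R).

Lemma ultra_segment (I : Type) (U : set_system I) (UU : UltraFilter U) (t : I -> R) :
  (forall i, 0 <= t i <= T) -> exists2 t', 0 <= t' <= T & t i @[i --> U] --> t'.
Proof.
move=> h; have [] := @ultra_cvg_compact _ _ UU R `[0, T]%classic t; first exact: segment_compact.
  by move=> i /=; rewrite in_itv/=.
by move=> p /=; rewrite in_itv/= => pT tp; exists p.
Qed.

Lemma touching_max dY (Y : measurableType dY) (gb : probability Y R) (mu0 : Pd)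
    (G0 : probability (Y * Td)%type R) (G : R -> Pd -> Td -> R) (tau : R -> R)
    (a : Y * Td -> R) (f : Td -> R) :
  0 <= T -> plan_of gb mu0 G0 -> usc T G -> (exists M, forall t mu w, 0 <= t <= T -> `|G t mu w| <= M) ->
  continuous tau -> prefix_test dec_torus a -> continuous f ->
  exists t mu Gam w, [/\ 0 <= t <= T, plan_of gb mu Gam &
    forall t' mu' Gam' w', 0 <= t' <= T -> plan_of gb mu' Gam' ->
    G t' mu' w' - tau t' - \int[Gam']_z a z - f w' <= G t mu w - tau t - \int[Gam]_z a z - f w].
Proof.
move=> T0 plan0 uG [M hM] ctau ta cf.
pose X := {q : R * Pd * probability (Y * Td)%type R * Td | 0 <= q.1.1.1 <= T /\ plan_of gb q.1.1.2 q.1.2}.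
pose Phi (q : X) := let: exist (t, mu, Gam, w) _ := q in G t mu w - tau t - \int[Gam]_z a z - f w.
have x0 : X by exists (0, mu0, G0, 0); split => //=; rewrite lexx.
have [ba _] := ta; have [Ma hMa] := proj2 ba.
have [U [UU oU]] := nat_ultrafilter.
have bdf : exists Mf, forall w, `|f w| <= Mf.
  by have [[Mf hf] _] := digital_continuous d_gt0 delta_min cf; exists Mf.
have [Mf hf] := bdf.
have ctau' : {within `[0, T], continuous tau} by exact: continuous_subspaceT.
have [tm tmT htm] := EVT_min T0 ctau'.
have [] := @ultra_max _ U UU oU X Phi x0.
- exists (M - tau tm + Ma + Mf) => -[[[[t mu] Gam] w] [/= tT pl]].
  have := hM t mu w tT; have := hf w; have /= := htm t.
  rewrite in_itv/= => /(_ tT).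
  have := expect_bound Gam ba hMa.
  rewrite !ler_norml => /andP[? _] ? /andP[? _] /andP[_ ?]; lra.
- move=> x.
  pose t n := (sval (x n)).1.1.1; pose mu n := (sval (x n)).1.1.2.
  pose Gam n := (sval (x n)).1.2; pose w n := (sval (x n)).2.
  have tT n : 0 <= t n <= T by have [] := svalP (x n).
  have pl n : plan_of gb (mu n) (Gam n) by have [] := svalP (x n).
  have PhiE n : Phi (x n) = G (t n) (mu n) (w n) - tau (t n) - \int[Gam n]_z a z - f (w n).
    by rewrite /t /mu /Gam /w; case: (x n) => -[[[]]].
  have [t' t'T ct] := ultra_segment UU tT.
  have [mu' [Gam' [pl' cmu cGam]]] := plan_compact d_gt0 delta_min UU pl.
  have [w' cw] := torus_ultra UU w.
  exists (exist _ (t', mu', Gam', w') (conj t'T pl')) => e e0.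
  have e4 : 0 < e / 4 by rewrite divr_gt0.
  have h1 : \forall n \near U, G (t n) (mu n) (w n) <= G t' mu' w' + e / 4.
    exact: (usc_limit _ uG tT t'T ct cmu cw e4).
  have h2 : \forall n \near U, `|\int[Gam']_z a z - \int[Gam n]_z a z| <= e / 4.
    by move/cvgrPdist_le : (cGam _ ta) => /(_ _ e4).
  have ct' : tau (t n) @[n --> U] --> tau t' by exact: continuous_cvg (ctau _) ct.
  have h3 : \forall n \near U, `|tau t' - tau (t n)| <= e / 4.
    by move/cvgrPdist_le : ct' => /(_ _ e4).
  have cf' : f (w n) @[n --> U] --> f w' by exact: continuous_cvg (cf _) cw.
  have h4 : \forall n \near U, `|f w' - f (w n)| <= e / 4.
    by move/cvgrPdist_le : cf' => /(_ _ e4).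
  near=> n.
  have i1 : G (t n) (mu n) (w n) <= G t' mu' w' + e / 4 by near: n.
  have i2 : `|\int[Gam']_z a z - \int[Gam n]_z a z| <= e / 4 by near: n.
  have i3 : `|tau t' - tau (t n)| <= e / 4 by near: n.
  have i4 : `|f w' - f (w n)| <= e / 4 by near: n.
  rewrite PhiE /=; move: i1 i2 i3 i4; rewrite !ler_norml => ? /andP[? ?] /andP[? ?] /andP[? ?]; lra.
- move=> [[[[t mu] Gam] w] [/= tT pl]] hx; exists t, mu, Gam, w; split => // t' mu' Gam' w' t'T pl'.
  exact: (hx (exist _ (t', mu', Gam', w') (conj t'T pl'))).
Unshelve. all: by end_near. Qed.

End touching_maximum.

(** Equality of terms, by irrelevance of the packed proofs: it lets a jet be recovered after two
    negations. *)
Lemma eq_probability (R : realType) d (S : measurableType d) (P Q : probability S R) :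
  P = Q :> (set S -> \bar R) -> P = Q.
Proof.
move: P Q => [p cp] [q cq] /= pq; move: cp cq; rewrite -{}pq => cp cq.
congr (Probability.Pack _); move: cp cq.
move=> [[a b] [c] [e] [f] [g] [h] [i]] [[a' b'] [c'] [e'] [f'] [g'] [h'] [i']].
rewrite (Prop_irrelevance a a') (Prop_irrelevance b b') (Prop_irrelevance c c').
rewrite (Prop_irrelevance e e') (Prop_irrelevance f f') (Prop_irrelevance g g').
by rewrite (Prop_irrelevance h h') (Prop_irrelevance i i').
Qed.

(** The change of variables is made on positive and negative parts, without integrability: the
    Hamiltonian is not bounded in the momentum. *)
Lemma expect_law_meas (R : realType) d (S : measurableType d) d' (S' : measurableType d')
    (P : probability S R) (h : S -> S') (mh : measurable_fun setT h) (f : S' -> R) :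
  measurable_fun setT f -> \int[law P mh]_x f x = \int[P]_x f (h x).
Proof.
move=> /measurable_EFinP mf.
have key g : measurable_fun setT g -> (forall x, 0 <= g x)%E ->
    (\int[law P mh]_x g x = \int[P]_x g (h x))%E.
  move=> mg g0; have := ge0_integral_pushforward mh P measurableT mg (fun x _ => g0 x).
  by rewrite preimage_setT.
rewrite /Rintegral integralE [in RHS]integralE; congr (fine (_ - _)%E).
  have E := key _ (measurable_funepos mf) (funepos_ge0 _).
  by rewrite [LHS]E; apply: eq_integral => x _; rewrite !funeposE.
have E := key _ (measurable_funeneg mf) (funeneg_ge0 _).
by rewrite [LHS]E; apply: eq_integral => x _; rewrite !funenegE.
Qed.

Lemma opp_measureK (R : realType) (d : nat) (nu : pprobability 'rV[R]_d R) :
  opp_measure (opp_measure nu) = nu.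
Proof.
apply: eq_probability; apply/funext => A; congr (nu _).
by apply/seteqP; split => z /=; rewrite opprK.
Qed.

(** * Viscosity inequalities at touching points *)

Section viscosity_inequalities.
Context {R : realType} {d : nat} (d_gt0 : (0 < d)%N).
Local Notation Td := (torus R d).
Local Notation Pd := (Ptorus R d).
Local Notation Rd := 'rV[R]_d.
Local Notation twopi := ((pi : R) *+ 2).
Variables (delta : Td -> Td -> Rd) (delta_min : minimal_difference delta) (T : R) (T0 : 0 <= T).

(** A translation only changes the phases, so the translate is again an integral trigonometric
    sum. *)
Lemma continuous_tsum_shift (l : seq (mode (R := R) (d := d))) (e : Td) : integral_modes l ->
  continuous (fun w : Td => tsum l (w - e)).
Proof.
move=> il; pose l' := [seq (m.1, m.2 - twopi * dot m.1.2 (repr e : Rd)) | m <- l].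
have il' : integral_modes l' by move=> _ /mapP[m ml ->] i; exact: (il m ml i).
rewrite (_ : (fun w => _) = tsum l'); first exact: continuous_tsum.
apply/funext => w; rewrite -[w]reprK -[X in _ - X]reprK -piB !tsum_pi//.
rewrite /trig big_map; apply: eq_bigr => m _; congr (_ * cos _).
by rewrite /phase/= dotDr (dotC _ (- _)) dotNl (dotC (repr e)); ring.
Qed.

Lemma touching (gb : probability (Td * Td)%type R) (mu0 : Pd)
    (G0 : probability ((Td * Td) * Td)%type R) (G : R -> Pd -> Td -> R)
    (b0 b1 b2 k : R) l (e : Td) :
  plan_of gb mu0 G0 -> usc T G ->
  (exists M, forall t mu w, 0 <= t <= T -> `|G t mu w| <= M) ->
  0 <= b2 -> 0 <= k -> integral_modes l ->
  let tau s := b0 + b1 * s + b2 * s ^+ 2 in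
  exists t mu Gam w psi p X, [/\ 0 <= t <= T, plan_of gb mu Gam,
    forall t' mu' Gam' w', 0 <= t' <= T -> plan_of gb mu' Gam' ->
      G t' mu' w' - tau t' - k * \int[Gam']_z pot z - tsum l (w' - e) <=
      G t mu w - tau t - k * \int[Gam]_z pot z - tsum l (w - e),
    superjet delta T G t mu w (b1 + 2 * b2 * t, psi, p, X) /\ \tr X = tlap l (w - e) &
    forall F : Td * Rd -> R, measurable_fun setT F ->
      bdd (fun z : (Td * Td) * Td => F (z.2, k *: potg z)) ->
      \int[mu]_x \int[psi x]_z F (x, z) = \int[Gam]_z F (z.2, k *: potg z)].
Proof.
move=> pl0 uG bG b20 k0 il tau.
have ctau : continuous tau.
  move=> s; apply: cvgD; first by apply: cvgD; [exact: cvg_cst|apply: cvgM; [exact: cvg_cst|exact: cvg_id]].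
  by apply: cvgM; [exact: cvg_cst|exact: exprn_continuous].
have ta : prefix_test dec_torus (fun z : (Td * Td) * Td => k * pot z).
  have [bp hp] := prefix_test_pot delta_min d_gt0.
  split; first exact: bmeasZ.
  move=> x x0; have k1 : 0 < k + 1 by rewrite ltr_wpDl.
  have [n hn] := hp (x / (k + 1)) (divr_gt0 x0 k1); exists n => y c c' E.
  rewrite -mulrBr normrM ger0_norm//.
  apply: (@le_trans _ _ (k * (x / (k + 1)))); first by rewrite ler_wpM2l// hn.
  by rewrite mulrCA ler_piMr ?(ltW x0)// ler_pdivrMr// mul1r lerDl.
have cf : continuous (fun w : Td => tsum l (w - e)).
  exact: continuous_tsum_shift.
have [t [mu [Gam [w [tT pl hmax]]]]] := touching_max d_gt0 delta_min T0 pl0 uG bG ctau ta cf.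
have tl := taylor2_shift (taylor2_tsum (w - e) il).
pose g (z : (Td * Td) * Td) := k *: potg z.
have mg : measurable_fun setT g.
  apply: measurable_rV => i.
  rewrite [X in measurable_fun _ X](_ : _ = fun z : (Td * Td) * Td => k * potg z 0 i).
    apply: measurable_funM; first exact: measurable_cst.
    exact: (measurableT_comp (measurable_coord i) measurable_potg).
  by apply/funext => z; rewrite mxE.
have bg z : enorm (g z) <= k * (d%:R * (5 * twopi)).
  by rewrite enormZ ger0_norm// ler_wpM2l// enorm_potg_le.
have A0 : 0 <= k * (8 * twopi ^+ 2) by rewrite mulr_ge0// mulr_ge0// sqr_ge0.
have ha (y : Td * Td) (x x' : Td) : k * pot (y, x') <= k * pot (y, x) + dot (g (y, x)) (delta x' x)
    + k * (8 * twopi ^+ 2) * tdist x' x ^+ 2.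
  by rewrite dotZl -mulrA -!mulrDr ler_wpM2l//; exact: pot_taylor.
have htau t' : t <= t' <= T -> tau t' <= tau t + (b1 + 2 * b2 * t) * (t' - t) + b2 * (t' - t) ^+ 2.
  by move=> _; rewrite /tau le_eqVlt; apply/orP; left; apply/eqP; ring.
have maxi t' mu' Gam' w' : t <= t' <= T -> plan_of gb mu' Gam' ->
    G t' mu' w' - tau t' - \int[Gam']_z (k * pot z) - tsum l (w' - e) <=
    G t mu w - tau t - \int[Gam]_z (k * pot z) - tsum l (w - e).
  move=> /andP[tt t'T]; apply: hmax; rewrite t'T andbT; have /andP[t0 _] := tT.
  exact: le_trans tt.
have cY := coding_prod (coding_torus d_gt0 delta_min) (coding_torus d_gt0 delta_min).
have [ba _] := ta.
have [psi [hjet hF]] := touching_jet delta_min cY A0 b20 ba mg bg ha htau tl pl maxi.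
exists t, mu, Gam, w, psi, (trig_grad l (repr (w - e))), (trig_hess l (repr (w - e))); split => //.
  move=> t' mu' Gam' w' t'T pl'; have := hmax t' mu' Gam' w' t'T pl'.
  by rewrite !(expectZ _ _ bmeas_pot).
by split => //; rewrite trig_hess_tr.
Qed.

Variables (sigma : R -> R) (H : R -> Td -> Pd -> Rd -> R).
Hypothesis H_continuous :
  {within [set q : R * Td * Pd * Rd | 0 <= q.1.1.1],
    continuous (fun q => H q.1.1.1 q.1.1.2 q.1.2 q.2)}.
Variables (C : R) (C_gt0 : 0 < C).
Hypothesis H_growth : forall t x mu p, 0 <= t <= T ->
    `|H t x mu p| <= C * (1 + enorm p ^+ 2).

Lemma H_measurable t mu : 0 <= t -> measurable_fun setT (fun q : Td * Rd => H t q.1 mu q.2).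
Proof.
move=> t0; apply: (measurable_torus_space delta_min) => v /=.
pose D : set (R * Td * Pd * Rd) := [set q | 0 <= q.1.1.1].
pose e (v : 'rV[R]_(d + d)) : R * Td * Pd * Rd := (t, \pi_Td (lsubmx v), mu, rsubmx v).
have c1 : rsubmx u @[u --> v] --> rsubmx v by exact: continuous_rsubmx.
have c2 : \pi_Td (lsubmx u) @[u --> v] --> (\pi_Td (lsubmx v) : Td).
  apply: (@continuous_comp _ _ _ (lsubmx : 'rV[R]_(d + d) -> Rd) (\pi_Td : Rd -> Td)).
    exact: continuous_lsubmx.
  exact: pi_continuous.
have ct : t @[u --> v] --> t by apply: (@cvg_cst _ _ _ _ (nbhs_filter v)).
have cmu : mu @[u --> v] --> mu by apply: (@cvg_cst _ _ _ _ (nbhs_filter v)).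
have FF := nbhs_filter v.
have c3 : (t, (\pi_Td (lsubmx u) : Td)) @[u --> v] --> (t, (\pi_Td (lsubmx v) : Td)) by exact: cvg_pair ct c2.
have c4 : (t, (\pi_Td (lsubmx u) : Td), mu) @[u --> v] --> (t, (\pi_Td (lsubmx v) : Td), mu) by exact: cvg_pair c3 cmu.
have ce : e u @[u --> v] --> e v by exact: cvg_pair c4 c1.
move=> A hA; have := @H_continuous (e v) A hA; rewrite /nbhs/=.
have Dv : D (e v) by [].
rewrite -(nbhs_subspace_in Dv) => /ce; rewrite /nbhs/=.
by apply: filterS => u /(_ t0).
Qed.

Lemma H_plan_bdd t mu (a : R) : 0 <= t <= T ->
  bdd (fun z : (Td * Td) * Td => H t z.2 mu (a *: potg z)).
Proof.
move=> tT; exists (C * (1 + (`|a| * (d%:R * (5 * twopi))) ^+ 2)) => z.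
rewrite (le_trans (H_growth _ _ _ tT))// ler_pM2l// lerD2l.
have le : enorm (a *: potg z) <= `|a| * (d%:R * (5 * twopi)) by rewrite enormZ ler_wpM2l// enorm_potg_le.
by rewrite ler_pXn2r ?nnegrE ?enorm_ge0// (le_trans _ le) ?enorm_ge0.
Qed.

Lemma H_plan_bmeas t mu (a : R) : 0 <= t <= T ->
  bmeas (fun z : (Td * Td) * Td => H t z.2 mu (a *: potg z)).
Proof.
move=> tT; split; last exact: H_plan_bdd.
have /andP[t0 _] := tT.
apply: (measurableT_comp (H_measurable mu t0) (g := fun z : (Td * Td) * Td => (z.2, a *: potg z))).
apply: measurable_fun_pair => //; apply: measurable_rV => i.
rewrite [X in measurable_fun _ X](_ : _ = fun z : (Td * Td) * Td => a * potg z 0 i).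
  apply: measurable_funM; first exact: measurable_cst.
  exact: (measurableT_comp (measurable_coord i) measurable_potg).
by apply/funext => z; rewrite mxE.
Qed.

Section subsolution.
Variables (U : R -> Pd -> Td -> R) (U_sub : viscosity_subsolution delta T sigma H U)
  (U_bounded : exists M, forall t mu w, 0 <= t <= T -> `|U t mu w| <= M).

Lemma subsolution_touching (gb : probability (Td * Td)%type R) (mu0 : Pd)
    (G0 : probability ((Td * Td) * Td)%type R) (b0 b1 b2 k : R) l (e : Td) :
  plan_of gb mu0 G0 -> 0 <= b2 -> 0 <= k -> integral_modes l ->
  let tau s := b0 + b1 * s + b2 * s ^+ 2 in
  exists t mu Gam w, [/\ 0 <= t <= T, plan_of gb mu Gam,
    forall t' mu' Gam' w', 0 <= t' <= T -> plan_of gb mu' Gam' ->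
      U t' mu' w' - tau t' - k * \int[Gam']_z pot z - tsum l (w' - e) <=
      U t mu w - tau t - k * \int[Gam]_z pot z - tsum l (w - e) &
    t < T -> - (b1 + 2 * b2 * t) + \int[Gam]_z H t z.2 mu (k *: potg z)
      - sigma t ^+ 2 / 2 * tlap l (w - e) <= 0].
Proof.
move=> pl0 b20 k0 il tau; have [uU hU] := U_sub.
have [t [mu [Gam [w [psi [p [X [tT pl hmax [hj htr] hF]]]]]]]] :=
  touching b0 b1 e pl0 uU U_bounded b20 k0 il.
exists t, mu, Gam, w; split => // tT'.
have /andP[t0 _] := tT.
have t0T : 0 <= t < T by rewrite t0.
have := hU _ _ _ _ t0T hj; rewrite /jet_operator/= htr /Hbar.
by rewrite (hF (fun q => H t q.1 mu q.2))//; [exact: H_measurable|exact: H_plan_bdd].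
Qed.

End subsolution.

Section supersolution.
Variables (V : R -> Pd -> Td -> R) (V_super : viscosity_supersolution delta T sigma H V)
  (V_bounded : exists M, forall t mu w, 0 <= t <= T -> `|V t mu w| <= M).

(** - V is touched from above and the jet is negated: momentum, time slope and Laplacian change
    sign, which explains - k in front of [potg]. *)
Lemma supersolution_touching (gb : probability (Td * Td)%type R) (mu0 : Pd)
    (G0 : probability ((Td * Td) * Td)%type R) (b0 b1 b2 k : R) l (e : Td) :
  plan_of gb mu0 G0 -> 0 <= b2 -> 0 <= k -> integral_modes l ->
  let tau s := b0 + b1 * s + b2 * s ^+ 2 in
  exists t mu Gam w, [/\ 0 <= t <= T, plan_of gb mu Gam,
    forall t' mu' Gam' w', 0 <= t' <= T -> plan_of gb mu' Gam' ->
      - V t' mu' w' - tau t' - k * \int[Gam']_z pot z - tsum l (w' - e) <=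
      - V t mu w - tau t - k * \int[Gam]_z pot z - tsum l (w - e) &
    t < T -> 0 <= (b1 + 2 * b2 * t) + \int[Gam]_z H t z.2 mu (- k *: potg z)
      + sigma t ^+ 2 / 2 * tlap l (w - e)].
Proof.
move=> pl0 b20 k0 il tau; have [lV hV] := V_super.
have uV : usc T (fun t mu w => - V t mu w).
  by rewrite /usc; under eq_fun do under eq_fun do under eq_fun do rewrite opprK.
have bV : exists M, forall t mu w, 0 <= t <= T -> `|- V t mu w| <= M.
  by have [M hM] := V_bounded; exists M => *; rewrite normrN; exact: hM.
have [t [mu [Gam [w [psi [p [X [tT pl hmax [hj htr] hF]]]]]]]] :=
  touching b0 b1 e pl0 uV bV b20 k0 il.
exists t, mu, Gam, w; split => // tT'.
have /andP[t0 _] := tT.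
have t0T : 0 <= t < T by rewrite t0.
pose j : jet R d := neg_jet (b1 + 2 * b2 * t, psi, p, X).
have ppE : (fun x => opp_measure (opp_measure (psi x))) = psi.
  exact: (functional_extensionality_dep (fun x => opp_measureK (psi x))).
have hj' : subjet delta T V t mu w j.
  have jE : neg_jet j = (b1 + 2 * b2 * t, psi, p, X) by rewrite /j /neg_jet !opprK ppE.
  by rewrite -jE in hj.
have := hV _ _ _ _ t0T hj'; rewrite /jet_operator/= /j /neg_jet opprK.
rewrite raddfN/= htr mulrN opprK /Hbar.
rewrite (_ : \int[mu]_x _ = \int[Gam]_z H t z.2 mu (- k *: potg z))//.
have mH : measurable_fun setT (fun q : Td * Rd => H t q.1 mu (- q.2)).
  apply: (measurableT_comp (H_measurable mu t0) (g := fun q : Td * Rd => (q.1, - q.2))).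
  by apply: measurable_fun_pair => //; exact: (measurableT_comp (@measurable_opprV R d) measurable_snd).
transitivity (\int[mu]_x \int[psi x]_z H t x mu (- z)).
  apply: eq_Rintegral => x _; apply: (expect_law_meas (psi x) (@measurable_opprV R d)).
  exact: (measurableT_comp (H_measurable mu t0) (pair1_measurable x)).
rewrite (hF (fun q => H t q.1 mu (- q.2)))//.
  by apply: eq_Rintegral => z _; rewrite scaleNr.
have [M hM] := H_plan_bdd mu (- k) tT.
by exists M => z; have := hM z; rewrite scaleNr.
Qed.

End supersolution.
End viscosity_inequalities.

(** * Gluing of two plans over a common coupling *)

Section gluing.
Context {R : realType} {d : nat} (d_gt0 : (0 < d)%N).
Local Notation Td := (torus R d).
Local Notation Pd := (Ptorus R d).
Local Notation Rd := 'rV[R]_d.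
Variables (delta : Td -> Td -> Rd) (delta_min : minimal_difference delta).

Definition displacement_cost (G : probability ((Td * Td) * Td)%type R) := \int[G]_z cost (z.2 - z.1.1).

Lemma bmeas_displacement_cost : bmeas (fun z : (Td * Td) * Td => cost (z.2 - z.1.1) : R).
Proof. exact: (bmeas_comp measurable_displacement bmeas_costB). Qed.

(** Both moved points are sampled over the same frozen pair, with independent seeds, the second plan
    seeing the pair swapped through [e2]. Integrating [cost_glue] gives the bound. *)
Lemma glue_plans (g : probability (Td * Td)%type R) (mu nu : Pd) G1 G2 :
  plan_of g mu G1 -> plan_of (swap_law g) nu G2 ->
  exists gam, coupling mu nu gam /\
    \int[gam]_q cost (q.1 - q.2) <= \int[g]_q cost (q.1 - q.2)
      + (\int[G1]_z pot z - displacement_cost G1) + (\int[G2]_z pot z - displacement_cost G2).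
Proof.
move=> pl1 pl2; have cT := coding_torus d_gt0 delta_min.
have [X1 [mX1 h1]] := disintegration cT (proj1 pl1).
have [X2 [mX2 h2]] := disintegration cT (proj1 pl2).
pose g1 :=
  [the probability _ _ of (g \x @unif01 R)%E].
pose Q :=
  [the probability _ _ of (g1 \x @unif01 R)%E].
pose e2 (z : ((Td * Td) * R) * R) : (Td * Td) * R := ((z.1.1.2, z.1.1.1), z.2).
have m11 : measurable_fun setT (fun z : ((Td * Td) * R) * R => z.1.1).
  exact: (measurableT_comp measurable_fst measurable_fst).
have me2 : measurable_fun setT e2.
  apply: measurable_fun_pair => //.
  by apply: measurable_fun_pair; [exact: (measurableT_comp measurable_snd m11)|exact: (measurableT_comp measurable_fst m11)].
have prod1 A : measurable A -> g1 (A `*` setT) = g A.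
  move=> mA; rewrite /g1/= product_measure1E//= -[RHS]mule1; congr (_ * _)%E.
  exact: (@probability_setT _ _ _ (unif01 : probability _ _)).
have prod2 A : measurable A -> Q (A `*` setT) = g1 A.
  move=> mA; rewrite /Q/= product_measure1E//= -[RHS]mule1; congr (_ * _)%E.
  exact: (@probability_setT _ _ _ (unif01 : probability _ _)).
have I1 f : bmeas f -> \int[G1]_z f z = \int[Q]_z f (z.1.1, X1 z.1).
  move=> bf; rewrite h1//.
  have mZ : measurable_fun setT (fun z : (Td * Td) * R => (z.1, X1 z)) by exact: measurable_fun_pair.
  by rewrite -(expect_fst prod2 (bmeas_comp mZ bf)).
have I2 f : bmeas f -> \int[G2]_z f z = \int[Q]_z f ((e2 z).1, X2 (e2 z)).
  move=> bf; rewrite h2//.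
  have mZ : measurable_fun setT (fun z : (Td * Td) * R => (z.1, X2 z)) by exact: measurable_fun_pair.
  have bF := bmeas_comp mZ bf.
  have msw : measurable_fun setT (fun z : (Td * Td) * R => ((z.1.2, z.1.1), z.2)).
    apply: measurable_fun_pair => //.
    by apply: measurable_fun_pair; [exact: (measurableT_comp measurable_snd measurable_fst)|exact: (measurableT_comp measurable_fst measurable_fst)].
  have bF' := bmeas_comp msw bF.
  have := expect_seed prod1 bF'; rewrite /= => ->.
  have [b1 ->] := expect_prod (swap_law g) unif01 bF.
  have [_ ->] := expect_prod g unif01 bF'.
  by rewrite [LHS](expect_law g (@measurable_swap _ Td _ Td) b1); apply: eq_Rintegral.
pose m z := (X1 z.1, X2 (e2 z)).
have mm : measurable_fun setT m.
  by apply: measurable_fun_pair; [exact: (measurableT_comp mX1 measurable_fst)|exact: (measurableT_comp mX2 me2)].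
exists (law Q mm); split.
  move=> A mA; have bA := bmeas_indic (R := R) mA; split.
    apply: probability_eq => //; first by rewrite -[X in measurable X]setTI; exact: measurable_fst.
    rewrite -!expect_indic//; last by rewrite -[X in measurable X]setTI; exact: measurable_fst.
    rewrite -(expect_snd (proj2 pl1) bA) [RHS](I1 _ (bmeas_comp measurable_snd bA)).
    transitivity (\int[law Q mm]_x (\1_A x.1 : R)); first exact: eq_Rintegral.
    by rewrite [LHS](expect_law Q mm (bmeas_comp measurable_fst bA)); apply: eq_Rintegral.
  apply: probability_eq => //; first by rewrite -[X in measurable X]setTI; exact: measurable_snd.
  rewrite -!expect_indic//; last by rewrite -[X in measurable X]setTI; exact: measurable_snd.
  rewrite -(expect_snd (proj2 pl2) bA) [RHS](I2 _ (bmeas_comp measurable_snd bA)).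
  transitivity (\int[law Q mm]_x (\1_A x.2 : R)); first exact: eq_Rintegral.
  by rewrite [LHS](expect_law Q mm (bmeas_comp measurable_snd bA)); apply: eq_Rintegral.
rewrite expect_law; last exact: bmeas_costB.
have bp := @bmeas_pot R d; have bc := bmeas_displacement_cost.
rewrite /displacement_cost -!expectB// I1; last exact: bmeasB.
rewrite I2; last exact: bmeasB.
have b0 : bmeas (fun z : ((Td * Td) * R) * R => cost (z.1.1.1 - z.1.1.2) : R) by exact: (bmeas_comp m11 bmeas_costB).
have m1 : measurable_fun setT (fun z : ((Td * Td) * R) * R => (z.1.1, X1 z.1)).
  by apply: measurable_fun_pair => //; exact: (measurableT_comp mX1 measurable_fst).
have m2 : measurable_fun setT (fun z : ((Td * Td) * R) * R => ((e2 z).1, X2 (e2 z))).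
  by apply: measurable_fun_pair; [exact: (measurableT_comp measurable_fst me2)|exact: (measurableT_comp mX2 me2)].
have b1 := bmeas_comp m1 (bmeasB bp bc); have b2 := bmeas_comp m2 (bmeasB bp bc).
have -> : \int[g]_q cost (q.1 - q.2) = \int[Q]_z cost (z.1.1.1 - z.1.1.2).
  have bc1 := bmeas_comp (@measurable_fst _ _ (Td * Td)%type R) (@bmeas_costB R d).
  rewrite [RHS](expect_fst prod2 bc1).
  by rewrite [RHS](expect_fst prod1 (@bmeas_costB R d)).
rewrite -expectD// -expectD//; last exact: bmeasD.
apply: expect_le; [exact: bmeas_comp mm bmeas_costB|by apply: bmeasD => //; exact: bmeasD|].
by move=> z; exact: cost_glue.
Qed.

End gluing.

(** * Doubling of variables *)

Section penalization.
Context {R : realType} {d : nat}.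
Local Notation Td := (torus R d).
Local Notation Pd := (Ptorus R d).
Local Notation Rd := 'rV[R]_d.
Local Notation twopi := ((pi : R) *+ 2).

Lemma displacement_cost_ge0 (G : probability ((Td * Td) * Td)%type R) : 0 <= displacement_cost G.
Proof. by apply: expect_ge0 => z; exact: cost_ge0. Qed.

Lemma diag_plan (g : probability (Td * Td)%type R) (mu : Pd) :
  (forall A : set Td, measurable A -> g (fst @^-1` A) = mu A) ->
  exists G, [/\ plan_of g mu G, \int[G]_z pot z = 0 & displacement_cost G = 0].
Proof.
move=> hg.
have md : measurable_fun setT (fun q : Td * Td => (q, q.1)) by exact: measurable_fun_pair.
exists (law g md); split.
- split=> A mA; rewrite lawE -?hg//; congr (g _).
    by apply/seteqP; split => q //= [].
  by apply/seteqP; split => q //= [].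
- rewrite expect_law; last exact: bmeas_pot.
  rewrite -[RHS](expect_cst g 0); apply: eq_Rintegral => q _.
  by rewrite /pot big1// => i _ /=; rewrite subrr sn0 cs0 mulr0 add0r subrr mulr0.
- rewrite /displacement_cost expect_law; last exact: bmeas_displacement_cost.
  by rewrite -[RHS](expect_cst g 0); apply: eq_Rintegral => q _; rewrite /= subrr cost0.
Qed.

Definition penalized (T : R) (U V : R -> Pd -> Td -> R) c k K t s mu nu (gam : probability (Td * Td)%type R) x w y : R :=
  U t mu x - V s nu y - c * (T - t) - c * (T - s)
  - k * (\int[gam]_q cost (q.1 - q.2) + cost (x - w) + cost (w - y)) - K * (t - s) ^+ 2.

(* At a maximum point of the penalized functional the coupling is frozen: t, x
   and s, y are moved separately, with plans over the maximizing coupling, and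
   the variable w is eliminated through the inf-convolution phi and its smooth
   resolvent. *)
Lemma frozen_touching (d_gt0 : (0 < d)%N) (delta : Td -> Td -> Rd)
    (delta_min : minimal_difference delta) (T : R) (T0 : 0 <= T) (sigma : R -> R)
    (H : R -> Td -> Pd -> Rd -> R)
    (H_continuous : {within [set q : R * Td * Pd * Rd | 0 <= q.1.1.1],
       continuous (fun q => H q.1.1.1 q.1.1.2 q.1.2 q.2)})
    (C : R) (C_gt0 : 0 < C)
    (H_growth : forall t x mu p, 0 <= t <= T -> `|H t x mu p| <= C * (1 + enorm p ^+ 2))
    (U V : R -> Pd -> Td -> R)
    (U_sub : viscosity_subsolution delta T sigma H U)
    (U_bounded : exists M, forall t mu w, 0 <= t <= T -> `|U t mu w| <= M)
    (V_super : viscosity_supersolution delta T sigma H V)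
    (V_bounded : exists M, forall t mu w, 0 <= t <= T -> `|V t mu w| <= M)
    c k K tb sb mub nub g xb wb yb e :
  0 < k -> 0 <= K -> 0 < e -> 0 <= tb <= T -> 0 <= sb <= T -> coupling mub nub g ->
  (forall t s mu nu gam x w y, 0 <= t <= T -> 0 <= s <= T -> coupling mu nu gam ->
    penalized T U V c k K t s mu nu gam x w y <= penalized T U V c k K tb sb mub nub g xb wb yb) ->
  exists L L1 L2 t s mu nu G1 G2,
  [/\ [/\ 0 <= t <= T, 0 <= s <= T, plan_of g mu G1 & plan_of (swap_law g) nu G2],
   (t - tb) ^+ 2 + k * displacement_cost G1 <= 2 * e /\
   (s - sb) ^+ 2 + k * displacement_cost G2 <= 2 * e,
   [/\ `|L| <= k * twopi ^+ 2 * d%:R + e, L1 <= L + e & L - e <= L2],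
   t < T -> - (2 * K * (tb - sb) - c + (4 * K + 2) * (t - tb))
     + \int[G1]_z H t z.2 mu (k *: potg z) - sigma t ^+ 2 / 2 * L1 <= 0 &
   s < T -> 0 <= - (2 * K * (tb - sb) + c - (4 * K + 2) * (s - sb))
     + \int[G2]_z H s z.2 nu (- k *: potg z) - sigma s ^+ 2 / 2 * L2].
Proof.
move=> k0 K0 e0 tbT sbT cg hmax.
have [G1b [pl1b p1b d1b]] := @diag_plan g mub (fun A mA => proj1 (cg A mA)).
have [G2b [pl2b p2b d2b]] : exists G, [/\ plan_of (swap_law g) nub G, \int[G]_z pot z = 0 & displacement_cost G = 0].
  apply: diag_plan => A mA; have := swap_lawE g A setT; rewrite setXT => ->.
  by rewrite setTX (proj2 (cg A mA)).
pose D := tb - sb.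
(* With t - s = D + (t - tb) - (s - sb), the square (t - s)^2 is at most D^2 plus a function of t
   and a function of s, both vanishing at tb and sb. *)
pose tau1 t := c * (T - t) + K * (2 * D * (t - tb) + 2 * (t - tb) ^+ 2).
pose tau2 s := c * (T - s) + K * (- (2 * D * (s - sb)) + 2 * (s - sb) ^+ 2).
pose ep (G : probability ((Td * Td) * Td)%type R) := \int[G]_z pot z - displacement_cost G.
pose A t mu G x := U t mu x - tau1 t - k * ep G.
pose B s nu G y := V s nu y + tau2 s + k * ep G.
pose Ab := A tb mub G1b xb; pose Bb := B sb nub G2b yb.
pose S := Ab - Bb - k * cost (xb - wb) - k * cost (wb - yb).
have key t s mu nu G1 G2 x w y : 0 <= t <= T -> 0 <= s <= T ->
    plan_of g mu G1 -> plan_of (swap_law g) nu G2 ->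
    A t mu G1 x - B s nu G2 y - k * cost (x - w) - k * cost (w - y) <= S.
  move=> tT sT pl1 pl2; have [gam [cgam hgam]] := glue_plans d_gt0 delta_min pl1 pl2.
  have := hmax t s mu nu gam x w y tT sT cgam.
  have := ler_wpM2l (ltW k0) hgam.
  have h : (t - s) ^+ 2 <= D ^+ 2 + 2 * D * (t - tb) - 2 * D * (s - sb) + 2 * (t - tb) ^+ 2 + 2 * (s - sb) ^+ 2.
    have := sqr_ge0 ((t - tb) + (s - sb)); rewrite /D; clear -d; nra.
  have := ler_wpM2l K0 h.
  rewrite /penalized /S /Ab /Bb /A /B /ep /tau1 /tau2 p1b p2b d1b d2b -/D !subrr.
  by move: (displacement_cost G1) (displacement_cost G2) => d1 d2; clear -d; lra.
(* The infimum runs over all the unknowns of the super-solution side at once, so that only w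
   remains. *)
pose E w : set R := [set r | exists s nu G y,
  [/\ 0 <= s <= T, plan_of (swap_law g) nu G & r = B s nu G y + k * cost (w - y)]].
pose phi w := inf (E w).
have Eb w : E w (Bb + k * cost (w - yb)) by exists sb, nub, G2b, yb.
have Elb w t mu G1 x : 0 <= t <= T -> plan_of g mu G1 -> lbound (E w) (A t mu G1 x - k * cost (x - w) - S).
  move=> tT pl1 _ [s [nu [G2 [y [sT pl2 ->]]]]].
  by have := key t s mu nu G1 G2 x w y tT sT pl1 pl2; clear -d; lra.
have phi_le w s nu G y : 0 <= s <= T -> plan_of (swap_law g) nu G -> phi w <= B s nu G y + k * cost (w - y).
  move=> sT pl2; apply: ge_inf; last by exists s, nu, G, y.
  by eexists; exact: (Elb w tb mub G1b xb tbT pl1b).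
(* phi lies above the sup-convolution of A lowered by S and meets it at wb; together with [phi_le]
   this gives a paraboloid on each side of phi at wb. *)
have phi_ge w t mu G1 x : 0 <= t <= T -> plan_of g mu G1 -> A t mu G1 x - k * cost (x - w) - S <= phi w.
  by move=> tT pl1; apply: lb_le_inf; [exists (Bb + k * cost (w - yb))|exact: Elb].
have phib1 : phi wb = Bb + k * cost (wb - yb).
  apply/eqP; rewrite eq_le phi_le//=.
  by have := phi_ge wb tb mub G1b xb tbT pl1b; rewrite /S -/Ab; clear -d; lra.
have phib2 : phi wb = Ab - k * cost (xb - wb) - S by rewrite phib1 /S; clear -d; lra.
have rphi : cost_regular phi.
  move=> e' e'0; have [K' K'0 hK'] := @cost_split R d _ (divr_gt0 e'0 k0).
  exists (k * K'); first by rewrite mulr_gt0.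
  move=> x y; rewrite -lerBlDr -lerBlDr; apply: lb_le_inf; first by exists (Bb + k * cost (y - yb)).
  move=> _ [s [nu [G [y' [sT pl ->]]]]].
  have := phi_le x s nu G y' sT pl.
  have := ler_wpM2l (ltW k0) (hK' (x - y') (y - y')).
  have -> : x - y' - (y - y') = x - y by rewrite opprB subrKA.
  by rewrite !mulrDr mulrCA divff ?gt_eqF// mulr1; clear -d; lra.
have hup w : phi w <= phi wb + k * (cost (w - yb) - cost (wb - yb)).
  by rewrite phib1; have := phi_le w sb nub G2b yb sbT pl2b; rewrite -/Bb; clear -d; lra.
have hlo w : phi wb - k * (cost (w - xb) - cost (wb - xb)) <= phi w.
  rewrite phib2; have := phi_ge w tb mub G1b xb tbT pl1b; rewrite -/Ab.
  by rewrite -(costN (w - xb)) -(costN (wb - xb)) !opprB; clear -d; lra.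
have [l [il hl hL h3 h4]] := resolvent_approx rphi (ltW k0) e0 hup hlo.
(* With w = x - e1, the cost of x - w is the constant cost e1: A lies below a translate of phi, up
   to constants, and is therefore tested with the same translate of tsum l. *)
pose e1 := xb - wb; pose e2 := yb - wb.
pose l' := trig_scale (-1) l.
have il' : integral_modes l' by move=> _ /mapP[m ml ->] i; exact: (il m ml i).
have tl' x : tsum l' x = - tsum l x by rewrite /tsum trig_scaleE mulN1r.
have tl'' x : tlap l' x = - tlap l x by rewrite /tlap trig_lap_scale mulN1r.
have b20 : 0 <= 2 * K + 1 by move: K0; clear -d; lra.
(* The three coefficients are those of tau1 t + (t - tb)^2 as a polynomial in t; the added square
   localizes the touching time. The next ones come from tau2 s + (s - sb)^2 in the same way. *)
have [t [mu [G1 [x [tT pl1 max1 ineq1]]]]] :=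
  subsolution_touching d_gt0 delta_min T0 H_continuous C_gt0 H_growth U_sub U_bounded
   (c * T - 2 * K * D * tb + (2 * K + 1) * tb ^+ 2) (- c + 2 * K * D - 2 * (2 * K + 1) * tb)
   e1 pl1b b20 (ltW k0) il.
have [s [nu [G2 [y [sT pl2 max2 ineq2]]]]] :=
  supersolution_touching d_gt0 delta_min T0 H_continuous C_gt0 H_growth V_super V_bounded
   (c * T + 2 * K * D * sb + (2 * K + 1) * sb ^+ 2) (- c - 2 * K * D - 2 * (2 * K + 1) * sb)
   e2 pl2b b20 (ltW k0) il'.
have dc0 := @displacement_cost_ge0.
(* A contains k times [pot] minus the displacement cost, the test function k times [pot] alone; the
   difference is the term controlling [displacement_cost G1]. *)
have loc1 : (t - tb) ^+ 2 + k * displacement_cost G1 <= (phi (x - e1) - tsum l (x - e1)) - (phi wb - tsum l wb).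
  have := max1 tb mub G1b xb tbT pl1b; rewrite p1b.
  have -> : xb - e1 = wb by rewrite /e1 subKr.
  have := phi_ge (x - e1) t mu G1 x tT pl1; rewrite subKr phib2 /S /Ab /A /ep /tau1 p1b d1b -/e1.
  by rewrite !subrr; clear -d; lra.
have loc2 : (s - sb) ^+ 2 + k * displacement_cost G2 <= (phi wb - tsum l wb) - (phi (y - e2) - tsum l (y - e2)).
  have := max2 sb nub G2b yb sbT pl2b; rewrite p2b !tl'.
  have -> : yb - e2 = wb by rewrite /e2 subKr.
  have := phi_le (y - e2) s nu G2 y sT pl2; rewrite (addrC y) addrK costN phib1.
  have -> : cost (wb - yb) = cost e2 by rewrite -costN opprB.
  rewrite /Bb /B /ep /tau2 p2b d2b.
  by rewrite !subrr; clear -d; lra.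
have k1 := mulr_ge0 (ltW k0) (dc0 G1); have k2 := mulr_ge0 (ltW k0) (dc0 G2).
have q1 := sqr_ge0 (t - tb); have q2 := sqr_ge0 (s - sb).
exists (tlap l wb), (tlap l (x - e1)), (tlap l (y - e2)), t, s, mu, nu, G1, G2; split => //.
- split.
    have := hl (x - e1); have := hl wb; rewrite !ler_norml; move: loc1; clear -d.
    by move=> ? /andP[? ?] /andP[? ?]; lra.
  have := hl (y - e2); have := hl wb; rewrite !ler_norml; move: loc2; clear -d.
  by move=> ? /andP[? ?] /andP[? ?]; lra.
- split => //; first by apply: h3; move: loc1 k1 q1; clear -d; lra.
  by apply: h4; move: loc2 k2 q2; clear -d; lra.
- move=> /ineq1; rewrite /D; clear -d; lra.
- move=> /ineq2; rewrite tl'' /D; clear -d; lra.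
Qed.

End penalization.

(** * Limits of the doubled variables *)

Section coupling_limits.
Context {R : realType} {d : nat}.
Local Notation Td := (torus R d).
Local Notation Pd := (Ptorus R d).
Local Notation Rd := 'rV[R]_d.

Lemma coupling_fst (mu nu : Pd) (gam : probability (Td * Td)%type R) f : coupling mu nu gam -> bmeas f ->
  \int[gam]_q f q.1 = \int[mu]_x f x.
Proof. by move=> cg; apply: expect_fst => A mA; rewrite -(proj1 (cg A mA)) setXT. Qed.

Lemma coupling_snd (mu nu : Pd) (gam : probability (Td * Td)%type R) f : coupling mu nu gam -> bmeas f ->
  \int[gam]_q f q.2 = \int[nu]_x f x.
Proof. by move=> cg; apply: expect_snd => A mA; rewrite -(proj2 (cg A mA)) setTX. Qed.

Variables (d_gt0 : (0 < d)%N) (delta : Td -> Td -> Rd) (delta_min : minimal_difference delta).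

Lemma coupling_compact (I : Type) (F : set_system I) (UF : UltraFilter F)
    (mu nu : I -> Pd) (gam : I -> probability (Td * Td)%type R) :
  (forall i, coupling (mu i) (nu i) (gam i)) ->
  exists mu' nu' gam', [/\ coupling mu' nu' gam', mu i @[i --> F] --> mu', nu i @[i --> F] --> nu' &
    \int[gam i]_q cost (q.1 - q.2) @[i --> F] --> \int[gam']_q cost (q.1 - q.2)].
Proof.
move=> cg.
have mt : measurable_fun setT (fun q : Td * Td => (tt, q)) by exact: measurable_fun_pair.
pose G i : probability (unit * (Td * Td))%type R := law (gam i) mt.
pose pt : probability unit R := law (@unif01 R) (@measurable_cst _ _ _ _ setT tt).
have marg i A : measurable A -> G i (A `*` setT) = pt A.
  move=> _; have [tA|tA] := pselect (A tt).
    have -> : A = setT by apply/seteqP; split => // -[].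
    by rewrite setXTT !probability_setT.
  have -> : A = set0 by apply/seteqP; split => // -[].
  by rewrite set0X !measure0.
have cT := coding_torus d_gt0 delta_min.
have [X [mX hX]] := young_compactness (coding_prod cT cT) UF marg.
pose gam' : probability (Td * Td)%type R := law (pt \x unif01)%E mX.
have key (f : Td * Td -> R) : bmeas f -> digital (dec_prod dec_torus dec_torus) f ->
    \int[gam i]_q f q @[i --> F] --> \int[gam']_q f q.
  move=> bf df; rewrite expect_law//.
  have := hX _ (prefix_test_snd unit bf df); rewrite /=.
  rewrite (_ : (fun i => _) = (fun i => \int[gam i]_q f q))//.
  apply/funext => i; rewrite expect_law//.
  by apply: bmeas_comp bf.
pose mu' : Pd := law gam' measurable_fst; pose nu' : Pd := law gam' measurable_snd.
have cg' : coupling mu' nu' gam' by [].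
exists mu', nu', gam'; split => //.
- apply: Ptorus_cvg => f cf.
  have [bf df] := digital_continuous d_gt0 delta_min cf.
  have bmf : bmeas f by split; first exact: continuous_measurable_torus.
  have := key _ (bmeas_comp measurable_fst bmf) (digital_fst dec_torus (conj bf df)).
  rewrite (coupling_fst cg' bmf) (_ : (fun i => _) = (fun i => \int[mu i]_x f x))//.
  by apply/funext => i; rewrite (coupling_fst (cg i) bmf).
- apply: Ptorus_cvg => f cf.
  have [bf df] := digital_continuous d_gt0 delta_min cf.
  have bmf : bmeas f by split; first exact: continuous_measurable_torus.
  have := key _ (bmeas_comp measurable_snd bmf) (digital_snd dec_torus (conj bf df)).
  rewrite (coupling_snd cg' bmf) (_ : (fun i => _) = (fun i => \int[nu i]_x f x))//.
  by apply/funext => i; rewrite (coupling_snd (cg i) bmf).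
- apply: (key (fun q => cost (q.1 - q.2))); first exact: bmeas_costB.
  apply: digital_sum => i.
  rewrite (_ : (fun x => _) = fun q : Td * Td => 1 + -1 * (cs q.1 i * cs q.2 i + sn q.1 i * sn q.2 i)); last first.
    by apply/funext => q; rewrite csB mulN1r.
  have dc : digital dec_torus (fun x : Td => cs x i : R).
    by apply: (digital_continuous d_gt0 delta_min) => ?; exact: continuous_cs.
  have ds : digital dec_torus (fun x : Td => sn x i : R).
    by apply: (digital_continuous d_gt0 delta_min) => ?; exact: continuous_sn.
  apply: digitalD; first exact: digital_cst.
  apply: digitalZ; apply: digitalD; apply: digitalM.
  + exact: (digital_fst dec_torus dc).
  + exact: (digital_snd dec_torus dc).
  + exact: (digital_fst dec_torus ds).
  + exact: (digital_snd dec_torus ds).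
Qed.

Lemma cost_eq0 (x : Td) : cost x = 0 -> x = 0.
Proof.
move=> x0; have := tdist_cost x 0; rewrite subr0 x0 => h.
have : tdist x 0 = 0.
  by apply/eqP; rewrite -sqrf_eq0 eq_le h sqr_ge0.
rewrite -(enorm_delta delta_min) => h0.
have d0 : delta x 0 = 0.
  apply/rowP => i; rewrite mxE; apply/eqP; rewrite -normr_le0 -h0; exact: coord_le_enorm.
by rewrite -[x]subr0 -(delta_pi delta_min) d0 raddf0.
Qed.

(** By Markov's inequality gam gives mass 0 to each set where the cost is at least 1 / (n + 1), so
    it is carried by the diagonal. *)
Lemma cost0_coupling (mu nu : Pd) gam f : coupling mu nu gam ->
  \int[gam]_q cost (q.1 - q.2) = 0 -> bmeas f -> \int[mu]_x f x = \int[nu]_x f x.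
Proof.
move=> cg c0 bf; pose N := [set q : Td * Td | cost (q.1 - q.2) != 0 :> R].
have mc : measurable_fun setT (fun q : Td * Td => cost (q.1 - q.2) : R) by case: (@bmeas_costB R d).
have mN : measurable N.
  rewrite (_ : N = (fun q : Td * Td => cost (q.1 - q.2) : R) @^-1` [set~ 0]).
    rewrite -[X in measurable X]setTI; apply: mc => //; exact: measurableC.
  by apply/seteqP; split => q /=; move/eqP.
have gN : gam N = 0.
  pose A n := [set q : Td * Td | n.+1%:R^-1 <= (cost (q.1 - q.2) : R)].
  have mA n : measurable (A n).
    rewrite (_ : A n = (fun q : Td * Td => cost (q.1 - q.2) : R) @^-1` [set r | n.+1%:R^-1 <= r])//.
    rewrite -[X in measurable X]setTI; apply: mc => //.
    by rewrite -set_itvcy; exact: measurable_itv.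
  have gA n : gam (A n) = 0.
    apply/eqP; rewrite eq_le measure_ge0 andbT -[gam (A n)]fineK ?fin_num_measure// lee_fin -expect_indic//.
    have bA := bmeas_indic (R := R) (mA n).
    have n0 : 0 < n.+1%:R :> R by rewrite ltr0n.
    rewrite -(pmulr_rle0 _ (x := n.+1%:R^-1)) ?invr_gt0// -expectZ// -c0.
    apply: expect_le; [exact: bmeasZ|exact: bmeas_costB|move=> q; rewrite indicE].
    have [|_] := boolP (q \in A n); last by rewrite mulr0 cost_ge0.
    by rewrite inE mulr1.
  apply/eqP; rewrite eq_le measure_ge0 andbT.
  have NA : N `<=` \bigcup_n A n.
    move=> q /= qN; have c1 : 0 < (cost (q.1 - q.2) : R) by rewrite lt_neqAle eq_sym qN cost_ge0.
    exists (Num.truncn (cost (q.1 - q.2) : R)^-1) => //=.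
    by rewrite /A/= invf_ple ?posrE ?ltr0n// ltW// truncnS_gt.
  apply: (le_trans (le_measure gam _ _ NA)); rewrite ?inE//; first exact: bigcupT_measurable.
  apply: (le_trans (measure_sigma_subadditive _ _ _ (@subset_refl _ _))) => //; first exact: bigcupT_measurable.
  by rewrite eseries0// => n _ _; exact: gA.
have [M hM] := proj2 bf.
rewrite -(coupling_fst cg bf) -(coupling_snd cg bf); apply/eqP; rewrite -subr_eq0.
have b1 := bmeas_comp (@measurable_fst _ _ Td Td) bf.
have b2 := bmeas_comp (@measurable_snd _ _ Td Td) bf.
rewrite -expectB// -normr_le0 (le_trans (expect_norm _ (bmeasB b1 b2)))//.
have bN := bmeas_indic (R := R) mN.
apply: (@le_trans _ _ (\int[gam]_q (2 * M * \1_N q))); last by rewrite expectZ// expect_indic// gN mulr0.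
apply: expect_le; [exact/bmeas_norm/bmeasB|exact: bmeasZ|move=> q; rewrite indicE].
have [_|] := boolP (q \in N).
  by rewrite mulr1 (le_trans (ler_normB _ _))// mulr_natl mulr2n lerD.
rewrite notin_setE /N/= => /negP; rewrite negbK => /eqP/cost_eq0/subr0_eq ->.
by rewrite subrr normr0 mulr0.
Qed.

(* Two measures with the same integrals need not be equal as terms (they may
   differ on non-measurable sets), but they are topologically
   indistinguishable in P(T^d). *)
Lemma cvg_cost0 (I : Type) (F : set_system I) (FF : Filter F) (nu : I -> Pd) (m m' : Pd) gam :
  coupling m m' gam -> \int[gam]_q cost (q.1 - q.2) = 0 -> nu i @[i --> F] --> m' -> nu i @[i --> F] --> m.
Proof.
move=> cg c0 h.
have E : continuous_integrals m = continuous_integrals m'.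
  apply/funext => -[f cf]; apply: (cost0_coupling cg c0).
  have [bf _] := digital_continuous d_gt0 delta_min cf.
  by split; first exact: continuous_measurable_torus.
move=> A; rewrite nbhsE => -[B [[C oC BE] Bm]] BA; apply: h.
rewrite nbhsE; exists B => //; split; first by exists C.
by move: Bm; rewrite -BE /= E.
Qed.

Lemma cvg_costB (I : Type) (F : set_system I) (FF : Filter F) (x y : I -> Td) (x' y' : Td) :
  x i @[i --> F] --> x' -> y i @[i --> F] --> y' -> cost (x i - y i) @[i --> F] --> (cost (x' - y') : R).
Proof.
move=> cx cy; apply: cvgr_sum => j.
apply: cvgB; first exact: cvg_cst.
under eq_fun do rewrite csB; rewrite csB.
have h1 (f : Td -> 'I_d -> R) (z : I -> Td) z' : continuous (f ^~ j) -> z i @[i --> F] --> z' ->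
    f (z i) j @[i --> F] --> f z' j.
  by move=> cf cz; exact: continuous_cvg (cf _) cz.
by apply: cvgD; apply: cvgM; apply: h1 => //; (exact: continuous_cs || exact: continuous_sn).
Qed.

Record doubled := Doubled {
  dt : R; ds : R; dmu : Pd; dnu : Pd; dgam : probability (Td * Td)%type R;
  dx : Td; dw : Td; dy : Td }.

Definition mismatch q : R :=
  \int[dgam q]_z cost (z.1 - z.2) + cost (dx q - dw q) + cost (dw q - dy q).

Lemma mismatch_ge0 q : 0 <= mismatch q.
Proof.
by rewrite /mismatch !addr_ge0 ?cost_ge0//; apply: expect_ge0 => z; exact: cost_ge0.
Qed.

Variables (T : R).

Definition admissible q :=
  [/\ 0 <= dt q <= T, 0 <= ds q <= T & coupling (dmu q) (dnu q) (dgam q)].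

Lemma doubled_limit (I : Type) (F : set_system I) (UF : UltraFilter F) (q : I -> doubled) :
  (forall i, admissible (q i)) -> exists q', [/\ admissible q',
    dt (q i) @[i --> F] --> dt q' /\ ds (q i) @[i --> F] --> ds q',
    dmu (q i) @[i --> F] --> dmu q' /\ dnu (q i) @[i --> F] --> dnu q',
    dx (q i) @[i --> F] --> dx q' /\ dy (q i) @[i --> F] --> dy q' &
    mismatch (q i) @[i --> F] --> mismatch q'].
Proof.
move=> adm.
have [t tT ct] : exists2 t, 0 <= t <= T & dt (q i) @[i --> F] --> t.
  by apply: ultra_segment => i; have [] := adm i.
have [s sT cs] : exists2 s, 0 <= s <= T & ds (q i) @[i --> F] --> s.
  by apply: ultra_segment => i; have [] := adm i.
have cg i : coupling (dmu (q i)) (dnu (q i)) (dgam (q i)) by have [] := adm i.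
have [mu [nu [gam [cgam cmu cnu cc]]]] := coupling_compact UF cg.
have [x cx] := torus_ultra UF (fun i => dx (q i)).
have [w cw] := torus_ultra UF (fun i => dw (q i)).
have [y cy] := torus_ultra UF (fun i => dy (q i)).
exists (Doubled t s mu nu gam x w y); split => //.
have h1 := cvg_costB _ cx cw; have h2 := cvg_costB _ cw cy.
by apply: cvgD; [apply: cvgD => //; exact: h1|exact: h2].
Qed.

Variables (U V : R -> Pd -> Td -> R) (uU : usc T U) (lV : lsc T V)
  (U_bounded : exists M, forall t mu w, 0 <= t <= T -> `|U t mu w| <= M)
  (V_bounded : exists M, forall t mu w, 0 <= t <= T -> `|V t mu w| <= M).

Definition gap q : R := U (dt q) (dmu q) (dx q) - V (ds q) (dnu q) (dy q).

Definition penalty k K q : R := k * mismatch q + K * (dt q - ds q) ^+ 2.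

Definition Phi c k K q : R := gap q - c * (T - dt q) - c * (T - ds q) - penalty k K q.

Lemma penalty_ge0 k K q : 0 <= k -> 0 <= K -> 0 <= penalty k K q.
Proof. by move=> k0 K0; rewrite addr_ge0// mulr_ge0// ?mismatch_ge0// sqr_ge0. Qed.

Lemma gap_bounded : exists M, forall q, admissible q -> `|gap q| <= M.
Proof.
have [M hM] := U_bounded; have [N hN] := V_bounded; exists (M + N) => q [tT sT _].
by rewrite (le_trans (ler_normB _ _))// lerD// ?hM// hN.
Qed.

Lemma Phi_max c k K q0 : 0 <= c -> 0 <= k -> 0 <= K -> admissible q0 ->
  exists2 q, admissible q & forall q', admissible q' -> Phi c k K q' <= Phi c k K q.
Proof.
move=> c0 k0 K0 adm0; have [Uf [UU oU]] := nat_ultrafilter.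
pose X := {q | admissible q}.
have [] := @ultra_max _ Uf UU oU X (fun q => Phi c k K (sval q)) (exist _ q0 adm0).
- have [M hM] := gap_bounded; exists M => -[q adm] /=.
  have := hM q adm; have := penalty_ge0 q k0 K0; rewrite /Phi ler_norml.
  have [/andP[_ tT] /andP[_ sT] _] := adm.
  have : 0 <= c * (T - dt q) by rewrite mulr_ge0// subr_ge0.
  have : 0 <= c * (T - ds q) by rewrite mulr_ge0// subr_ge0.
  by move=> ? ? ? /andP[? ?]; lra.
- move=> x; have adm n : admissible (sval (x n)) by exact: svalP.
  have [q [admq [ct cs] [cmu cnu] [cx cy] cm]] := doubled_limit UU adm.
  exists (exist _ q admq) => e e0; have e3 : 0 < e / 3 by rewrite divr_gt0.
  have [tT sT _] := admq.
  have tTn n : 0 <= dt (sval (x n)) <= T by have [] := adm n.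
  have sTn n : 0 <= ds (sval (x n)) <= T by have [] := adm n.
  pose rest q := c * (T - dt q) + c * (T - ds q) + penalty k K q.
  have crest : rest (sval (x n)) @[n --> Uf] --> rest q.
    apply: cvgD; first by apply: cvgD; apply: cvgM; (try exact: cvg_cst); apply: cvgB; (exact: cvg_cst || by []).
    apply: cvgD; apply: cvgM; (try exact: cvg_cst) => //.
    exact: (cvgM (cvgB ct cs) (cvgB ct cs)).
  have h1 : \forall n \near Uf, U (dt (sval (x n))) (dmu (sval (x n))) (dx (sval (x n))) <=
      U (dt q) (dmu q) (dx q) + e / 3.
    exact: (usc_limit _ uU tTn tT ct cmu cx e3).
  have h2 : \forall n \near Uf, V (ds q) (dnu q) (dy q) <=
      V (ds (sval (x n))) (dnu (sval (x n))) (dy (sval (x n))) + e / 3.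
    exact: (lsc_limit _ lV sTn sT cs cnu cy e3).
  have h3 : \forall n \near Uf, `|rest q - rest (sval (x n))| <= e / 3.
    by move/cvgrPdist_le : crest => /(_ _ e3).
  near=> n.
  have i1 : U (dt (sval (x n))) (dmu (sval (x n))) (dx (sval (x n))) <=
      U (dt q) (dmu q) (dx q) + e / 3 by near: n.
  have i2 : V (ds q) (dnu q) (dy q) <=
      V (ds (sval (x n))) (dnu (sval (x n))) (dy (sval (x n))) + e / 3 by near: n.
  have : `|rest q - rest (sval (x n))| <= e / 3 by near: n.
  move: i1 i2; rewrite /Phi /gap /rest /= ler_norml; clear -d_gt0 delta_min U_bounded V_bounded uU lV.
  by move=> i1 i2 /andP[i3 i4]; lra.
- by move=> [q adm] hq; exists q => // q' adm'; exact: (hq (exist _ q' adm')).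
Unshelve. all: by end_near. Qed.

(* Otherwise the points have a limit point with both times equal to T and zero
   penalty, whose gap is nonpositive by the terminal condition. *)
Lemma terminal_gap del : 0 < del -> (forall mu w, U T mu w <= V T mu w) ->
  exists2 r, 0 < r & exists N : nat, forall k K q, N%:R <= k -> k <= K -> admissible q ->
    penalty k K q <= 1 -> del <= gap q -> dt q <= T - r /\ ds q <= T - r.
Proof.
move=> del0 UVT; apply: contrapT => hn.
have [Uf [UU oU]] := nat_ultrafilter.
have bad (n : nat) : exists p : R * R * doubled, [/\ n.+1%:R <= p.1.1 /\ p.1.1 <= p.1.2,
    admissible p.2, penalty p.1.1 p.1.2 p.2 <= 1, del <= gap p.2 &
    ~ (dt p.2 <= T - n.+1%:R^-1 /\ ds p.2 <= T - n.+1%:R^-1)].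
  apply: contrapT => h; apply: hn; exists n.+1%:R^-1; first by rewrite invr_gt0 ltr0n.
  exists n.+1 => k K q nk kK adm p1 dg; apply: contrapT => hq; apply: h.
  by exists (k, K, q).
pose pn n := sval (cid (bad n)); pose kn n := (pn n).1.1; pose Kn n := (pn n).1.2; pose qn n := (pn n).2.
have hq n : [/\ n.+1%:R <= kn n /\ kn n <= Kn n, admissible (qn n),
   penalty (kn n) (Kn n) (qn n) <= 1, del <= gap (qn n) &
   ~ (dt (qn n) <= T - n.+1%:R^-1 /\ ds (qn n) <= T - n.+1%:R^-1)].
  exact: svalP (cid (bad n)).
have adm n : admissible (qn n) by have [] := hq n.
have [q [admq [ct cs] [cmu cnu] [cx cy] cm]] := doubled_limit UU adm.
have inv0 (e : R) : 0 < e -> \forall n \near Uf, n.+1%:R^-1 <= e.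
  move=> e0; apply: oU; exists (Num.truncn e^-1) => // n /= en.
  by rewrite invf_ple ?posrE ?ltr0n// ltW// (lt_le_trans (truncnS_gt _))// ler_nat.
have small n : mismatch (qn n) <= n.+1%:R^-1 /\ (dt (qn n) - ds (qn n)) ^+ 2 <= n.+1%:R^-1.
  have [[nk kK] _ p1 _ _] := hq n.
  have n0 : 0 < n.+1%:R :> R by rewrite ltr0n.
  have m0 := mismatch_ge0 (qn n); have s0 := sqr_ge0 (dt (qn n) - ds (qn n)).
  have a1 : n.+1%:R * mismatch (qn n) <= kn n * mismatch (qn n) by rewrite ler_wpM2r.
  have a2 : n.+1%:R * (dt (qn n) - ds (qn n)) ^+ 2 <= Kn n * (dt (qn n) - ds (qn n)) ^+ 2.
    by rewrite ler_wpM2r// (le_trans nk).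
  have a3 : 0 <= n.+1%:R * mismatch (qn n) by rewrite mulr_ge0// ltW.
  have a4 : 0 <= n.+1%:R * (dt (qn n) - ds (qn n)) ^+ 2 by rewrite mulr_ge0// ltW.
  move: p1; rewrite /penalty => p1.
  split; rewrite -[leRHS]mul1r ler_pdivlMr// mulrC; lra.
have mis0 : mismatch q = 0.
  apply/eqP; rewrite eq_le mismatch_ge0 andbT; apply/ler_addgt0Pr => e e0.
  have e2 : 0 < e / 2 by rewrite divr_gt0.
  have h1 : \forall n \near Uf, `|mismatch q - mismatch (qn n)| <= e / 2.
    by move/cvgrPdist_le : cm => /(_ _ e2).
  have [n [/= i1 i2]] := filter_ex2 _ h1 (inv0 _ e2).
  have i3 := le_trans (proj1 (small n)) i2.
  by move: i1 i3; rewrite ler_norml; clear -d_gt0 delta_min U_bounded V_bounded uU lV => /andP[? ?] ?; lra.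
have : [/\ \int[dgam q]_z cost (z.1 - z.2) = 0, cost (dx q - dw q) = 0 & cost (dw q - dy q) = 0].
  have c1 : 0 <= \int[dgam q]_z cost (z.1 - z.2) by apply: expect_ge0 => z; exact: cost_ge0.
  have c2 := cost_ge0 (dx q - dw q); have c3 := cost_ge0 (dw q - dy q).
  by move: mis0 c1 c2 c3; rewrite /mismatch; clear -d_gt0 delta_min U_bounded V_bounded uU lV; split; lra.
move=> [g0 /cost_eq0/subr0_eq xw /cost_eq0/subr0_eq wy].
have close (e : R) : 0 < e -> \forall n \near Uf, `|dt (qn n) - ds (qn n)| <= e.
  move=> e0; have e2 : 0 < e ^+ 2 by rewrite exprn_gt0.
  have := inv0 _ e2; apply: filterS => n ne; have [_ h] := small n.
  rewrite -(@ler_pXn2r _ 2)// ?nnegrE// ?(ltW e0)// real_normK ?num_real//.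
  exact: le_trans ne.
have [tT sT cq] := admq.
(* For every n one of the two times exceeds T - 1 / (n + 1), and the penalty brings the other one
   close to it. *)
have last (e : R) : 0 < e -> T - e <= dt q /\ T - e <= ds q.
  move=> e0; have e4 : 0 < e / 4 by rewrite divr_gt0.
  have h1 : \forall n \near Uf, `|dt q - dt (qn n)| <= e / 4.
    by move/cvgrPdist_le : ct => /(_ _ e4).
  have h2 : \forall n \near Uf, `|ds q - ds (qn n)| <= e / 4.
    by move/cvgrPdist_le : cs => /(_ _ e4).
  have h12 : \forall n \near Uf, `|dt q - dt (qn n)| <= e / 4 /\ `|ds q - ds (qn n)| <= e / 4 by exact: filterI.
  have h34 : \forall n \near Uf, `|dt (qn n) - ds (qn n)| <= e / 4 /\ n.+1%:R^-1 <= e / 4.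
    by apply: filterI; [exact: close|exact: inv0].
  have [n [/= [i1 i2] [i3 i4]]] := filter_ex2 _ h12 h34.
  have [_ _ _ _ hnot] := hq n.
  have : T - e / 4 < dt (qn n) \/ T - e / 4 < ds (qn n).
    have [h|h] := ltP (T - e / 4) (dt (qn n)); first by left.
    right; rewrite ltNge; apply/negP => h'; apply: hnot; split.
      by move: h i4; clear -d_gt0 delta_min U_bounded V_bounded uU lV; move: (n.+1%:R^-1) => r; lra.
    by move: h' i4; clear -d_gt0 delta_min U_bounded V_bounded uU lV; move: (n.+1%:R^-1) => r; lra.
  move: i1 i2 i3; rewrite !ler_norml; clear -d_gt0 delta_min U_bounded V_bounded uU lV => /andP[? ?] /andP[? ?] /andP[? ?].
  by case=> ?; split; lra.
have tE : dt q = T.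
  apply/eqP; rewrite eq_le; have /andP[_ ->] := tT; apply/ler_addgt0Pr => e e0.
  by have [+ _] := last e e0; rewrite lerBlDr.
have sE : ds q = T.
  apply/eqP; rewrite eq_le; have /andP[_ ->] := sT; apply/ler_addgt0Pr => e e0.
  by have [_ +] := last e e0; rewrite lerBlDr.
have d4 : 0 < del / 4 by rewrite divr_gt0.
have tTn n : 0 <= dt (qn n) <= T by have [] := adm n.
have sTn n : 0 <= ds (qn n) <= T by have [] := adm n.
(* The terminal condition compares U and V at one and the same measure; as the limit coupling has
   zero cost, the second measures also converge to [dmu q]. *)
have cnu' : dnu (qn n) @[n --> Uf] --> dmu q by exact: (cvg_cost0 _ cq g0 cnu).
have h1 : \forall n \near Uf, U (dt (qn n)) (dmu (qn n)) (dx (qn n)) <= U (dt q) (dmu q) (dx q) + del / 4.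
  exact: (usc_limit _ uU tTn tT ct cmu cx d4).
have h2 : \forall n \near Uf, V (ds q) (dmu q) (dy q) <= V (ds (qn n)) (dnu (qn n)) (dy (qn n)) + del / 4.
  exact: (lsc_limit _ lV sTn sT cs cnu' cy d4).
have [n [/= i1 i2]] := filter_ex2 _ h1 h2.
have [_ _ _ dg _] := hq n.
have := UVT (dmu q) (dx q).
move: i1 i2 dg; rewrite /gap tE sE xw wy; move: del0; clear -d_gt0 delta_min U_bounded V_bounded uU lV; lra.
Unshelve. all: by end_near. Qed.

End coupling_limits.

(** * Comparison *)

Section one_variable_bounds.
Context {R : realType}.

(** The derivative of sigma may be unbounded near T, so the Lipschitz constant depends on b < T. *)
Lemma smooth_on_lipschitz (T b : R) (f : R -> R) : smooth_on `[0, T[ f -> b < T ->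
  exists2 L, 0 <= L & forall s t, 0 <= s <= b -> 0 <= t <= b -> `|f s - f t| <= L * `|s - t|.
Proof.
move=> [A [g [_ AT gf dg]]] bT.
have Ab t : 0 <= t <= b -> A t.
  by move=> /andP[t0 tb]; apply: AT; rewrite /= in_itv/= t0 (le_lt_trans tb).
have fE t : 0 <= t <= b -> f t = g t.
  by move=> /andP[t0 tb]; rewrite gf//= in_itv/= t0 (le_lt_trans tb).
have [b0|b0] := ltP b 0.
  exists 0 => // s t /andP[s0 sb]; by have := le_lt_trans (le_trans s0 sb) b0; rewrite ltxx.
have c1 : {within `[0, b], continuous (derive1 g)}.
  apply: continuous_in_subspaceT => t; rewrite inE/= in_itv/= => /Ab At.
  have /derivable1_diffP/differentiable_continuous := dg 1%N t At; exact.
have [M [_ hM]] : exists M, 0 <= M /\ forall t, 0 <= t <= b -> `|derive1 g t| <= M.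
  have cn : {within `[0, b], continuous (fun t => `|derive1 g t|)}.
    by move=> t; apply: continuous_comp; [exact: c1|exact: norm_continuous].
  have [c cb hc] := EVT_max b0 cn.
  exists `|derive1 g c|; split => // t tb; apply: hc; by rewrite in_itv.
exists (Num.max M 0); first by rewrite le_max lexx orbT.
have key s t : 0 <= s <= b -> 0 <= t <= b -> s < t -> `|f s - f t| <= Num.max M 0 * `|s - t|.
  move=> sb tb st; rewrite fE// (fE t)//.
  have sub x : x \in `[s, t] -> 0 <= x <= b.
    rewrite in_itv/= => /andP[sx xt]; have /andP[s0 _] := sb; have /andP[_ tb'] := tb.
    by rewrite (le_trans s0)// (le_trans xt).
  have dfx x : x \in `[s, t] -> derivable g x 1 by move=> /sub/Ab; exact: (dg 0%N).
  have [x xst] : exists2 c, c \in `]s, t[ & g t - g s = derive1 g c * (t - s).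
    apply: MVT => // [x xst|].
      rewrite derive1E; apply: DeriveDef => //; apply: dfx; exact: subset_itv_oo_cc xst.
    apply: continuous_in_subspaceT => x; rewrite inE/= => /dfx.
    by move/derivable1_diffP/differentiable_continuous.
  move=> E; rewrite distrC (distrC s) E normrM ler_wpM2r// le_max hM//.
  by apply: sub; exact: subset_itv_oo_cc xst.
move=> s t sb tb; case: (ltgtP s t) => [st|st|->]; first exact: key.
  by rewrite distrC (distrC s); exact: key.
by rewrite !subrr normr0 mulr0.
Qed.

End one_variable_bounds.

Section gradient_bound.
Context {R : realType} {d : nat}.
Local Notation Rd := 'rV[R]_d.

Lemma derive_gradient (f : Rd -> R) x v : differentiable f x -> 'D_v f x = dot (gradient f x) v.
Proof.
move=> df; rewrite deriveE// {1}(row_sum_delta v) linear_sum; apply: eq_bigr => i _.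
by rewrite linearZ/= mxE deriveE// mulrC.
Qed.

Lemma is_derive_line (f : Rd -> R) (x v : Rd) (t : R) : differentiable f (x + t *: v) ->
  is_derive t 1 (fun s : R => f (x + s *: v)) (dot (gradient f (x + t *: v)) v).
Proof.
move=> df; rewrite -derive_gradient//.
have E : (fun h : R => h^-1 *: ((fun s : R => f (x + s *: v)) (h *: 1 + t) - f (x + t *: v))) =
         (fun h : R => h^-1 *: (f (h *: v + (x + t *: v)) - f (x + t *: v))).
  apply/funext => h; congr (_ *: (f _ - _)).
  by rewrite -[h *: 1]/(h * 1) mulr1 scalerDl addrCA.
apply: DeriveDef; last by rewrite /derive/= /shift/= E.
have : derivable f (x + t *: v) v by exact: diff_derivable.
by rewrite /derivable/= /shift/= -E.
Qed.

(** Mean value theorem on the segment from q to p, which stays in the ball of radius M. *)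
Lemma gradient_lipschitz (f : Rd -> R) (M B : R) :
  (forall p, differentiable f p) -> (forall p, enorm p <= M -> enorm (gradient f p) <= B) ->
  forall p q, enorm p <= M -> enorm q <= M -> `|f p - f q| <= B * enorm (p - q).
Proof.
move=> df gB p q pM qM.
have [c /andP[c0 c1]] := mean_value ltr01 (fun t => is_derive_line (df (q + t *: (p - q)))).
rewrite scale1r scale0r addr0 subr0 mulr1 (addrC q (p - q)) subrK => ->.
rewrite (le_trans (normr_dot_le _ _))// ler_wpM2r ?enorm_ge0// gB//.
have -> : q + c *: (p - q) = c *: p + (1 - c) *: q.
  by rewrite scalerBr scalerBl scale1r addrCA.
rewrite (le_trans (enormD _ _))// !enormZ !ger0_norm ?(ltW c0) ?subr_ge0 ?(ltW c1)//.
have := ler_wpM2l (ltW c0) pM; have : 0 <= 1 - c by rewrite subr_ge0 ltW.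
by move=> /(ler_wpM2l)/(_ _ _ qM); lra.
Qed.

End gradient_bound.

(** * Comparison of the Hamiltonian terms *)

Section hamiltonian_comparison.
Context {R : realType} {d : nat}.
Local Notation Td := (torus R d).
Local Notation Pd := (Ptorus R d).
Local Notation Rd := 'rV[R]_d.
Local Notation twopi := ((pi : R) *+ 2).
Variables (delta : Td -> Td -> Rd) (delta_min : minimal_difference delta).

Let root (u : Td) : R := Num.sqrt (cost u).

Lemma bmeas_sqrt dS (S : measurableType dS) (f : S -> R) : bmeas f -> bmeas (fun x => Num.sqrt (f x)).
Proof.
move=> [mf [M hM]]; split.
  apply: (measurableT_comp _ mf); apply: continuous_measurable_fun; exact: sqrt_continuous.
exists (Num.sqrt M) => x; rewrite ger0_norm ?sqrtr_ge0// ler_wsqrtr// (le_trans _ (hM x))//.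
exact: ler_norm.
Qed.

Lemma expect_sqrt dS (S : measurableType dS) (P : probability S R) (f : S -> R) :
  bmeas f -> (forall x, 0 <= f x) -> \int[P]_x Num.sqrt (f x) <= Num.sqrt (\int[P]_x f x).
Proof.
move=> bf f0; have bs := bmeas_sqrt bf.
have h : (\int[P]_x Num.sqrt (f x)) ^+ 2 <= \int[P]_x f x.
  rewrite (le_trans (expect_sqr _ bs))//; under eq_Rintegral do rewrite sqr_sqrtr//.
  exact: lexx.
rewrite -[leLHS]ger0_norm ?expect_ge0// -?sqrtr_sqr ?ler_wsqrtr//.
Qed.

Lemma tdist_root (x y : Td) : tdist x y <= root (x - y).
Proof. by have := ler_wsqrtr (tdist_cost x y); rewrite sqrtr_sqr ger0_norm ?tdist_ge0. Qed.

Lemma W2_le (mu nu : Pd) gam : coupling mu nu gam ->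
  W2 mu nu <= Num.sqrt (\int[gam]_q cost (q.1 - q.2)).
Proof.
move=> cg; apply: ler_wsqrtr; apply: (@le_trans _ _ (transport_cost gam)).
  apply: ge_inf; last by exists gam.
  by exists 0 => _ [g _ <-]; apply: expect_ge0 => q; exact: sqr_ge0.
apply: expect_le; [apply: bmeasX; exact: bmeas_tdist delta_min|exact: bmeas_costB|].
by move=> q; exact: tdist_cost.
Qed.

Lemma potg_diag (q : Td * Td) : potg (q, q.1) = twopi *: \row_i sn (q.1 - q.2) i.
Proof. by apply/rowP => i; rewrite !mxE /= subrr sn0 cs0 mulr1 mulr0 addr0. Qed.

Lemma twopi_ge0 : 0 <= twopi. Proof. by rewrite mulrn_wge0 ?pi_ge0. Qed.

Lemma enorm_potg_diag (q : Td * Td) : enorm (potg (q, q.1)) <= 2 * twopi * root (q.1 - q.2).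
Proof.
rewrite potg_diag enormZ (ger0_norm twopi_ge0) -mulrA mulrCA ler_wpM2l ?twopi_ge0//.
apply: enorm_le; first by rewrite mulr_ge0// sqrtr_ge0.
rewrite exprMn sqr_sqrtr ?cost_ge0// /dot /cost mulr_sumr; apply: ler_sum => i _.
rewrite !mxE; have := cs2Dsn2 (q.1 - q.2) i; have := cs_bound (q.1 - q.2) i.
by rewrite ler_norml; move: (cs _ _) (sn _ _) => c s /andP[c1 c2] h; nra.
Qed.

(** With c = cos (x - q.1), both the square of r (c - 1) and s^2 are at most 2 (1 - c), so each
    coordinate has square at most (4 + 64) (1 - c) <= 9^2 (1 - c). *)
Lemma enorm_potg_sub (q : Td * Td) (x : Td) :
  enorm (potg (q, x) - potg (q, q.1)) <= 9 * twopi * root (x - q.1).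
Proof.
rewrite potg_diag.
have -> : potg (q, x) - twopi *: \row_i sn (q.1 - q.2) i =
  twopi *: \row_i (sn (q.1 - q.2) i * (cs (x - q.1) i - 1) + 4 * sn (x - q.1) i).
  by apply/rowP => i; rewrite !mxE /=; ring.
rewrite enormZ (ger0_norm twopi_ge0) -mulrA mulrCA ler_wpM2l ?twopi_ge0//.
apply: enorm_le; first by rewrite mulr_ge0// sqrtr_ge0.
rewrite exprMn sqr_sqrtr ?cost_ge0// /dot /cost mulr_sumr; apply: ler_sum => i _.
rewrite !mxE; have := cs2Dsn2 (x - q.1) i; have := cs_bound (x - q.1) i; have := sn_bound (q.1 - q.2) i.
rewrite !ler_norml; move: (cs _ _) (sn (x - q.1) _) (sn _ _) => c s r /andP[r1 r2] /andP[c1 c2] h.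
have s2 : s ^+ 2 <= 2 * (1 - c) by nra.
have a2 : (r * (c - 1)) ^+ 2 <= 2 * (1 - c).
  have r3 : r ^+ 2 <= 1 by nra.
  have c3 : (c - 1) ^+ 2 <= 2 * (1 - c) by nra.
  rewrite exprMn; apply: le_trans c3; rewrite ler_piMl ?sqr_ge0//.
have := sqr_ge0 (r * (c - 1) - 4 * s); nra.
Qed.

Variables (H : R -> Td -> Pd -> Rd -> R) (C : R) (C_gt0 : 0 < C) (T : R).
Hypotheses
  (H_continuous :
    {within [set q : R * Td * Pd * Rd | 0 <= q.1.1.1],
      continuous (fun q => H q.1.1.1 q.1.1.2 q.1.2 q.2)})
  (H_differentiable : forall t x mu p, 0 <= t -> differentiable (H t x mu) p)
  (H_lipschitz : forall p s t mu nu x y, 0 <= s -> 0 <= t ->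
    `|H t x mu p - H s y nu p|
      <= C * (1 + enorm p) * (`|t - s| + W2 mu nu + tdist x y))
  (H_growth : forall t x mu p, 0 <= t <= T ->
    `|H t x mu p| <= C * (1 + enorm p ^+ 2))
  (DH_growth : forall t x mu p, 0 <= t <= T ->
    enorm (gradient (H t x mu) p) <= C * (1 + enorm p)).

(* The Hamiltonian terms of frozen_touching are compared with those at the
   maximizing coupling, where the momentum potg (q, q.1) is of the order of the
   distance between the coupled points. *)
Lemma H_lipschitz_p t x mu M p q : 0 <= t <= T -> enorm p <= M -> enorm q <= M ->
  `|H t x mu p - H t x mu q| <= C * (1 + M) * enorm (p - q).
Proof.
move=> tT; have /andP[t0 _] := tT; apply: gradient_lipschitz => [p'|p' pM].
  exact: H_differentiable.
by rewrite (le_trans (DH_growth _ _ _ tT))// ler_pM2l// lerD2l.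
Qed.

Lemma bmeas_H_diag t mu (a : R) (g : probability (Td * Td)%type R) : 0 <= t <= T ->
  bmeas (fun q : Td * Td => H t q.1 mu (a *: potg (q, q.1))).
Proof.
move=> tT.
have md : measurable_fun setT (fun q : Td * Td => (q, q.1)) by exact: measurable_fun_pair.
exact: (bmeas_comp md (H_plan_bmeas delta_min H_continuous C_gt0 H_growth mu a tT)).
Qed.

(** The constant is of order a^2, which is harmless: it multiplies displacements that go to 0 at
    fixed k. In the factor 2 + 9 * 2 pi |a|, the two units come from W2 and from the displacement of
    x, the rest from the change of momentum. *)
Lemma H_plan_compare (a t tb : R) (g : probability (Td * Td)%type R) (mu mub : Pd) G :
  0 <= t <= T -> 0 <= tb <= T -> plan_of g mu G -> (forall A : set Td, measurable A -> g (fst @^-1` A) = mub A) ->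
  `|\int[G]_z H t z.2 mu (a *: potg z) - \int[g]_q H tb q.1 mub (a *: potg (q, q.1))| <=
  C * (1 + `|a| * (d%:R * (5 * twopi))) * (2 + 9 * twopi * `|a|)
    * (`|t - tb| + Num.sqrt (displacement_cost G)).
Proof.
move=> tT tbT pl hg; have /andP[t0 _] := tT; have /andP[tb0 _] := tbT.
set M := `|a| * _; set rho := Num.sqrt (displacement_cost G).
have PM (z : (Td * Td) * Td) : enorm (a *: potg z) <= M by rewrite enormZ; apply: ler_wpM2l => //; exact: enorm_potg_le.
have b1 := H_plan_bmeas delta_min H_continuous C_gt0 H_growth mu a tT.
have b2 := bmeas_H_diag mub a g tbT.
rewrite -(expect_fst (proj1 pl) b2) -expectB//; last exact: (bmeas_comp measurable_fst b2).
have b3 := bmeasB b1 (bmeas_comp (@measurable_fst _ _ (Td * Td)%type Td) b2).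
rewrite (le_trans (expect_norm _ b3))//.
have mv : measurable_fun setT (fun z : (Td * Td) * Td => (z.2, z.1.1)) := measurable_displacement.
have bcost := @bmeas_displacement_cost R d.
have broot := bmeas_sqrt bcost.
have W : W2 mu mub <= rho.
  (* The pair of the moved point and its original position couples mu and mub. *)
  have cg : coupling mu mub (law G mv).
    move=> A mA; split; rewrite lawE.
      by rewrite -(proj2 pl)//; congr (G _); apply/seteqP; split => z //= [].
    rewrite -hg// -(proj1 pl); last by rewrite -[X in measurable X]setTI; exact: measurable_fst.
    by congr (G _); apply/seteqP; split => z //= [].
  by have := W2_le cg; rewrite expect_law//; exact: bmeas_costB.
pose Q := C * (1 + M) * (`|t - tb| + rho).
pose S := C * (1 + M) * (1 + 9 * twopi * `|a|).
apply: (@le_trans _ _ (\int[G]_z (Q + S * Num.sqrt (cost (z.2 - z.1.1))))).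
  apply: expect_le; first exact: bmeas_norm b3.
    by apply: bmeasD; [exact: bmeas_cst|exact: bmeasZ].
  move=> z /=.
  rewrite -(subrKA (H tb z.1.1 mub (a *: potg z))) (le_trans (ler_normD _ _))//.
  have h1 := H_lipschitz (a *: potg z) mu mub z.2 z.1.1 tb0 t0.
  have h2 := H_lipschitz_p z.1.1 mub tbT (PM z) (PM (z.1, z.1.1)).
  have h3 : `|t - tb| + W2 mu mub + tdist z.2 z.1.1 <= `|t - tb| + rho + Num.sqrt (cost (z.2 - z.1.1)).
    by rewrite lerD ?lerD// tdist_root.
  have h4 : C * (1 + enorm (a *: potg z)) * (`|t - tb| + W2 mu mub + tdist z.2 z.1.1) <=
      C * (1 + M) * (`|t - tb| + rho + Num.sqrt (cost (z.2 - z.1.1))).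
    rewrite ler_pM//.
    - by rewrite mulr_ge0// ?(ltW C_gt0)// addr_ge0// enorm_ge0.
    - by rewrite !addr_ge0 ?tdist_ge0 ?sqrtr_ge0.
    - by rewrite ler_pM2l// lerD2l.
  have h5 : enorm (a *: potg z - a *: potg (z.1, z.1.1)) <= `|a| * (9 * twopi * Num.sqrt (cost (z.2 - z.1.1))).
    rewrite -scalerBr enormZ ler_wpM2l//; case: z {h1 h2 h3 h4} => q x; exact: enorm_potg_sub.
  have CM : 0 <= C * (1 + M) by rewrite mulr_ge0 ?(ltW C_gt0)// addr_ge0// (le_trans _ (PM z))// enorm_ge0.
  have h6 := ler_wpM2l CM h5.
  rewrite /Q /S; lra.
rewrite (expectD _ (bmeas_cst _ Q) (bmeasZ S broot)) expect_cst expectZ//.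
have h7 : \int[G]_z Num.sqrt (cost (z.2 - z.1.1)) <= rho by apply: expect_sqrt => // z; exact: cost_ge0.
have M0 : 0 <= M by rewrite mulr_ge0// mulr_ge0// mulr_ge0// twopi_ge0.
have S0 : 0 <= S.
  by rewrite /S mulr_ge0 ?mulr_ge0 ?(ltW C_gt0) ?addr_ge0// ?mulr_ge0 ?twopi_ge0.
have h8 := ler_wpM2l S0 h7.
have h9 : 0 <= C * (1 + M) * (1 + 9 * twopi * `|a|) * `|t - tb| by exact: mulr_ge0.
rewrite /Q /S in h8 h9 *; lra.
Qed.

(** Both sides carry the same momentum, of size at most w times the root of the cost, so only the
    Lipschitz bound in (t, x, mu) is used. The term without decay in rho or in the time gap is
    absent; the worst one, k rho^2, is what the penalty controls. *)
Lemma H_coupling_compare (k tb sb : R) (g : probability (Td * Td)%type R) (mub nub : Pd) :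
  0 <= k -> 0 <= tb <= T -> 0 <= sb <= T -> coupling mub nub g ->
  forall rho, rho = Num.sqrt (\int[g]_q cost (q.1 - q.2)) ->
  \int[swap_law g]_q H sb q.1 nub (- k *: potg (q, q.1)) - \int[g]_q H tb q.1 mub (k *: potg (q, q.1)) <=
  C * (`|tb - sb| + 2 * rho + 2 * twopi * k * (`|tb - sb| * rho + 2 * rho ^+ 2)).
Proof.
move=> k0 tbT sbT cg rho rhoE; have /andP[tb0 _] := tbT; have /andP[sb0 _] := sbT.
have b1 := bmeas_H_diag mub k g tbT.
have b2 := bmeas_H_diag nub (- k) g sbT.
rewrite expect_law//=.
(* Swapping the pair changes the sign of [sn], which offsets the sign of - k. *)
have E q : - k *: potg ((q.2, q.1), q.2) = k *: potg (q, q.1) :> Rd.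
  apply/rowP => i; rewrite !mxE /= !subrr sn0 cs0 -(opprB q.1) snN; ring.
rewrite [X in X - _](_ : _ = \int[g]_q H sb q.2 nub (k *: potg (q, q.1))); last first.
  by apply: eq_Rintegral => q _; rewrite E.
have b3 : bmeas (fun q : Td * Td => H sb q.2 nub (k *: potg (q, q.1))).
  rewrite [X in bmeas X](_ : _ = (fun q => H sb (q.2, q.1).1 nub (- k *: potg ((q.2, q.1), (q.2, q.1).1)))).
    exact: (bmeas_comp (@measurable_swap _ Td _ Td) b2).
  by apply/funext => q /=; rewrite E.
rewrite -expectB//.
have bc := @bmeas_costB R d; have br := bmeas_sqrt bc.
have rho2 : rho ^+ 2 = \int[g]_q cost (q.1 - q.2).
  by rewrite rhoE sqr_sqrtr//; apply: expect_ge0 => q; exact: cost_ge0.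
have W : W2 nub mub <= rho.
  have cg' : coupling nub mub (swap_law g).
    by move=> A mA; split; rewrite /swap_law lawE; have [h1 h2] := cg A mA; [rewrite -h2|rewrite -h1].
  have := W2_le cg'; rewrite expect_law; last exact: bc.
  by rewrite rhoE; congr (_ <= Num.sqrt _); apply: eq_Rintegral => q _ /=; rewrite -costN opprB.
pose w := 2 * twopi * k.
have w0 : 0 <= w by rewrite !mulr_ge0// twopi_ge0.
pose D := `|tb - sb| + rho.
have D0 : 0 <= D by rewrite addr_ge0// rhoE sqrtr_ge0.
apply: (@le_trans _ _ (\int[g]_q (C * (D + (w * D + 1) * Num.sqrt (cost (q.1 - q.2)) + w * cost (q.1 - q.2))))).
  apply: expect_le; first exact: bmeasB.
    by apply: bmeasZ; apply: bmeasD; [apply: bmeasD; [exact: bmeas_cst|exact: bmeasZ]|exact: bmeasZ].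
  move=> q; rewrite (le_trans (ler_norm _))// (le_trans (H_lipschitz _ _ _ _ _ tb0 sb0))// -mulrA ler_pM2l//.
  have n1 : enorm (k *: potg (q, q.1)) <= w * Num.sqrt (cost (q.1 - q.2)).
    by rewrite enormZ ger0_norm// /w [leRHS]mulrAC [leRHS]mulrC ler_wpM2l// enorm_potg_diag.
  have n2 : `|sb - tb| + W2 nub mub + tdist q.2 q.1 <= D + Num.sqrt (cost (q.1 - q.2)).
    by rewrite distrC lerD ?lerD// -costN opprB tdist_root.
  apply: (@le_trans _ _ ((1 + w * Num.sqrt (cost (q.1 - q.2))) * (D + Num.sqrt (cost (q.1 - q.2))))).
    apply: ler_pM => //; last by rewrite lerD2l.
      by rewrite addr_ge0// enorm_ge0.
    by rewrite !addr_ge0 ?tdist_ge0 ?sqrtr_ge0.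
  have := sqr_sqrtr (cost_ge0 (q.1 - q.2)); move: (Num.sqrt _) => r <-.
  by rewrite le_eqVlt; apply/orP; left; apply/eqP; ring.
have bD := bmeasD (bmeas_cst _ D) (bmeasZ (w * D + 1) br).
rewrite (expectZ _ C (bmeasD bD (bmeasZ w bc))) ler_pM2l//.
rewrite (expectD _ bD (bmeasZ w bc)) (expectD _ (bmeas_cst _ D) (bmeasZ (w * D + 1) br)).
rewrite !expectZ// expect_cst -rho2.
have h7 : \int[g]_q Num.sqrt (cost (q.1 - q.2)) <= rho by rewrite rhoE; apply: expect_sqrt => // z; exact: cost_ge0.
have wD : 0 <= w * D + 1 by rewrite addr_ge0// mulr_ge0.
have := ler_wpM2l wD h7; rewrite -/w /D; lra.
Qed.

End hamiltonian_comparison.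

(** * The final estimate and the contradiction *)

Section comparison.
Context {R : realType} {d : nat} (d_gt0 : (0 < d)%N).
Local Notation Td := (torus R d).
Local Notation Pd := (Ptorus R d).
Local Notation Rd := 'rV[R]_d.
Local Notation twopi := ((pi : R) *+ 2).

Lemma le_of_linear_error (a b kap h0 : R) : 0 < h0 -> 0 <= kap ->
  (forall h, 0 < h <= h0 -> a <= b + kap * h) -> a <= b.
Proof.
move=> h00 kap0 hyp; apply/ler_addgt0Pr => e e0.
have k1 : 0 < kap + 1 by rewrite ltr_wpDl.
pose h := Num.min h0 (e / (kap + 1)).
have hpos : 0 < h by rewrite lt_min h00 divr_gt0.
have := hyp h; rewrite hpos ge_min lexx => /(_ isT) /le_trans; apply; rewrite lerD2l.
apply: (@le_trans _ _ (kap * (e / (kap + 1)))); first by rewrite ler_wpM2l// ge_min lexx orbT.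
by rewrite mulrCA ler_piMr ?(ltW e0)// ler_pdivrMr// mul1r lerDl.
Qed.

Lemma sqr_lipschitz (f : R -> R) (A : set R) M L : (forall t, A t -> `|f t| <= M) ->
  (forall s t, A s -> A t -> `|f s - f t| <= L * `|s - t|) ->
  forall s t, A s -> A t -> `|f s ^+ 2 - f t ^+ 2| <= 2 * M * L * `|s - t|.
Proof.
move=> fM fL s t As At; rewrite subr_sqr normrM mulrC.
rewrite -(mulrA _ L) ler_pM//; last exact: fL.
by rewrite (le_trans (ler_normD _ _))// mulr_natl mulr2n lerD// fM.
Qed.

(* The weight k ^+ 3, like any power at least 2, makes k |t - s| <= z, which
   absorbs the variation of sigma^2 against a Laplacian of order k. *)
Lemma final_estimate (delta : Td -> Td -> Rd) (delta_min : minimal_difference delta)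
    (T : R) (T_gt0 : 0 < T) (sigma : R -> R) (sigma_smooth : smooth_on `[0, T[ sigma)
    (sigma_bounded : exists M, forall t, 0 <= t < T -> `|sigma t| <= M)
    (H : R -> Td -> Pd -> Rd -> R)
    (H_continuous : {within [set q : R * Td * Pd * Rd | 0 <= q.1.1.1],
       continuous (fun q => H q.1.1.1 q.1.1.2 q.1.2 q.2)})
    (H_differentiable : forall t x mu p, 0 <= t -> differentiable (H t x mu) p)
    (C : R) (C_gt0 : 0 < C)
    (H_lipschitz : forall p s t mu nu x y, 0 <= s -> 0 <= t ->
      `|H t x mu p - H s y nu p| <= C * (1 + enorm p) * (`|t - s| + W2 mu nu + tdist x y))
    (H_growth : forall t x mu p, 0 <= t <= T -> `|H t x mu p| <= C * (1 + enorm p ^+ 2))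
    (DH_growth : forall t x mu p, 0 <= t <= T -> enorm (gradient (H t x mu) p) <= C * (1 + enorm p))
    (U V : R -> Pd -> Td -> R)
    (U_bounded : exists M, forall t mu w, 0 <= t <= T -> `|U t mu w| <= M)
    (V_bounded : exists M, forall t mu w, 0 <= t <= T -> `|V t mu w| <= M)
    (U_sub : viscosity_subsolution delta T sigma H U)
    (V_super : viscosity_supersolution delta T sigma H V) (r : R) (r_gt0 : 0 < r) :
  exists B : R, forall (c k z : R) q, 1 <= k -> 0 <= z <= 1 -> admissible T q ->
    (forall q', admissible T q' -> Phi T U V c k (k ^+ 3) q' <= Phi T U V c k (k ^+ 3) q) ->
    penalty k (k ^+ 3) q <= z ^+ 2 -> dt q <= T - r -> ds q <= T - r ->
    2 * c <= B * z.
Proof.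
have r2T : T - r / 2 < T by rewrite ltrBlDr ltrDl divr_gt0.
have [Ls Ls0 hLs] := smooth_on_lipschitz sigma_smooth r2T.
have [Ms0 hMs0] := sigma_bounded; pose Ms := `|Ms0|.
have Ms_ge0 : 0 <= Ms by exact: normr_ge0.
have hMs t : 0 <= t < T -> `|sigma t| <= Ms by move=> /hMs0 h; rewrite (le_trans h)// ler_norm.
pose L := 2 * Ms * Ls.
have L0 : 0 <= L by rewrite !mulr_ge0.
pose A := [set t | 0 <= t <= T - r / 2].
have AM (t : R) : A t -> `|sigma t| <= Ms.
  by move=> /andP[t0 tr]; apply: hMs; rewrite t0 (le_lt_trans tr).
have sigL (s t : R) : A s -> A t -> `|sigma s ^+ 2 - sigma t ^+ 2| <= L * `|s - t|.
  by apply: sqr_lipschitz => // s' t'; exact: hLs.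
pose W := twopi ^+ 2.
have W0 : 0 <= W by exact: sqr_ge0.
have tp0 : 0 <= twopi by exact: twopi_ge0.
exists (C * (3 + 6 * twopi) + L * (W * d%:R + 1)) => c k z [tb sb mub nub g xb wb yb].
rewrite /admissible /penalty /mismatch /= => k1 /andP[z0 z1] [tbT sbT cg] hmax pen tbr sbr.
have k0 : 0 < k by exact: lt_le_trans k1.
pose K : R := k ^+ 3; have K0 : 0 <= K by rewrite exprn_ge0// ltW.
have hmax' t s mu nu gam x w y : 0 <= t <= T -> 0 <= s <= T -> coupling mu nu gam ->
    penalized T U V c k K t s mu nu gam x w y <= penalized T U V c k K tb sb mub nub g xb wb yb.
  move=> tT sT cgam; have := hmax (Doubled t s mu nu gam x w y) (And3 tT sT cgam).
  by rewrite /Phi /gap /penalty /mismatch /penalized /= !opprD !addrA.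
set D := \int[g]_q cost (q.1 - q.2) in pen.
have D0 : 0 <= D by apply: expect_ge0 => q; exact: cost_ge0.
pose rho := Num.sqrt D.
have rho2 : rho ^+ 2 = D by rewrite sqr_sqrtr.
have rho0 : 0 <= rho by exact: sqrtr_ge0.
pose Dt : R := `|tb - sb|; have Dt0 : 0 <= Dt by exact: normr_ge0.
have penD : k * D <= z ^+ 2.
  have c1 := cost_ge0 (xb - wb); have c2 := cost_ge0 (wb - yb); have s2 := sqr_ge0 (tb - sb).
  have h : D <= D + cost (xb - wb) + cost (wb - yb) by rewrite -addrA lerDl addr_ge0.
  by move: pen (ler_wpM2l (ltW k0) h) (mulr_ge0 K0 s2); rewrite -/K; clear -d_gt0; lra.
have penT : K * Dt ^+ 2 <= z ^+ 2.
  apply: le_trans pen; rewrite /Dt real_normK ?num_real// ler_wpDl// mulr_ge0 ?(ltW k0)//.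
  by rewrite !addr_ge0// cost_ge0.
have kDt : k * Dt <= z.
  rewrite -(@ler_pXn2r _ 2) ?nnegrE// ?mulr_ge0 ?(ltW k0)//; apply: le_trans penT.
  by rewrite exprMn /K ler_wpM2r ?sqr_ge0// exprS ler_peMl ?sqr_ge0.
have krho : k * rho ^+ 2 <= z.
  by rewrite rho2 (le_trans penD)// expr2 ler_piMl.
have rhoz : rho <= z.
  rewrite -(@ler_pXn2r _ 2) ?nnegrE// rho2; apply: le_trans penD; rewrite ler_peMl//.
have Dtz : Dt <= z by apply: le_trans kDt; rewrite ler_peMl.
have kDrho : k * (Dt * rho) <= z.
  by rewrite mulrA -[leRHS]mulr1 ler_pM ?mulr_ge0 ?(ltW k0)// (le_trans rhoz).
pose Ak := C * (1 + k * (d%:R * (5 * twopi))) * (2 + 9 * twopi * k).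
pose J := C * (Dt + 2 * rho + 2 * twopi * k * (Dt * rho + 2 * rho ^+ 2)).
pose Q : R := k * W * d%:R + 1.
have Q0 : 0 <= Q by rewrite /Q addr_ge0 ?mulr_ge0 ?(ltW k0).
pose P := J + L * Dt * Q / 2.
have Ak0 : 0 <= Ak.
  by rewrite /Ak !mulr_ge0 ?addr_ge0 ?mulr_ge0 ?(ltW C_gt0) ?(ltW k0).
(* [kap] gathers, at fixed k, the factors of all the errors vanishing with h; [P] is what remains in
   the limit. *)
pose kap := 2 * (4 * K + 2) + 4 * Ak + L * Q + Ms ^+ 2.
have kap0 : 0 <= kap.
  have h1 : 0 <= L * Q by exact: mulr_ge0.
  have h2 := sqr_ge0 Ms; move: h1 h2 Ak0 K0; rewrite /kap; clear -d_gt0; lra.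
(* The precision e = h^2 / 2 makes every displacement at most h, and h <= r / 2 keeps the touching
   times below T - r / 2, where the viscosity inequalities and the Lipschitz bound on sigma^2 are
   available. *)
have main (h : R) : 0 < h <= Num.min 1 (r / 2) -> 2 * c <= P + kap * h.
  rewrite le_min => /and3P[h0 h1 hr].
  have e0 : 0 < h ^+ 2 / 2 by rewrite divr_gt0// exprn_gt0.
  have [Lb [L1 [L2 [t [s [mu [nu [G1 [G2 [[tT sT pl1 pl2] [loc1 loc2] [hL hL1 hL2] sub sup]]]]]]]]]] :=
    frozen_touching d_gt0 delta_min (ltW T_gt0) H_continuous C_gt0 H_growth U_sub U_bounded
      V_super V_bounded k0 K0 e0 tbT sbT cg hmax'.
  have h2 : 2 * (h ^+ 2 / 2) = h ^+ 2 by rewrite mulrC divfK.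
  rewrite h2 in loc1 loc2.
  have loc (x y : R) (G : probability ((Td * Td) * Td)%type R) : (x - y) ^+ 2 + k * displacement_cost G <= h ^+ 2 ->
      `|x - y| <= h /\ Num.sqrt (displacement_cost G) <= h.
    move=> hh; have dc := displacement_cost_ge0 G; have sq := sqr_ge0 (x - y).
    have kd : displacement_cost G <= k * displacement_cost G by rewrite ler_peMl.
    split; first by rewrite -(@ler_pXn2r _ 2) ?nnegrE ?(ltW h0)// real_normK ?num_real//; move: hh dc kd; clear -d_gt0; lra.
    by rewrite -(@ler_pXn2r _ 2) ?nnegrE ?sqrtr_ge0 ?(ltW h0)// sqr_sqrtr//; move: hh sq kd; clear -d_gt0; lra.
  have [lt1 ld1] := loc _ _ _ loc1; have [lt2 ld2] := loc _ _ _ loc2.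
  have close (x y : R) : `|x - y| <= h -> y <= T - r -> 0 <= x <= T -> A x /\ x < T.
    rewrite ler_norml => /andP[_ hh] yr /andP[x0 _].
    have xr : x <= T - r / 2 by move: hh yr hr; clear -d_gt0; lra.
    by rewrite /A /= x0 xr; split => //; exact: le_lt_trans r2T.
  have [At tT'] := close _ _ lt1 tbr tT; have [As sT'] := close _ _ lt2 sbr sT.
  have := sub tT'; have := sup sT'.
  have cmp1 := H_plan_compare delta_min C_gt0 H_continuous H_differentiable H_lipschitz H_growth DH_growth k tT tbT pl1 (fun A' mA => proj1 (cg A' mA)).
  have hg' (A' : set Td) : measurable A' -> swap_law g (fst @^-1` A') = nub A'.
    by move=> mA; rewrite /swap_law lawE -(proj2 (cg A' mA)).
  have cmp2 := H_plan_compare delta_min C_gt0 H_continuous H_differentiable H_lipschitz H_growth DH_growth (- k) sT sbT pl2 hg'.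
  have cmp3 := H_coupling_compare delta_min C_gt0 H_continuous H_lipschitz H_growth (ltW k0) tbT sbT cg (erefl rho).
  move: cmp1 cmp2 cmp3; rewrite normrN (gtr0_norm k0) -/Ak -/J.
  set I1 := \int[G1]_z _; set I2 := \int[G2]_z _; set J1 := \int[g]_q _; set J2 := \int[swap_law g]_q _.
  rewrite -/Dt => cmp1 cmp2 cmp3 sup' sub'.
  have b1 : `|I1 - J1| <= Ak * (2 * h).
    by rewrite (le_trans cmp1)// ler_wpM2l// mulr_natl mulr2n lerD.
  have b2 : `|I2 - J2| <= Ak * (2 * h).
    by rewrite (le_trans cmp2)// ler_wpM2l// mulr_natl mulr2n lerD.
  have bL : `|Lb| <= Q.
    rewrite (le_trans hL)// lerD2l ler_pdivrMr// mul1r (@le_trans _ _ 1)// ?ler1n//.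
    by rewrite exprn_ile1// ltW.
  have ts : `|t - s| <= 2 * h + Dt.
    have -> : t - s = (t - tb) + (tb - sb) - (s - sb) by clear -d_gt0; ring.
    rewrite (le_trans (ler_normB _ _))// (le_trans (lerD (ler_normD _ _) (lexx _)))// -/Dt.
    by move: lt1 lt2; clear -d_gt0; lra.
  have s1 := sqr_ge0 (sigma t); have s2 := sqr_ge0 (sigma s).
  have m1 : sigma t ^+ 2 <= Ms ^+ 2.
    by rewrite -(real_normK (num_real (sigma t))) ler_pXn2r ?nnegrE// AM.
  have m2 : sigma s ^+ 2 <= Ms ^+ 2.
    by rewrite -(real_normK (num_real (sigma s))) ler_pXn2r ?nnegrE// AM.
  have eh : h ^+ 2 / 2 <= h / 2 by rewrite ler_pM2r// expr2 ler_piMl// ltW.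
  have h20 : 0 <= h / 2 by rewrite divr_ge0// ltW.
  (* Both Laplacians are replaced by the common value [Lb] up to errors of order h; [Lb], of order
     k, is then multiplied only by the difference of the values of sigma^2. *)
  have d1 : sigma t ^+ 2 * L1 <= sigma t ^+ 2 * Lb + Ms ^+ 2 * (h / 2).
    move: (ler_wpM2l s1 hL1) (ler_wpM2r h20 m1) (ler_wpM2l s1 eh); clear -d_gt0; lra.
  have d2 : sigma s ^+ 2 * Lb - Ms ^+ 2 * (h / 2) <= sigma s ^+ 2 * L2.
    move: (ler_wpM2l s2 hL2) (ler_wpM2r h20 m2) (ler_wpM2l s2 eh); clear -d_gt0; lra.
  have d3 : (sigma t ^+ 2 - sigma s ^+ 2) * Lb <= L * (2 * h + Dt) * Q.
    rewrite (le_trans (ler_norm _))// normrM ler_pM// (le_trans (sigL _ _ At As))// ler_wpM2l//.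
  have K42 : 0 <= 4 * K + 2 by move: K0; clear -d_gt0; lra.
  have n1 : (4 * K + 2) * (t - tb) <= (4 * K + 2) * h.
    by rewrite ler_wpM2l// (le_trans (ler_norm _)).
  have n2 : (4 * K + 2) * (s - sb) <= (4 * K + 2) * h.
    by rewrite ler_wpM2l// (le_trans (ler_norm _)).
  move: (mulr_ge0 (sqr_ge0 Ms) (ltW h0)) sub' sup' b1 b2 cmp3 d1 d2 d3 n1 n2; rewrite !ler_norml /P /kap; clear -d_gt0.
  move=> ? ? ? /andP[? ?] /andP[? ?] ? ? ? ? ? ?; lra.
have h00 : 0 < Num.min 1 (r / 2) by rewrite lt_min ltr01 divr_gt0.
apply: (le_trans (le_of_linear_error h00 kap0 main)).
rewrite /P mulrDl lerD//.
  rewrite -[leRHS]mulrA /J ler_wpM2l ?(ltW C_gt0)//.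
  have h : k * (Dt * rho) + 2 * (k * rho ^+ 2) <= 3 * z by move: kDrho krho; clear -d_gt0; lra.
  by move: (ler_wpM2l tp0 h) Dtz rhoz; clear -d_gt0; lra.
have h : Dt * Q <= (W * d%:R + 1) * z.
  have Wd0 : 0 <= W * d%:R by rewrite mulr_ge0.
  by move: (ler_wpM2l Wd0 kDt) Dtz; rewrite /Q; clear -d_gt0; lra.
have h' : 0 <= L * (Dt * Q) by rewrite !mulr_ge0.
by move: (ler_wpM2l L0 h) h'; clear -d_gt0; lra.
Qed.

End comparison.

(** A sequence bounded below cannot lose more than e at every step from N on. *)
Lemma small_decrement (R : realType) (m p : nat -> R) (a e : R) (N : nat) : 0 < e ->
  (forall n, a <= m n) -> (forall n, m n.+1 + p n <= m n) -> exists2 n, (N <= n)%N & p n <= e.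
Proof.
move=> e0 ma dec; apply: contrapT => hn.
have step n : (N <= n)%N -> m n.+1 + e <= m n.
  move=> Nn; apply: le_trans (dec n); rewrite lerD2l leNgt; apply/negP => /ltW pe.
  by apply: hn; exists n.
have iter j : m (N + j)%N + j%:R * e <= m N.
  elim: j => [|j ih]; first by rewrite addn0 mul0r addr0.
  rewrite (le_trans _ ih)// addnS -natr1 mulrDl mul1r (addrC _ e) addrA lerD2r.
  by rewrite step// leq_addr.
have := archi_boundP (normr_ge0 ((m N - a) / e)); set j := Num.bound _ => hj.
have := le_lt_trans (ler_norm _) hj; rewrite ltr_pdivrMr// ltNge => /negP; apply.
by rewrite lerBrDl (le_trans _ (iter j))// lerD2r.
Qed.

Section doubling.
Context {R : realType} {d : nat}.

(* Hence the maxima of Phi decrease along k = 2^n, by at least half of the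
   penalty at the maximizers, which therefore gets small. *)
Lemma penalty_double (k : R) (q : @doubled R d) : 0 <= k ->
  penalty k (k ^+ 3) q + penalty (2 * k) ((2 * k) ^+ 3) q / 2 <= penalty (2 * k) ((2 * k) ^+ 3) q.
Proof.
move=> k0; have := mulr_ge0 (exprn_ge0 3 k0) (sqr_ge0 (dt q - ds q)).
by rewrite /penalty exprMn; lra.
Qed.
End doubling.

Theorem proposition2p21 (R : realType) (d : nat) (d_gt0 : (0 < d)%N)
  (delta : torus R d -> torus R d -> 'rV[R]_d)
  (delta_min : minimal_difference delta)
  (T : R) (T_gt0 : 0 < T)
  (sigma : R -> R)
  (sigma_smooth : smooth_on `[0, T[ sigma)
  (sigma_bounded : exists M, forall t, 0 <= t < T -> `|sigma t| <= M)
  (H : R -> torus R d -> Ptorus R d -> 'rV[R]_d -> R)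
  (H_continuous :
    {within [set q : R * torus R d * Ptorus R d * 'rV[R]_d | 0 <= q.1.1.1],
      continuous (fun q => H q.1.1.1 q.1.1.2 q.1.2 q.2)})
  (H_differentiable : forall t x mu p, 0 <= t -> differentiable (H t x mu) p)
  (C : R) (C_gt0 : 0 < C)
  (H_lipschitz : forall p s t mu nu x y, 0 <= s -> 0 <= t ->
    `|H t x mu p - H s y nu p|
      <= C * (1 + enorm p) * (`|t - s| + W2 mu nu + tdist x y))
  (H_growth : forall t x mu p, 0 <= t <= T ->
    `|H t x mu p| <= C * (1 + enorm p ^+ 2))
  (DH_growth : forall t x mu p, 0 <= t <= T ->
    enorm (gradient (H t x mu) p) <= C * (1 + enorm p))
  (U V : R -> Ptorus R d -> torus R d -> R)
  (U_bounded : exists M, forall t mu w, 0 <= t <= T -> `|U t mu w| <= M)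
  (V_bounded : exists M, forall t mu w, 0 <= t <= T -> `|V t mu w| <= M)
  (U_sub : viscosity_subsolution delta T sigma H U)
  (V_super : viscosity_supersolution delta T sigma H V)
  (UV_terminal : forall mu w, U T mu w <= V T mu w) :
  forall t mu w, 0 <= t <= T -> U t mu w <= V t mu w.
Proof.
move=> t0 mu0 w0 t0T; rewrite leNgt; apply/negP => UV.
have uU := U_sub.1; have lV := V_super.1; have T0 := ltW T_gt0.
(* On the diagonal point [q0] the penalty is 0, so Phi there is at least 3 del - 2 c T; with c = del
   / T this is del, hence every maximum of Phi is at least del. *)
pose del : R := (U t0 mu0 w0 - V t0 mu0 w0) / 3.
have del0 : 0 < del by rewrite divr_gt0// subr_gt0.
pose c : R := del / T; have c0 : 0 < c by exact: divr_gt0.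
have cT : c * T = del by rewrite /c divfK// gt_eqF.
have mdiag : measurable_fun setT (fun x : torus R d => (x, x)).
  exact: measurable_fun_pair.
pose q0 := Doubled t0 t0 mu0 mu0 (law mu0 mdiag) w0 w0 w0.
have adm0 : admissible T q0.
  split=> //= A mA; rewrite !lawE; split; congr (mu0 _).
have pen0 k K : penalty k K q0 = 0.
  rewrite /penalty /mismatch /= !subrr cost0 !addr0 expr0n mulr0 addr0.
  rewrite expect_law; last exact: bmeas_costB.
  have -> : (fun x : torus R d => cost ((x, x).1 - (x, x).2) : R) = fun=> 0.
    by apply: funext => x; rewrite subrr cost0.
  by rewrite expect_cst mulr0.
pose kk n : R := 2 ^+ n.
have kk0 n : 0 <= kk n by rewrite exprn_ge0.
have kk1 n : 1 <= kk n by rewrite exprn_ege1// ler1n.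
have kkS n : kk n.+1 = 2 * kk n by rewrite /kk exprS.
have max_ex n : {q | admissible T q & forall q', admissible T q' ->
    Phi T U V c (kk n) (kk n ^+ 3) q' <= Phi T U V c (kk n) (kk n ^+ 3) q}.
  apply: cid2.
  exact: (Phi_max d_gt0 delta_min uU lV U_bounded V_bounded (ltW c0) (kk0 n) (exprn_ge0 3 (kk0 n)) adm0).
pose Q n := s2val (max_ex n).
have Qadm n : admissible T (Q n) by exact: s2valP (max_ex n).
have Qmax n q : admissible T q ->
    Phi T U V c (kk n) (kk n ^+ 3) q <= Phi T U V c (kk n) (kk n ^+ 3) (Q n).
  exact: s2valP' (max_ex n) q.
pose m n : R := Phi T U V c (kk n) (kk n ^+ 3) (Q n).
have mdel n : del <= m n.
  apply: le_trans (Qmax n _ adm0); rewrite /Phi pen0 /gap /=.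
  have -> : U t0 mu0 w0 - V t0 mu0 w0 = 3 * del by rewrite /del mulrCA mulfV ?mulr1.
  have /andP[t00 _] := t0T.
  by move: (mulr_ge0 (ltW c0) t00) del0; rewrite -cT; clear -d_gt0; lra.
have gap_ge n : del <= gap U V (Q n).
  have := mdel n; rewrite /m /Phi; have [/andP[_ h1] /andP[_ h2] _] := Qadm n.
  have cc := ltW c0.
  have p0 : 0 <= penalty (kk n) (kk n ^+ 3) (Q n) by rewrite penalty_ge0// exprn_ge0.
  have e1 : 0 <= c * (T - dt (Q n)) by rewrite mulr_ge0// subr_ge0.
  have e2 : 0 <= c * (T - ds (Q n)) by rewrite mulr_ge0// subr_ge0.
  by move: p0 e1 e2; clear -d_gt0; lra.
pose p n : R := penalty (kk n.+1) (kk n.+1 ^+ 3) (Q n.+1).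
have mdec n : m n.+1 + p n / 2 <= m n.
  apply: le_trans (Qmax n _ (Qadm n.+1)); rewrite /m /Phi.
  by move: (penalty_double (Q n.+1) (kk0 n)); rewrite -kkS -/(p n); clear -d_gt0; lra.
have [r r0 [N hN]] := terminal_gap d_gt0 delta_min uU lV del0 UV_terminal.
have [B hB] := final_estimate d_gt0 delta_min T_gt0 sigma_smooth sigma_bounded H_continuous
  H_differentiable C_gt0 H_lipschitz H_growth DH_growth U_bounded V_bounded U_sub V_super r0.
(* Chosen so that B z <= c, which is incompatible with the conclusion 2 c <= B z of
   [final_estimate]. *)
pose z : R := Num.min 1 (c / (`|B| + 1)).
have B1 : 0 < `|B| + 1 by rewrite ltr_wpDl.
have z0 : 0 < z by rewrite lt_min ltr01 divr_gt0.
have z1 : z <= 1 by rewrite ge_min lexx.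
have Bz : B * z <= c.
  apply: (@le_trans _ _ ((`|B| + 1) * z)).
    by rewrite ler_wpM2r ?(ltW z0)// (le_trans (ler_norm _))// lerDl.
  by rewrite mulrC -ler_pdivlMr// ge_min lexx orbT.
have [n Nn pn] := small_decrement N (divr_gt0 (exprn_gt0 2 z0) (@ltr0Sn R 1)) mdel mdec.
have {}pn : p n <= z ^+ 2 by rewrite -(@ler_pM2r _ (2^-1)).
have Nk : N%:R <= kk n.+1.
  by rewrite /kk -natrX ler_nat (leq_trans Nn)// ltnW// (ltn_trans (ltnSn n))// ltn_expl.
have p1 : p n <= 1 by rewrite (le_trans pn)// exprn_ile1// ltW.
have kle : kk n.+1 <= kk n.+1 ^+ 3 by rewrite exprS ler_peMr// exprn_ege1.
have [dT sT] := hN _ _ _ Nk kle (Qadm n.+1) p1 (gap_ge n.+1).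
have z01 : 0 <= z <= 1 by rewrite z1 ltW.
have := hB c (kk n.+1) z (Q n.+1) (kk1 _) z01 (Qadm _) (Qmax _) pn dT sT.
by move: Bz c0; clear -d_gt0; lra.
Qed.
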